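(* Let $\tau:\Omega_H\to[0,T]$ be a bounded raw stopping time. There is a canonical contractive truncation $\mathsf T_\tau:\mathbb H_{\mathcal P}^2\to\mathbb H_{\mathcal P}^2$, written $\mathsf T_\tau Z=:\mathbf 1_{[0,\tau]}Z$, obtained as the upper-energy limit of the dyadic predictable stopping truncations $\mathbf 1_{[0,\tau_n]}Z$ ($\tau_n$ the dyadic ceiling of $\tau$). It satisfies $$I(\mathbf 1_{[0,\tau]}Z)=r_\tau I(Z)\quad\text{in }\mathbb S_{\mathcal P}^2,$$ and $\mathsf T_\sigma\mathsf T_\tau=\mathsf T_{\sigma\wedge\tau}$ for bounded raw stopping times $\sigma,\tau$. It is continuous in the horizon: if $\sup_{\omega\in\Omega_H}|\tau_n(\omega)-\tau(\omega)|\to0$ for bounded raw stopping times $\tau_n,\tau$, then for every $Z\in\mathbb H_{\mathcal P}^2$, $$\|\mathsf T_{\tau_n}Z-\mathsf T_\tau Z\|_{\mathbb H_{\mathcal P}^2}+\|r_{\tau_n}I(Z)-r_\tau I(Z)\|_{\mathbb S_{\mathcal P}^2}\to0.$$ Moreover $$\|\mathbf 1_{[0,\tau]}Z\|_{\mathbb H_{\mathcal P}^2}=\|I_\tau(Z)\|_{\mathcal L_{\mathcal P}^2},$$ in particular $\|\mathbf 1_{[0,t]}Z\|_{\mathbb H_{\mathcal P}^2}=\|I_t(Z)\|_{\mathcal L_{\mathcal P}^2}$ for deterministic $t$. Consequently $$\|Z\|_{\mathbb H_{\mathcal P}^2}=\|I_T(Z)\|_{\mathcal L_{\mathcal P}^2}\le\|I(Z)\|_{\mathbb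 S_{\mathcal P}^2}\le2\|Z\|_{\mathbb H_{\mathcal P}^2}.$$ In particular, on the stable first-jet graph $\mathscr W$, $$d_{\mathscr W}((Y,Z),(\widetilde Y,\widetilde Z))=\|Y-\widetilde Y\|_{\mathbb S_{\mathcal P}^2}+\|I_T(Z-\widetilde Z)\|_{\mathcal L_{\mathcal P}^2}.$$
   Context: $0<T<\infty$, $H$ nonzero separable real Hilbert, $\Gamma\in\mathcal S_1(H)_+$ (positive trace class). $\Omega_H=C_0([0,T];H)$, coordinate process $X$, raw filtration $\mathcal F_t^0=\sigma(X_s:s\le t)$; raw stopping times are stopping times of this filtration; $(r_\tau Y)_t=Y_{t\wedge\tau}$. $\mathfrak M_\Gamma$ is the set of laws under which $X$ is a continuous local martingale with operator bracket $\int a_t^Pdt$, $0\preceq a_t^P\preceq\Gamma$ a.e.; $\mathcal P\subset\mathfrak M_\Gamma$ is nonempty. $\|\xi\|_{\mathcal L_{\mathcal P}^2}=\sup_{P\in\mathcal P}(E^P|\xi|^2)^{1/2}$; $\mathbb S_{\mathcal P}^2$ is the closed space generated by Borel continuous real raw-adapted processes of finite norm $\|Y\|_{\mathbb S_{\mathcal P}^2}=\sup_P(E^P\sup_t|Y_t|^2)^{1/2}$ (modulo quasi-sure equality). $\mathbb H_{\mathcal P}^2$ is the completion, after quotienting the null space, of bounded elementary raw-predictable $H$-valued processes $Z=\sum_kZ_k\mathbf 1_{(t_k,t_{k+1}]}$ in the seminorm $\sup_P(E^P\int_0^T\langle a_t^PZ_t,Z_t\rangle dt)^{1/2}$. The pathwise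 step integral $I_t(Z)=\sum_k\langle Z_k,X_{t\wedge t_{k+1}}-X_{t\wedge t_k}\rangle$ extends uniquely to a bounded injective linear map $I:\mathbb H_{\mathcal P}^2\to\mathbb S_{\mathcal P}^2$ with closed range, projecting under each $P$ to the classical It\^o integral. Dyadic ceiling: $\tau_n=\min\{kT2^{-n}\ge\tau\}$. Stable first-jet graph. $\mathscr W\subset\mathbb S_{\mathcal P}^2\times\mathbb H_{\mathcal P}^2$ is the closure of the set of pairs $([Y],[D_Q^{\rm pw}Y])$, $Y$ ranging over an admissible backward testing core, with $d_{\mathscr W}((Y,Z),(\widetilde Y,\widetilde Z))=\|Y-\widetilde Y\|_{\mathbb S_{\mathcal P}^2}+\|Z-\widetilde Z\|_{\mathbb H_{\mathcal P}^2}$. Here an admissible backward testing core is a linear class, invariant under deterministic stopping, of bounded raw-adapted continuous trajectories $Y$ with a linear pathwise covariation algorithm $[Y,\langle X,h\rangle]^{\rm pw}$ ($h$ in the algebraic span $H_0$ of a fixed orthonormal basis), such that: under every $P\in\mathcal P$, $Y$ is a continuous square-integrable special semimartingale (canonical decomposition with a square-integrable martingale part and a predictable finite-variation part) and the pathwise covariations agree $P$-a.s. with the classical ones; they are absolutely continuous with predictable densities $\lambda^Y_t(h)$ obeying, off a set null for all $P\in\mathcal P$, for a.e. $t$ and all $h\in H_0$, $|\lambda_t^Y(h)|\le g_t^Y\langle\mathfrak a_th,h\rangle^{1/2}$ with $g^Y\ge0$ predictable and $\sup_PE^P\int_0^T|g_t^Y|^2dt<\infty$, where $\mathfrak a$ is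 the common predictable bracket density ($\mathfrak a=a^P$ $dt\otimes P$-a.e. for all $P\in\mathcal P$); the predictable process $U_t^Y\in\overline{\operatorname{Ran}\mathfrak a_t^{1/2}}$ determined by $\lambda_t^Y(h)=\langle U_t^Y,\mathfrak a_t^{1/2}h\rangle$ is the limit, in $\sup_P(E^P\int_0^T\|\cdot\|_H^2dt)^{1/2}$, of $\mathfrak a^{1/2}Z^n$ with $Z^n$ bounded elementary predictable, and $[D_Q^{\rm pw}Y]\in\mathbb H_{\mathcal P}^2$ denotes the limit class of $Z^n$; the covariation algorithm is linear and stopping compatible, $D_Q^{\rm pw}(r_tY)=\mathbf 1_{[0,t]}D_Q^{\rm pw}Y$; and the set of pairs above is separable. *)

(* Defs.v *)
From HB Require Import structures.
From mathcomp Require Import all_boot all_order all_algebra.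
From mathcomp Require Import all_classical all_reals all_analysis.

Set Implicit Arguments.
Unset Strict Implicit.
Unset Printing Implicit Defensive.

Import Order.TTheory GRing.Theory Num.Theory.
Import numFieldNormedType.Exports.

Local Open Scope classical_set_scope.
Local Open Scope ring_scope.

(* Completeness is carried by H, so H with an [inner_product] is a real Hilbert
   space. *)
Record inner_product (R : realType) (H : normedModType R) := InnerProduct {
  ip_fun :> H -> H -> R;
  ip_sym : forall x y, ip_fun x y = ip_fun y x;
  ip_linear : forall (c : R) x y z,
    ip_fun (c *: x + y) z = c * ip_fun x z + ip_fun y z;
  ip_norm : forall x, ip_fun x x = `|x| ^+ 2 }.

Definition separable_space (V : topologicalType) : Prop :=
  exists2 D : set V, countable D & dense D.

Section Operators.
Context (R : realType) (H : completeNormedModType R) (ip : inner_product H).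

Definition self_adjoint (A : H -> H) : Prop :=
  [/\ (forall (c : R) x y, A (c *: x + y) = c *: A x + A y),
      continuous A & forall x y, ip (A x) y = ip x (A y)].

Definition nonneg_op (A : H -> H) : Prop :=
  self_adjoint A /\ forall x, 0 <= ip (A x) x.

Definition loewner_le (A B : H -> H) : Prop :=
  forall x, ip (A x) x <= ip (B x) x.

Definition lin_span (B : set H) : set H :=
  [set x | exists (n : nat) (c : 'I_n -> R) (e : 'I_n -> H),
     (forall i, B (e i)) /\ x = \sum_(i < n) c i *: e i].

Definition orthonormal_basis (B : set H) : Prop :=
  [/\ (forall x, B x -> ip x x = 1),
      (forall x y, B x -> B y -> x <> y -> ip x y = 0)
    & dense (lin_span B)].

Definition pos_trace_class (A : H -> H) : Prop :=
  nonneg_op A /\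
  exists2 B, orthonormal_basis B & (\esum_(e in B) (ip (A e) e)%:E < +oo)%E.

(* The unique nonnegative self-adjoint square root when A is nonnegative. *)
Definition op_sqrt (A : H -> H) : H -> H :=
  xget (fun _ => 0) [set S : H -> H | nonneg_op S /\ S \o S = A].

End Operators.

(* Trajectories indexed by [0,T] are functions on R extended by constants outside
   [0,T], so that each one has a unique representative. *)
Section Paths.
Context (R : realType) (T : R).

Definition clamp (t : R) : R := Num.min T (Num.max 0 t).

Definition traj (V : normedModType R) : set (R -> V) :=
  [set f | continuous f /\ forall t, f t = f (clamp t)].

Definition traj0 (V : normedModType R) : set (R -> V) :=
  [set f | traj f /\ f 0 = 0].

Definition path_space (V : normedModType R) : Type := set_type (@traj0 V).

Lemma traj0_cst0 (V : normedModType R) : (fun _ : R => 0 : V) \in @traj0 V.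
Proof. by rewrite inE; split=> //; split=> // t; exact: cst_continuous. Qed.

HB.instance Definition _ (V : normedModType R) :=
  Choice.copy (path_space V) (set_type (@traj0 V)).
HB.instance Definition _ (V : normedModType R) :=
  isPointed.Build (path_space V) (SigSub (@traj0_cst0 V)).

Definition coord (V : normedModType R) (t : R) (w : path_space V) : V := val w t.

Definition sup_open (V : normedModType R) : set (set (path_space V)) :=
  [set U | forall w, U w -> exists2 e : R, 0 < e &
     forall w', (forall t, `|coord t w - coord t w'| < e) -> U w'].

End Paths.

(* Omega_H = C_0([0,T];H) with its Borel sigma-algebra. *)
Definition Omega (R : realType) (T : R) (H : normedModType R) :=
  g_sigma_algebraType (@sup_open R T H).

Section Processes.
Context (R : realType) (T : R) (H : completeNormedModType R)
  (ip : inner_product H).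
Local Notation Om := (Omega T H).
Local Notation prob := (probability Om R).
Local Notation leb := (@lebesgue_measure R).

Definition X (t : R) (w : Om) : H := coord t w.

Definition F0 (t : R) : set (set Om) :=
  <<s [set A | exists s (B : set H),
         [/\ 0 <= s <= t, (<<s open >>) B & A = X s @^-1` B]] >>.

Definition F_measurable (F : set (set Om)) (V : normedModType R)
    (f : Om -> V) : Prop :=
  forall B : set V, (<<s open >>) B -> F (f @^-1` B).

Definition raw_stopping (tau : Om -> R) : Prop :=
  (forall w, 0 <= tau w <= T) /\
  forall t, 0 <= t <= T -> F0 t [set w | tau w <= t].

Definition stopped (V : Type) (tau : Om -> R) (Y : Om -> R -> V) : Om -> R -> V :=
  fun w t => Y w (Num.min t (tau w)).

Definition raw_adapted (V : normedModType R) (Y : Om -> R -> V) : Prop :=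
  forall t, 0 <= t <= T -> F_measurable (F0 t) (fun w => Y w t).

Definition predictable_sets : set (set (R * Om)) :=
  <<s (`[0, T]%classic `*` setT),
    [set C | (exists2 A, F0 0 A & C = [set 0] `*` A) \/
       (exists s t A, [/\ 0 <= s, s <= t, t <= T, F0 s A
                        & C = `]s, t]%classic `*` A])] >>.

Definition predictable (V : normedModType R) (Y : Om -> R -> V) : Prop :=
  forall B : set V, (<<s open >>) B ->
    predictable_sets [set p | p.1 \in `[0, T] /\ B (Y p.2 p.1)].

Definition martingale (P : prob) (M : Om -> R -> R) : Prop :=
  [/\ @raw_adapted R M,
      (forall t, 0 <= t <= T -> P.-integrable setT (fun w => (M w t)%:E))
    & forall s t A, 0 <= s -> s <= t -> t <= T -> F0 s A ->
        (\int[P]_(w in A) (M w s)%:E = \int[P]_(w in A) (M w t)%:E)%E].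

Definition localizing (P : prob) (sigma : nat -> Om -> R) : Prop :=
  [/\ (forall n, raw_stopping (sigma n)),
      (forall n w, sigma n w <= sigma n.+1 w)
    & {ae P, forall w, exists n, sigma n w = T}].

Definition local_martingale (P : prob) (M : Om -> R -> R) : Prop :=
  exists2 sigma, localizing P sigma &
    forall n, martingale P (fun w t => stopped (sigma n) M w t - M w 0).

(* Bochner martingales: norm-integrable, with the identity between H-valued
   integrals tested against h : H. *)
Definition coord_local_martingale (P : prob) : Prop :=
  exists2 sigma, localizing P sigma &
    forall n,
      (forall t, 0 <= t <= T ->
         P.-integrable setT (fun w => (`|X (Num.min t (sigma n w)) w|)%:E)) /\
      forall h, martingale P (stopped (sigma n) (fun w t => ip (X t w) h)).

(* a is the density of the operator bracket of X under P, with 0 <= a <= Gamma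
   dt (x) P-a.e. *)
Definition bracket_density (Gamma : H -> H) (P : prob)
    (a : Om -> R -> H -> H) : Prop :=
  [/\ (forall w t, self_adjoint ip (a w t)),
      (forall h k, @predictable R (fun w t => ip (a w t h) k)),
      {ae (leb \x P)%E, forall p : R * Om, p.1 \in `[0, T] ->
         nonneg_op ip (a p.2 p.1) /\ loewner_le ip (a p.2 p.1) Gamma}
    & forall h k, local_martingale P (fun w t =>
        ip (X t w) h * ip (X t w) k -
        \int[leb]_(s in `[0, t]) ip (a w s h) k)].

Definition law_class (Gamma : H -> H) : set prob :=
  [set P | coord_local_martingale P /\ exists a, bracket_density Gamma P a].

Section Upper.
Variables (PP : set prob) (a : prob -> Om -> R -> H -> H).

Definition upper_L2 (xi : Om -> R) : \bar R :=
  ereal_sup [set Lnorm P 2%:E (fun w => (xi w)%:E) | P in PP].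

Definition S2_norm (Y : Om -> R -> R) : \bar R :=
  ereal_sup [set Lnorm P 2%:E (fun w =>
    ereal_sup [set (`|Y w t|)%:E | t in `[0, T]]) | P in PP].

Definition energy (Z : Om -> R -> H) : \bar R :=
  ereal_sup [set ((\int[P]_w \int[leb]_(t in `[0%R, T])
    (ip (a P w t (Z w t)) (Z w t))%:E) `^ (2^-1))%E | P in PP].

Definition upper_L2_field (U : Om -> R -> H) : \bar R :=
  ereal_sup [set ((\int[P]_w \int[leb]_(t in `[0%R, T])
    (`|U w t| ^+ 2)%:E) `^ (2^-1))%E | P in PP].

Definition quasi_surely (Q : Om -> Prop) : Prop :=
  forall P, PP P -> {ae P, forall w, Q w}.

Definition qs_eq (Y Y' : Om -> R -> R) : Prop :=
  quasi_surely (fun w => forall t, 0 <= t <= T -> Y w t = Y' w t).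

(* Elements of the space S^2 are handled through representatives: S2 is the set
   of representatives and [qs_eq] the equality. *)
Definition cont_process (Y : Om -> R -> R) : Prop :=
  (forall w, traj T (Y w)) /\
  forall t, measurable_fun setT (fun w : Om => Y w t).

Definition S2_gen (Y : Om -> R -> R) : Prop :=
  [/\ cont_process Y, @raw_adapted R Y & (S2_norm Y < +oo)%E].

Definition S2 (Y : Om -> R -> R) : Prop :=
  cont_process Y /\
  forall e : R, 0 < e -> exists2 Y', S2_gen Y' & (S2_norm (Y - Y')%R < e%:E)%E.

Record step_process := StepProcess {
  step_size : nat;
  step_time : nat -> R;
  step_val : nat -> Om -> H;
  step_time_itv : forall k, (k <= step_size)%N -> 0 <= step_time k <= T;
  step_time_mono : forall k, (k < step_size)%N -> step_time k < step_time k.+1;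
  step_val_bounded : exists C : R,
    forall k w, (k < step_size)%N -> `|step_val k w| <= C;
  step_val_raw : forall k, (k < step_size)%N ->
    F_measurable (F0 (step_time k)) (step_val k) }.

Definition step_field (z : step_process) : Om -> R -> H := fun w t =>
  \sum_(k < step_size z)
    if step_time z k < t <= step_time z k.+1 then step_val z k w else 0.

Definition step_integral (z : step_process) : Om -> R -> R := fun w t =>
  \sum_(k < step_size z)
    ip (step_val z k w)
       (X (Num.min t (step_time z k.+1)) w - X (Num.min t (step_time z k)) w).

Definition elementary : set (Om -> R -> H) :=
  [set Z | exists z, Z = step_field z].

(* (HH, j) is the completion of the elementary fields modulo the null space of
   the energy seminorm, i.e. it is the space H^2; j is only meaningful on
   elementary fields. *)
Definition energy_completion (HH : completeNormedModType R)
    (j : (Om -> R -> H) -> HH) : Prop :=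
  [/\ (forall (c : R) Z Z', elementary Z -> elementary Z' ->
         j (c *: Z + Z') = c *: j Z + j Z'),
      (forall Z, elementary Z -> (`|j Z|)%:E = energy Z)
    & dense (j @` elementary)].

Section Jets.
Context (HH : completeNormedModType R) (j : (Om -> R -> H) -> HH).

(* The bounded linear extension of the pathwise step integral; the clauses
   determine I up to [qs_eq]. *)
Definition step_integral_extension (I : HH -> Om -> R -> R) : Prop :=
  [/\ (forall Z, S2 (I Z)),
      (forall (c : R) Z Z', qs_eq (I (c *: Z + Z')) (c *: I Z + I Z')),
      (exists C : R, forall Z, (S2_norm (I Z) <= (C * `|Z|)%:E)%E)
    & forall z, qs_eq (I (j (step_field z))) (step_integral z)].

Definition contraction (L : HH -> HH) : Prop :=
  (forall (c : R) Z Z', L (c *: Z + Z') = c *: L Z + L Z') /\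
  forall Z, `|L Z| <= `|Z|.

Definition restrict (rho : Om -> R) (Z : Om -> R -> H) : Om -> R -> H :=
  fun w t => if 0 <= t <= rho w then Z w t else 0.

Definition pointwise_truncation (rho : Om -> R) (L : HH -> HH) : Prop :=
  contraction L /\
  forall Z, elementary Z ->
    elementary (restrict rho Z) /\ L (j Z) = j (restrict rho Z).

Definition dyadic_ceil (tau : Om -> R) (n : nat) : Om -> R := fun w =>
  (Num.ceil (tau w * 2 ^+ n / T))%:~R * (T / 2 ^+ n).

(* L is the strong limit of the truncations at the dyadic ceilings of tau. *)
Definition truncation (tau : Om -> R) (L : HH -> HH) : Prop :=
  contraction L /\
  exists2 D : nat -> HH -> HH,
    (forall n, pointwise_truncation (dyadic_ceil tau n) (D n)) &
    forall Z, D n Z @[n --> \oo] --> L Z.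

Definition semimartingale (P : prob) (Y : Om -> R -> R) : Prop :=
  exists M A : Om -> R -> R,
  [/\ martingale P M,
      (forall t, 0 <= t <= T -> (\int[P]_w ((M w t) ^+ 2)%:E < +oo)%E),
      @predictable R A
    & {ae P, forall w,
        [/\ M w 0 = 0 /\ A w 0 = 0,
            (forall t, 0 <= t <= T -> Y w t = Y w 0 + M w t + A w t),
            {within `[0, T], continuous (M w)},
            {within `[0, T], continuous (A w)}
          & bounded_variation 0 T (A w)]}].

(* [Y,N] = C under P: limit in probability of the sums of products of
   increments along deterministic partitions whose mesh tends to 0. *)
Definition covariation (P : prob) (Y N C : Om -> R -> R) : Prop :=
  [/\ (forall t, 0 <= t <= T -> measurable_fun setT (fun w : Om => C w t)),
      {ae P, forall w, {within `[0, T], continuous (C w)}}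
    & forall t, 0 <= t <= T -> forall e : R, 0 < e ->
        exists2 delta : R, 0 < delta &
        forall (m : nat) (p : nat -> R),
          p 0%N = 0 -> p m = t ->
          (forall i, (i < m)%N -> 0 <= p i.+1 - p i <= delta) ->
          (P [set w | (e <= `|\sum_(i < m) (Y w (p i.+1) - Y w (p i)) *
                                (N w (p i.+1) - N w (p i)) - C w t|)%R]
             <= e%:E)%E].

Definition common_bracket_density (frak : Om -> R -> H -> H) : Prop :=
  [/\ (forall w t, self_adjoint ip (frak w t)),
      (forall h k, @predictable R (fun w t => ip (frak w t h) k))
    & forall P, PP P -> {ae (leb \x P)%E, forall p : R * Om,
        p.1 \in `[0, T] -> frak p.2 p.1 = a P p.2 p.1}].

Variables (B : set H) (frak : Om -> R -> H -> H).
Local Notation H0 := (lin_span B).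
Local Notation rt := (fun w t => op_sqrt ip (frak w t)).

Definition ae_time (Q : R -> Prop) : Prop :=
  {ae leb, forall t, t \in `[0, T] -> Q t}.

Definition has_density (C lambda : H -> Om -> R -> R) : Prop :=
  forall h, H0 h ->
    @predictable R (lambda h) /\
    quasi_surely (fun w =>
      leb.-integrable `[0, T] (fun t => (lambda h w t)%:E) /\
      forall t, 0 <= t <= T ->
        C h w t = \int[leb]_(s in `[0, t]) lambda h w s).

Definition dominated (lambda : H -> Om -> R -> R) (g : Om -> R -> R) : Prop :=
  [/\ @predictable R g,
      (forall w t, 0 <= g w t),
      (ereal_sup [set \int[P]_w \int[leb]_(t in `[0%R, T])
         ((g w t) ^+ 2)%:E | P in PP] < +oo)%E
    & quasi_surely (fun w => ae_time (fun t => forall h, H0 h ->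
        `|lambda h w t| <= g w t * Num.sqrt (ip (frak w t h) h)))].

Definition represents (lambda : H -> Om -> R -> R) (U : Om -> R -> H) : Prop :=
  @predictable H U /\
  quasi_surely (fun w => ae_time (fun t =>
    closure (range (rt w t)) (U w t) /\
    forall h, H0 h -> lambda h w t = ip (U w t) (rt w t h))).

(* D is the class in H^2 of the pathwise derivative, read off from the family of
   covariations C h = [Y,<X,h>]. *)
Definition first_jet (C : H -> Om -> R -> R) (D : HH) : Prop :=
  exists lambda g U (Zn : nat -> Om -> R -> H),
  [/\ has_density C lambda, dominated lambda g, represents lambda U,
      (forall n, elementary (Zn n))
    & upper_L2_field (fun w t => U w t - rt w t (Zn n w t))
        @[n --> \oo] --> 0%E /\
      j (Zn n) @[n --> \oo] --> D].

Definition dW (p q : (Om -> R -> R) * HH) : \bar R :=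
  (S2_norm (p.1 - q.1)%R + (`|p.2 - q.2|)%:E)%E.

Definition jet_pairs (YY : set (Om -> R -> R))
    (cov : (Om -> R -> R) -> H -> Om -> R -> R) : set ((Om -> R -> R) * HH) :=
  [set p | YY p.1 /\ first_jet (cov p.1) p.2].

Record admissible_core (YY : set (Om -> R -> R))
    (cov : (Om -> R -> R) -> H -> Om -> R -> R) : Prop := AdmissibleCore {
  core0 : YY 0;
  core_linear : forall (c : R) Y Y', YY Y -> YY Y' -> YY (c *: Y + Y');
  core_stopped : forall Y t, YY Y -> 0 <= t <= T -> YY (stopped (cst t) Y);
  core_traj : forall Y, YY Y ->
    [/\ (forall w, traj T (Y w)), @raw_adapted R Y
      & exists C : R, forall w t, `|Y w t| <= C];
  cov_linear : forall (c : R) Y Y' h, YY Y -> YY Y' -> H0 h ->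
    qs_eq (cov (c *: Y + Y') h) (c *: cov Y h + cov Y' h);
  cov_linear_dir : forall (c : R) Y h h', YY Y -> H0 h -> H0 h' ->
    qs_eq (cov Y (c *: h + h')) (c *: cov Y h + cov Y h');
  cov_stopped : forall Y t h, YY Y -> 0 <= t <= T -> H0 h ->
    qs_eq (cov (stopped (cst t) Y) h) (stopped (cst t) (cov Y h));
  core_semimartingale : forall Y P, YY Y -> PP P -> semimartingale P Y;
  cov_classical : forall Y P h, YY Y -> PP P -> H0 h ->
    exists2 C, covariation P Y (fun w t => ip (X t w) h) C &
      {ae P, forall w, forall t, 0 <= t <= T -> cov Y h w t = C w t};
  core_jet : forall Y, YY Y -> exists D, first_jet (cov Y) D;
  core_jet_stopped : forall Y t D, YY Y -> 0 <= t <= T ->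
    first_jet (cov Y) D ->
    exists2 L, pointwise_truncation (cst t) L &
      first_jet (cov (stopped (cst t) Y)) (L D);
  core_separable : exists Q,
    [/\ countable Q, Q `<=` jet_pairs YY cov
      & forall p, jet_pairs YY cov p -> forall e : R, 0 < e ->
          exists2 q, Q q & (dW p q < e%:E)%E] }.

Definition jet_graph (YY : set (Om -> R -> R))
    (cov : (Om -> R -> R) -> H -> Om -> R -> R) : set ((Om -> R -> R) * HH) :=
  [set p | S2 p.1 /\ forall e : R, 0 < e ->
     exists2 q, jet_pairs YY cov q & (dW p q < e%:E)%E].

End Jets.
End Upper.
End Processes.

(* Main.v *)
Require Import Defs.
From HB Require Import structures.
From mathcomp Require Import all_boot all_order all_algebra.
From mathcomp Require Import all_classical all_reals all_analysis.
From mathcomp Require Import measurable_realfun ring lra.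

Set Implicit Arguments.
Unset Strict Implicit.
Unset Printing Implicit Defensive.

Import Order.TTheory GRing.Theory Num.Theory.
Import numFieldNormedType.Exports.

Local Open Scope classical_set_scope.
Local Open Scope ring_scope.

(** The integral is an isometry whose running supremum is controlled by Doob's
    inequality; the truncation and all its properties are then obtained by
    density, and identified through the injectivity of the integral.

    Coordinates.  Under each law of the class, the process [<X,h>] is given as a
    local martingale, and its bracket through a second localization.  Since the
    bracket is bounded by [G |h|^2 T], a pathwise inequality for the running
    maximum ([lenglart_pathwise]) bounds the mean of the supremum uniformly in the
    localization, and dominated convergence removes both localizations:
    [coordinate_martingale] makes [<X,h>] a square integrable martingale with
    bracket [int <a h, h> dt].

    Isometry.  If the values of a step process run through countably many vectors,
    the conditional statements for its increments reduce, on each level set of a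
    value, to one coordinate.  This gives the Ito isometry
    ([step_integral_isometry]) and, with Doob's inequality ([doob_L2]), the
    maximal bound with constant 2.  Measurable maps into a separable space are
    uniform limits of countably valued ones, so these step fields are dense in the
    completion ([countable_dense]); the integral being bounded, the equality of
    norms and the maximal bound hold everywhere ([integral_isometry],
    [integral_maximal]), and the integral is injective.

    Truncation.  At a dyadic ceiling rho, cutting an elementary field leaves an
    elementary field of no larger energy, and stops its step integral at rho
    ([step_integral_restrict]); the cut therefore extends to a contraction of the
    completion.  Two truncations of a field bounded by C differ on a random
    interval; if its length is at most d, the energy norm of the difference is at
    most [sqrt (G C^2 d)] ([energy_short]).  This one estimate makes the dyadic
    truncations converge and gives the continuity in the horizon
    ([truncation_horizon]).  The integral of the limit is the stopped integral:
    at a fixed time one side converges in mean square, the other along each path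
    ([integral_truncation]).

    The semigroup law follows by injectivity from the composition of stoppings,
    and the norm of a truncation is that of the integral stopped at tau, taken at
    time T. *)

(** * Inner products *)

Section InnerProduct.
Context (R : realType) (H : completeNormedModType R) (ip : inner_product H).
Implicit Types x y z : H.

Lemma ipDl x y z : ip (x + y) z = ip x z + ip y z.
Proof. by have := ip_linear ip 1 x y z; rewrite scale1r mul1r. Qed.

Lemma ip0l z : ip 0 z = 0.
Proof. by have := ipDl 0 0 z; rewrite addr0; lra. Qed.

Lemma ipZl c x z : ip (c *: x) z = c * ip x z.
Proof. by have := ip_linear ip c x 0 z; rewrite addr0 ip0l addr0. Qed.

Lemma ipNl x z : ip (- x) z = - ip x z.
Proof. by rewrite -scaleN1r ipZl mulN1r. Qed.

Lemma ipBl x y z : ip (x - y) z = ip x z - ip y z.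
Proof. by rewrite ipDl ipNl. Qed.

Lemma ipDr x y z : ip z (x + y) = ip z x + ip z y.
Proof. by rewrite !(ip_sym ip z) ipDl. Qed.

Lemma ip0r z : ip z 0 = 0.
Proof. by rewrite ip_sym ip0l. Qed.

Lemma ipZr c x z : ip z (c *: x) = c * ip z x.
Proof. by rewrite !(ip_sym ip z) ipZl. Qed.

Lemma ipNr x z : ip z (- x) = - ip z x.
Proof. by rewrite !(ip_sym ip z) ipNl. Qed.

Lemma ipBr x y z : ip z (x - y) = ip z x - ip z y.
Proof. by rewrite ipDr ipNr. Qed.

Lemma ip_polar x y : ip x y = (`|x + y| ^+ 2 - `|x - y| ^+ 2) / 4.
Proof.
rewrite -!(ip_norm ip) !(ipDl, ipDr, ipNl, ipNr) (ip_sym ip y x); lra.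
Qed.

Lemma ip_CS x y : `|ip x y| <= `|x| * `|y|.
Proof.
have pos c : 0 <= `|x| ^+ 2 + 2 * c * ip x y + c ^+ 2 * `|y| ^+ 2.
  have : 0 <= `|x + c *: y| ^+ 2 by rewrite exprn_ge0.
  rewrite -(ip_norm ip) !(ipDl, ipDr, ipZl, ipZr) (ip_sym ip y x) !(ip_norm ip).
  by move/le_trans; apply; rewrite le_eqVlt; apply/orP; left; apply/eqP; ring.
have [y0|y0] := eqVneq y 0; first by rewrite y0 ip0r !normr0 mulr0.
have ny : 0 < `|y| by rewrite normr_gt0.
have := pos (- ip x y / `|y| ^+ 2).
have -> : `|x| ^+ 2 + 2 * (- ip x y / `|y| ^+ 2) * ip x y +
    (- ip x y / `|y| ^+ 2) ^+ 2 * `|y| ^+ 2 = `|x| ^+ 2 - (ip x y) ^+ 2 / `|y| ^+ 2.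
  by field; rewrite gt_eqF.
rewrite subr_ge0 ler_pdivrMr ?exprn_gt0// -exprMn => h.
rewrite -ler_sqr ?nnegrE ?mulr_ge0//.
by rewrite real_normK ?num_real.
Qed.

Lemma ip_continuousl y : continuous (fun x => ip x y).
Proof.
move=> x; apply/cvgrPdist_lt => e e0.
have d0 : 0 < e / (`|y| + 1) by rewrite divr_gt0// ltr_wpDl.
near=> z.
rewrite -ipBl (le_lt_trans (ip_CS _ _))//.
have : `|x - z| < e / (`|y| + 1) by near: z; exact: cvgr_dist_lt.
rewrite ltr_pdivlMr ?ltr_wpDl// => /(le_lt_trans _); apply.
by rewrite ler_wpM2l// lerDl.
Unshelve. all: end_near. Qed.

End InnerProduct.

(** * Measurable maps into a separable normed space *)

Section BorelMeasurable.
Context d (T : measurableType d) (R : realType).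

(** Preimages of open sets generate those of all Borel sets, and no sigma-algebra
    has to be attached to the target. *)
Definition bmeas (V : normedModType R) (f : T -> V) :=
  forall U, open U -> measurable (f @^-1` U).

Lemma bmeas_borel (V : normedModType R) (f : T -> V) (B : set V) :
  bmeas f -> (<<s open >>) B -> measurable (f @^-1` B).
Proof.
move=> mf; suff : <<s open >> `<=` [set B | measurable (f @^-1` B)] by apply.
apply: smallest_sub => //; split => //=.
- by rewrite preimage_set0.
- by move=> A mA; rewrite setTD preimage_setC; exact: measurableC.
- by move=> F mF; rewrite preimage_bigcup; exact: bigcup_measurable.
Qed.

Lemma bmeas_realP (f : T -> R) : bmeas f <-> measurable_fun setT f.
Proof.
split=> [mf|mf U oU].
  apply: (measurability _ (RGenOpens.measurableE R)).
  move=> _ [_ [a [b ->]] <-]; rewrite setTI; apply: mf; exact: interval_open.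
by rewrite -[X in measurable X]setTI; apply: mf => //; exact: open_measurable.
Qed.

Lemma bmeas_comp (V W : normedModType R) (phi : V -> W) (f : T -> V) :
  continuous phi -> bmeas f -> bmeas (phi \o f).
Proof.
by move=> cphi mf U oU; rewrite comp_preimage; apply: mf; move/continuousP: cphi; apply.
Qed.

Lemma bmeas_cst (V : normedModType R) (c : V) : bmeas (cst c).
Proof. by move=> U _; rewrite preimage_cst; case: ifP. Qed.

Lemma bmeas_if (V : normedModType R) (b : T -> bool) (f g : T -> V) :
  measurable [set x | b x] -> bmeas f -> bmeas g ->
  bmeas (fun x => if b x then f x else g x).
Proof.
move=> mb mf mg U oU.
rewrite (_ : _ @^-1` _ = [set x | b x] `&` f @^-1` U `|` ~` [set x | b x] `&` g @^-1` U).
  by apply: measurableU; apply: measurableI => //; [exact: mf|exact: measurableC|exact: mg].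
by apply/seteqP; split => x /=; case: (b x) => //=; [left|right|case=> -[]|case=> -[]].
Qed.

Lemma bmeas_norm (V : normedModType R) (f : T -> V) : bmeas f ->
  measurable_fun setT (fun x => `|f x|).
Proof. by move=> mf; apply/bmeas_realP; apply: (bmeas_comp _ mf); exact: norm_continuous. Qed.

(** With idx a discretisation of a random argument, evaluation at that argument is
    cut into countably many evaluations at fixed arguments. *)
Lemma measurable_glue d' (T' : measurableType d') (idx : T -> nat) (g : nat -> T -> T') :
  (forall n, measurable (idx @^-1` [set n])) -> (forall n, measurable_fun setT (g n)) ->
  measurable_fun setT (fun x => g (idx x) x).
Proof.
move=> midx mg _ Y mY; rewrite setTI.
rewrite (_ : _ @^-1` Y = \bigcup_n (idx @^-1` [set n] `&` (g n @^-1` Y))).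
  apply: bigcup_measurable => n _; apply: measurableI => //.
  by rewrite -[X in measurable X]setTI; exact: mg.
apply/seteqP; split => [x Yx|x [n _ [/= <-]]//].
by exists (idx x).
Qed.

Section Separable.
Variable V : normedModType R.
Hypothesis Vsep : separable_space V.

Lemma dense_seq : exists dd : nat -> V, forall (x : V) (e : R), 0 < e -> exists n, `|x - dd n| < e.
Proof.
case: Vsep => D cD denseD.
have D0 : D !=set0.
  have [] := denseD setT; [by exists point|exact: openT|by move=> x [_ Dx]; exists x].
have [dd ddD] : exists dd : nat -> V, D `<=` range dd.
  move/countable_injP : cD => [g ginj].
  exists (fun n => xget point [set x | D x /\ g x = n]) => x Dx.
  exists (g x) => //; case: xgetP => [y -> [Dy gy]|/(_ x)/not_andP[]//].
  by apply: ginj; rewrite ?inE.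
exists dd => x e e0.
have [] := denseD (ball x e); [by exists x; exact: ballxx|exact: ball_open|].
move=> y [xy /ddD[n _ yn]]; exists n; rewrite yn.
by move: xy; rewrite -ball_normE.
Qed.

(** Separability enters here: addition is measurable for the product of the Borel
    sigma-algebras because an open condition on a sum is a countable union of
    conditions on pairs of balls centred at a dense sequence. *)
Lemma bmeas_add (f g : T -> V) : bmeas f -> bmeas g -> bmeas (f \+ g).
Proof.
move=> mf mg U oU; have [dd ddP] := dense_seq.
pose e_ n : R := n.+1%:R^-1.
pose good i j n := `[< ball (dd i + dd j) (2 * e_ n) `<=` U >].
rewrite (_ : _ @^-1` U = \bigcup_i \bigcup_j \bigcup_n
   if good i j n then f @^-1` (ball (dd i) (e_ n)) `&` g @^-1` (ball (dd j) (e_ n)) else set0).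
  do 3 (apply: bigcup_measurable => ? _); case: ifP => // _.
  by apply: measurableI; [apply: mf|apply: mg]; apply: ball_open.
apply/seteqP; split => x /=.
  move=> Ux.
  have /nbhs_ballP[e /= e0 eU] : nbhs (f x + g x) U by move: oU; rewrite openE; exact.
  have [n ne] : exists n, e_ n < e / 4.
    have [n _ /(_ n (leqnn n))] := near_infty_natSinv_lt (PosNum (divr_gt0 e0 (ltr0n R 4))).
    by exists n.
  have en0 : 0 < e_ n by rewrite invr_gt0.
  have [i fi] := ddP (f x) _ en0; have [j gj] := ddP (g x) _ en0.
  exists i => //; exists j => //; exists n => //.
  have -> : good i j n.
    apply/asboolP => y; rewrite -ball_normE /= => yy; apply: eU; rewrite -ball_normE/=.
    have -> : f x + g x - y = (f x - dd i) + (g x - dd j) + (dd i + dd j - y).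
      by rewrite (addrACA (f x)) -opprD addrA subrK.
    rewrite (le_lt_trans (ler_normD _ _))// (le_lt_trans (lerD (ler_normD _ _) (lexx _)))//.
    lra.
  by split; rewrite -ball_normE/= distrC.
move=> [i _ [j _ [n _]]]; case: ifP => // /asboolP sub.
rewrite -!ball_normE /= => -[fi gj]; apply: sub; rewrite -ball_normE/=.
rewrite opprD addrACA (le_lt_trans (ler_normD _ _))//; lra.
Qed.

Lemma bmeas_opp (f : T -> V) : bmeas f -> bmeas (fun x => - f x).
Proof. by move=> mf; apply: (bmeas_comp _ mf); exact: opp_continuous. Qed.

Lemma bmeas_sub (f g : T -> V) : bmeas f -> bmeas g -> bmeas (fun x => f x - g x).
Proof. by move=> mf mg; apply: bmeas_add => //; exact: bmeas_opp. Qed.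

Lemma bmeas_scale c (f : T -> V) : bmeas f -> bmeas (fun x => c *: f x).
Proof. by move=> mf; apply: (bmeas_comp (phi := *:%R c) _ mf); exact: scaler_continuous. Qed.

Lemma bmeas_sum n (f : 'I_n -> T -> V) : (forall i, bmeas (f i)) ->
  bmeas (fun x => \sum_(i < n) f i x).
Proof.
elim: n f => [|n IH] f mf.
  rewrite (_ : (fun _ => _) = cst 0); first exact: bmeas_cst.
  by apply/funext => x; rewrite big_ord0.
rewrite (_ : (fun _ => _) = ((fun x => \sum_(i < n) f (widen_ord (leqnSn n) i) x) \+ f ord_max)).
  by apply: bmeas_add => //; apply: IH.
by apply/funext => x /=; rewrite big_ord_recr.
Qed.

(** Countably valued functions are uniformly dense: send x to the first
   point of a dense sequence within distance e of [f x]. *)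
Lemma bmeas_approx (f : T -> V) (e : R) : 0 < e -> bmeas f ->
  exists (dd : nat -> V) (idx : T -> nat),
    (forall n, measurable (idx @^-1` [set n])) /\ forall x, `|f x - dd (idx x)| < e.
Proof.
move=> e0 mf; have [dd ddP] := dense_seq.
have ex x : exists n, `|f x - dd n| < e := ddP _ _ e0.
pose idx x := ex_minn (ex x).
exists dd, idx; split; last by move=> x; rewrite /idx; case: ex_minnP.
have mlt n : measurable [set x | `|f x - dd n| < e].
  rewrite (_ : [set _ | _] = f @^-1` (ball (dd n) e)); first by apply: mf; exact: ball_open.
  by apply/seteqP; split => x; rewrite /= -ball_normE /= distrC.
move=> n.
rewrite (_ : _ @^-1` _ = [set x | `|f x - dd n| < e] `&`
   \bigcap_(k < n) ~` [set x | `|f x - dd k| < e]).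
  apply: measurableI => //; apply: bigcap_measurableType => k _; exact: measurableC.
apply/seteqP; split => x /=.
  rewrite /idx; case: ex_minnP => m mx minm <-; split => // k /= km xk.
  by have := minm _ xk; rewrite leqNgt km.
rewrite /idx; case: ex_minnP => m mx minm [nx hn].
apply/eqP; rewrite eqn_leq minm //= leqNgt; apply/negP => mn.
exact: (hn m mn).
Qed.

End Separable.

Lemma bmeas_ip (H : completeNormedModType R) (ip : inner_product H)
  (f g : T -> H) : separable_space H -> bmeas f -> bmeas g ->
  measurable_fun setT (fun x => ip (f x) (g x)).
Proof.
move=> Hs mf mg.
rewrite (_ : (fun _ => _) = (fun x => (`|f x + g x| ^+ 2 - `|f x - g x| ^+ 2) / 4)); last first.
  by apply/funext => x; exact: ip_polar.
apply: measurable_funM => //; apply: measurable_funB; apply: measurable_funX; apply: bmeas_norm.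
  exact: bmeas_add.
exact: bmeas_sub.
Qed.

(** Joint measurability of the quadratic form along a measurable field: exact
    for countably valued fields, and passed to the limit by continuity. *)
Lemma bmeas_form (H : completeNormedModType R) (ip : inner_product H)
  (c : T -> H -> H) (Z : T -> H) : separable_space H ->
  (forall p, continuous (c p)) ->
  (forall h k, measurable_fun setT (fun p => ip (c p h) k)) -> bmeas Z ->
  measurable_fun setT (fun p => ip (c p (Z p)) (Z p)).
Proof.
move=> Hsep cont mb mZ.
have e0 n : 0 < n.+1%:R^-1 :> R by rewrite invr_gt0.
pose dd n := projT1 (cid (bmeas_approx Hsep (e0 n) mZ)).
have ddP n : exists idx : T -> nat, (forall k, measurable (idx @^-1` [set k])) /\
    forall p, `|Z p - dd n (idx p)| < n.+1%:R^-1.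
  by rewrite /dd; case: cid.
pose idx n := projT1 (cid (ddP n)).
have midx n k : measurable (idx n @^-1` [set k]) by rewrite /idx; case: cid => /= ? [].
have close n p : `|Z p - dd n (idx n p)| < n.+1%:R^-1 by rewrite /idx; case: cid => /= ? [].
pose Zn n p := dd n (idx n p).
apply: (@measurable_fun_cvg _ _ _ _ (fun n p => ip (c p (Zn n p)) (Zn n p))) => [n|p _].
  exact: (@measurable_glue _ _ (idx n) (fun k p => ip (c p (dd n k)) (dd n k))).
have cZ : Zn n p @[n --> \oo] --> Z p.
  apply/cvgrPdist_lt => e ee; near=> n; apply: (lt_trans (close n p)).
  near: n; exact: (near_infty_natSinv_lt (PosNum ee)).
set B := c p; have cB : B (Zn n p) @[n --> \oo] --> B (Z p).
  exact: (cvg_comp _ _ cZ (cont _ _)).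
have polar x y : ip x y = (`|x + y| ^+ 2 - `|x - y| ^+ 2) / 4 by exact: ip_polar.
rewrite polar; under eq_fun do rewrite polar.
have sq (u : nat -> R) (l : R) : u @ \oo --> l -> (fun n => u n ^+ 2 : R) @ \oo --> (l ^+ 2 : R).
  by move=> cu; exact: (cvg_comp _ (fun x : R => x ^+ 2) cu (@exprn_continuous _ 2 _)).
apply: cvgMl; apply: cvgB; apply: sq; apply: cvg_norm.
  exact: cvgD.
exact: cvgB.
Unshelve. all: end_near. Qed.

End BorelMeasurable.

(** * Raw filtration, stopping times and dyadic ceilings *)

Section Paths.
Context (R : realType) (T : R) (H : completeNormedModType R).
Hypothesis T0 : 0 < T.
Local Notation Om := (Omega T H).

Lemma clamp_itv t : 0 <= clamp T t <= T.
Proof. by rewrite /clamp le_min ge_min lexx le_max lexx (ltW T0). Qed.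

Lemma pathP (w : Om) : [/\ continuous (fun t => X t w), (forall t, X t w = X (clamp T t) w) & X 0 w = 0].
Proof. by have := set_valP w => -[[cw cl] w0]. Qed.

Lemma X0 (w : Om) : X 0 w = 0. Proof. by case: (pathP w). Qed.
Lemma X_cont (w : Om) : continuous (fun t => X t w). Proof. by case: (pathP w). Qed.

Definition Fgen (t : R) : set (set Om) :=
  [set A | exists s (B : set H), [/\ 0 <= s <= t, (<<s open >>) B & A = X s @^-1` B]].

(** The path space carrying the sigma-algebra at time t, so that lemmas about
    measurable functions apply to adaptedness. *)
Definition OmF (t : R) := g_sigma_algebraType (Fgen t).

Lemma F_measurableP (V : normedModType R) t (f : Om -> V) :
  F_measurable (@F0 R T H t) f <-> bmeas (f : OmF t -> V).
Proof.
split=> [mf U oU|mf B mB].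
  by apply: mf; exact: sub_sigma_algebra.
exact: (bmeas_borel mf).
Qed.

Lemma F0_mono s t : s <= t -> @F0 R T H s `<=` @F0 R T H t.
Proof.
move=> st; apply: smallest_sub; first exact: smallest_sigma_algebra.
move=> A [u [B [/andP[u0 us] mB ->]]]; apply: sub_sigma_algebra.
by exists u, B; split => //; rewrite u0 (le_trans us).
Qed.

Lemma bmeas_X s : bmeas (X s : Om -> H).
Proof.
move=> U oU; apply: sub_sigma_algebra => w Uw.
have /nbhs_ballP[e /= e0 eU] : nbhs (X s w) U by move: oU; rewrite openE; exact.
by exists e => // w' ww'; apply: eU; rewrite -ball_normE /=; exact: ww'.
Qed.

Lemma F0_measurable t (A : set Om) : @F0 R T H t A -> measurable A.
Proof.
move=> FA; suff : @F0 R T H t `<=` measurable by apply.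
apply: smallest_sub; first exact: sigma_algebra_measurable.
by move=> _ [s [B [_ mB ->]]]; apply: (bmeas_borel _ mB); exact: bmeas_X.
Qed.

Lemma F_measurable_X s t : 0 <= s <= t -> F_measurable (@F0 R T H t) (X s).
Proof. by move=> st B mB; apply: sub_sigma_algebra; exists s, B. Qed.

Lemma F_measurable_mono (V : normedModType R) s t (f : Om -> V) : s <= t ->
  F_measurable (@F0 R T H s) f -> F_measurable (@F0 R T H t) f.
Proof. by move=> st mf B mB; apply: (F0_mono st); exact: mf. Qed.

Lemma F_measurable_bmeas (V : normedModType R) t (f : Om -> V) :
  F_measurable (@F0 R T H t) f -> bmeas f.
Proof.
by move=> mf U oU; apply: (@F0_measurable t); apply: mf; exact: sub_sigma_algebra.
Qed.

Lemma F_measurable_realP t (f : Om -> R) :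
  F_measurable (@F0 R T H t) f <-> measurable_fun setT (f : OmF t -> R).
Proof. by rewrite F_measurableP; exact: bmeas_realP. Qed.

Lemma F_measurable_fun t (f : Om -> R) :
  F_measurable (@F0 R T H t) f -> measurable_fun setT f.
Proof. by move=> mf; apply/bmeas_realP; exact: F_measurable_bmeas mf. Qed.

(** Evaluation of a continuous process at a random time is the limit of its
    evaluations at the lower grid approximations of that time. *)
Lemma measurable_eval d (S : measurableType d) (Y : S -> R -> R) (u : S -> R) (t : R) :
  (forall s, 0 <= s <= t -> measurable_fun setT (fun w => Y w s)) ->
  (forall w, continuous (Y w)) -> measurable_fun setT u ->
  (forall w, 0 <= u w <= t) -> measurable_fun setT (fun w => Y w (u w)).
Proof.
move=> mY cY mu ut.
pose idx n w := Num.truncn (u w * n.+1%:R).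
pose g n k w := if k%:R / n.+1%:R <= t then Y w (k%:R / n.+1%:R) else 0.
have n0 n : 0 < n.+1%:R :> R by [].
have u0 w : 0 <= u w by case/andP: (ut w).
have un0 n w : 0 <= u w * n.+1%:R by rewrite mulr_ge0.
apply: (@measurable_fun_cvg _ _ _ _ (fun n w => g n (idx n w) w)) => [n|w _].
  apply: measurable_glue => k.
    rewrite (_ : _ @^-1` _ = (fun w => u w * n.+1%:R) @^-1` `[k%:R, k.+1%:R[%classic).
      rewrite -[X in measurable X]setTI.
      by apply: (measurable_funM mu (measurable_cst _)).
    apply/seteqP; split => w /=.
      by move=> <-; rewrite in_itv/= truncn_itv.
    by rewrite in_itv/= => h; apply: truncn_def.
  rewrite /g; have [kt|kt] := boolP (k%:R / n.+1%:R <= t); last exact: measurable_cst.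
  by apply: mY; rewrite kt divr_ge0.
have le_u n : (idx n w)%:R / n.+1%:R <= u w.
  by rewrite ler_pdivrMr// truncn_le.
have -> : (fun n => g n (idx n w) w) = (fun n => Y w ((idx n w)%:R / n.+1%:R)).
  apply/funext => n; rewrite /g ifT//.
  by rewrite (le_trans (le_u n))//; case/andP: (ut w).
suff h : (idx n w)%:R / n.+1%:R @[n --> \oo] --> u w by exact: (cvg_comp _ _ h (cY w (u w))).
apply/cvgrPdist_lt => e e0.
near=> n.
rewrite ger0_norm ?subr_ge0//.
have h : u w < (idx n w)%:R / n.+1%:R + n.+1%:R^-1.
  rewrite -[X in _ + X]mul1r -mulrDl ltr_pdivlMr//.
  by rewrite (natr1 (idx n w)); exact: truncnS_gt.
rewrite ltrBlDl (lt_trans h)// ltrD2l.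
near: n; exact: (near_infty_natSinv_lt (PosNum e0)).
Unshelve. all: end_near. Qed.

Lemma stopping_measurable (tau : Om -> R) t : 0 <= t <= T -> raw_stopping tau ->
  measurable_fun setT ((fun w => Num.min t (tau w)) : OmF t -> R).
Proof.
move=> /andP[t0 tT] [tau_itv tauF].
apply: (measurability _ (RGenOInfty.measurableE R)).
move=> _ [_ [r ->] <-]; rewrite setTI.
rewrite (_ : _ @^-1` _ = ~` [set w : OmF t | Num.min t (tau w) <= r]); last first.
  by apply/seteqP; split => w /=; rewrite in_itv/= andbT ltNge => /negP.
apply: measurableC.
have [tr|rt] := leP t r.
  rewrite (_ : [set _ | _] = setT)//; apply/seteqP; split => w //= _.
  by rewrite ge_min tr.
have [r0|r0] := ltP r 0.
  rewrite (_ : [set _ | _] = set0)//; apply/seteqP; split => w //=.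
  by rewrite ge_min => /orP[|]; rewrite leNgt ?rt// (lt_le_trans r0)//; case/andP: (tau_itv w).
rewrite (_ : [set _ | _] = [set w | tau w <= r]).
  apply: (F0_mono (ltW rt)); apply: tauF; rewrite r0/=; lra.
by apply/seteqP; split => w /=; rewrite ge_min leNgt rt /= => ->.
Qed.

Lemma stopping_measurableT (tau : Om -> R) : raw_stopping tau ->
  measurable_fun setT tau.
Proof.
move=> st; have tt : 0 <= T <= T by rewrite lexx ltW.
have := stopping_measurable tt st => mt.
have -> : tau = (fun w => Num.min T (tau w)).
  by apply/funext => w; rewrite (min_idPr _)//; case: st => /(_ w)/andP[].
move=> _ Y mY; apply: (@F0_measurable T); exact: mt.
Qed.

Lemma stopped_adapted (tau : Om -> R) (Y : Om -> R -> R) : raw_stopping tau ->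
  @raw_adapted R T H R Y -> (forall w, continuous (Y w)) ->
  @raw_adapted R T H R (stopped tau Y).
Proof.
move=> st aY cY t tT; apply/F_measurable_realP.
apply: (@measurable_eval _ (OmF t) Y (fun w => Num.min t (tau w)) t) => //.
- move=> s /andP[s0 sT]; apply/F_measurable_realP.
  by apply: (F_measurable_mono sT); apply: aY; rewrite s0/=; case/andP: tT => _; exact: le_trans.
- exact: stopping_measurable.
- case: st => st _ w; rewrite le_min ge_min lexx !andbT.
  by case/andP: tT => -> _ /=; case/andP: (st w).
Qed.

Lemma stopped_measurable (tau : Om -> R) (Y : Om -> R -> R) t : raw_stopping tau ->
  (forall s, 0 <= s <= T -> measurable_fun setT (fun w : Om => Y w s)) ->
  (forall w, continuous (Y w)) -> 0 <= t ->
  measurable_fun setT (fun w => stopped tau Y w t).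
Proof.
move=> st mY cY t0.
apply: (@measurable_eval _ Om Y (fun w => Num.min t (tau w)) T) => //.
- by apply: measurable_minr => //; exact: stopping_measurableT.
- move=> w; case: st => /(_ w)/andP[w0 wT] _.
  by rewrite le_min t0 w0 ge_min wT orbT.
Qed.

Lemma raw_stopping_cst t : 0 <= t <= T -> raw_stopping (cst t : Om -> R).
Proof.
move=> tT; split => // s sT; have [ts|ts] := leP t s.
  rewrite (_ : [set _ | _] = setT); first exact: (@measurableT _ (OmF s)).
  by apply/seteqP; split => w /=.
rewrite (_ : [set _ | _] = set0); first exact: (@measurable0 _ (OmF s)).
by apply/seteqP; split => w //=; rewrite leNgt ts.
Qed.

Lemma raw_stopping_min (sigma tau : Om -> R) : raw_stopping sigma -> raw_stopping tau ->
  raw_stopping (fun w => Num.min (sigma w) (tau w)).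
Proof.
move=> [s1 s2] [t1 t2]; split => [w|t tT].
  by rewrite le_min ge_min; case/andP: (s1 w) => -> ->; case/andP: (t1 w) => ->.
rewrite (_ : [set _ | _] = [set w | sigma w <= t] `|` [set w | tau w <= t]).
  by apply: (@measurableU _ (OmF t)); [exact: s2|exact: t2].
by apply/seteqP; split => w /=; rewrite ge_min => /orP.
Qed.

Section DyadicCeiling.
Variables (tau : Om -> R) (n : nat).
Hypothesis st : raw_stopping tau.
Local Notation c := (2 ^+ n : R).

Let c0 : 0 < c. Proof. exact: exprn_gt0. Qed.
Let Tc0 : 0 < T / c. Proof. exact: divr_gt0. Qed.
Let tc x : x * c / T = x / (T / c). Proof. by rewrite invfM invrK mulrA mulrAC. Qed.

Lemma dyadic_ceil_ge w : tau w <= dyadic_ceil tau n w.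
Proof. by rewrite /dyadic_ceil tc -ler_pdivrMr// ceil_ge. Qed.

Lemma dyadic_ceil_lt w : dyadic_ceil tau n w < tau w + T / c.
Proof.
rewrite /dyadic_ceil tc -ltr_pdivlMr// mulrDl divff ?gt_eqF//.
by have := ceilB1_lt (tau w / (T / c)); rewrite intrD mulrN1z ltrBlDr.
Qed.

Lemma dyadic_ceil_le w t : (dyadic_ceil tau n w <= t) =
  (tau w <= (Num.floor (t / (T / c)))%:~R * (T / c)).
Proof. by rewrite /dyadic_ceil tc -ler_pdivlMr// -floor_ge_int// ceil_le_int -ler_pdivrMr. Qed.

Lemma floor_dyadic_le t : (Num.floor (t / (T / c)))%:~R * (T / c) <= t.
Proof. by rewrite -ler_pdivlMr// ge_floor. Qed.

Definition dyadic_points := [seq k%:R * (T / c) | k <- iota 0 (2 ^ n).+1].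

Lemma dyadic_ceil_points w : dyadic_ceil tau n w \in dyadic_points.
Proof.
have [/(_ w)/andP[w0 wT] _] := st.
rewrite /dyadic_ceil tc.
have : 0 <= Num.ceil (tau w / (T / c)).
  by rewrite ceil_ge0 (@lt_le_trans _ _ 0)// ?divr_ge0 ?(ltW Tc0)//; lra.
have : Num.ceil (tau w / (T / c)) <= (2 ^ n)%:Z.
  by rewrite ceil_le_int ler_pdivrMr// -pmulrn natrX mulrC divfK ?gt_eqF.
case: (Num.ceil _) => // k kn _.
by apply/mapP; exists k => //; rewrite mem_iota/= add0n ltnS.
Qed.

Lemma dyadic_points_itv x : x \in dyadic_points -> 0 <= x <= T.
Proof.
move=> /mapP[k]; rewrite mem_iota/= add0n ltnS => kn ->.
rewrite mulr_ge0 ?(ltW Tc0)//= mulrC mulrAC ler_pdivrMr// ler_pM2l//.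
by rewrite -natrX ler_nat.
Qed.

(** The ceiling is at most t exactly when tau is at most the largest dyadic point
    below t, an event already known at that dyadic point. *)
Lemma dyadic_ceil_stopping : raw_stopping (dyadic_ceil tau n).
Proof.
split=> [w|t /andP[t0 tT]]; first exact/dyadic_points_itv/dyadic_ceil_points.
rewrite (_ : [set _ | _] = [set w | tau w <= (Num.floor (t / (T / c)))%:~R * (T / c)]).
  apply: (F0_mono (floor_dyadic_le t)).
  case: st => _; apply; rewrite (le_trans (floor_dyadic_le t))// andbT.
  rewrite mulr_ge0 ?(ltW Tc0)// ler0z floor_ge_int//.
  by rewrite divr_ge0// ltW.
by apply/seteqP; split => w /=; rewrite dyadic_ceil_le.
Qed.

Lemma dyadic_ceil_dist w : `|dyadic_ceil tau n w - tau w| <= T / c.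
Proof.
rewrite ger0_norm ?subr_ge0 ?dyadic_ceil_ge//.
by rewrite lerBlDl ltW// dyadic_ceil_lt.
Qed.

End DyadicCeiling.

Lemma dyadic_mesh_small d : 0 < d -> \forall n \near \oo, T / 2 ^+ n <= d.
Proof.
move=> d0; have h : (T / 2 ^+ n) @[n --> \oo] --> (0 : R).
  rewrite -[X in _ --> X](mulr0 T); apply: cvgM; first exact: cvg_cst.
  rewrite (_ : (fun n => _) = (fun n => 2^-1 ^+ n)); last by apply/funext => n; rewrite exprVn.
  by apply: cvg_expr; rewrite ger0_norm// invf_lt1// ltr1n.
by move/cvgr0_norm_le: h => /(_ _ d0); apply: filterS => n; apply: le_trans; exact: ler_norm.
Qed.

Lemma dyadic_ceil_cvg (tau : Om -> R) w : dyadic_ceil tau n w @[n --> \oo] --> tau w.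
Proof.
apply/cvgrPdist_le => e e0; apply: filterS (dyadic_mesh_small e0) => n.
by rewrite distrC; apply: le_trans; exact: dyadic_ceil_dist.
Qed.

End Paths.

(** * Elementary fields without a chosen subdivision *)

Section Grids.
Context (R : realType) (T : R) (H : completeNormedModType R) (ip : inner_product H).
Hypothesis T0 : 0 < T.
Hypothesis Hsep : separable_space H.
Local Notation Om := (Omega T H).
Implicit Types Z : Om -> R -> H.

Definition avoids (s : seq R) (u v : R) := forall x, x \in s -> ~~ (u < x < v).

(** Being the field of a step process, phrased so that it survives refinement of
    the subdivision: on a cell with no point of s in its interior, the field is
    constant in time and known at the left end.  Fields on different subdivisions
    are then compared on the union of the two. *)
Definition adapted_to (s : seq R) Z := forall u v, 0 <= u -> u < v -> v <= T ->
  avoids s u v ->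
  (forall w t, u < t <= v -> Z w t = Z w v) /\
  F_measurable (F0 u) (fun w => Z w v).

Definition bounded_on_support Z :=
  (exists C : R, forall w t, `|Z w t| <= C) /\
  (forall w t, ~~ (0 < t <= T) -> Z w t = 0).

Lemma step_field_adapted (z : step_process T H) :
  adapted_to [seq step_time z k | k <- iota 0 (step_size z).+1] (step_field z).
Proof.
move=> u v u0 uv vT av.
have av' k : (k <= step_size z)%N -> step_time z k <= u \/ v <= step_time z k.
  move=> kn; have : step_time z k \in [seq step_time z k | k <- iota 0 (step_size z).+1].
    by apply/mapP; exists k => //; rewrite mem_iota/= add0n ltnS.
  by move/av; rewrite negb_and -!leNgt => /orP.
have inE' k t : (k < step_size z)%N -> u < t <= v ->
    (step_time z k < t <= step_time z k.+1) = (step_time z k <= u) && (v <= step_time z k.+1).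
  move=> kn /andP[ut tv]; apply/andP/andP => -[h1 h2].
    case: (av' k (ltnW kn)) => h3; case: (av' k.+1 kn) => h4; split => //; lra.
  split; lra.
split=> [w t utv|].
  apply: eq_bigr => k _; rewrite !inE' //.
  by rewrite uv lexx.
apply/F_measurableP; apply: bmeas_sum => // k.
rewrite (_ : (fun _ => _) = if (step_time z k <= u) && (v <= step_time z k.+1) then
    step_val z k : OmF T H u -> H else cst 0); last first.
  by apply/funext => w; rewrite inE' ?uv ?lexx//; case: ifP.
case: ifP => [/andP[ku _]|_]; last exact: bmeas_cst.
by apply/F_measurableP; apply: (F_measurable_mono ku); exact: step_val_raw.
Qed.

Lemma step_time_lt (z : step_process T H) i k : (i < k)%N -> (k <= step_size z)%N ->
  step_time z i < step_time z k.
Proof.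
elim: k => // k IH; rewrite ltnS leq_eqVlt => /predU1P[->|ik] kn; first exact: step_time_mono.
by apply: (lt_trans (IH ik (ltnW kn))); exact: step_time_mono.
Qed.

Lemma step_field_bounded (z : step_process T H) : bounded_on_support (step_field z).
Proof.
split.
  have [C CP] := step_val_bounded z; exists (\sum_(k < step_size z) `|C|) => w t.
  apply: (le_trans (ler_norm_sum _ _ _)); apply: ler_sum => k _.
  case: ifP => _; last by rewrite normr0.
  by rewrite (le_trans (CP _ _ (ltn_ord k)))// ler_norm.
move=> w t; rewrite negb_and -!leNgt -ltNge => ht.
apply: big1 => k _; case: ifP => // /andP[h1 h2].
have /andP[a1 _] := step_time_itv (ltnW (ltn_ord k)).
have /andP[_ a2] := step_time_itv (ltn_ord k).
by exfalso; move/orP: ht => [h|h]; lra.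
Qed.

Lemma sorted_grid (s : seq R) : exists (n : nat) (p : nat -> R),
  [/\ p 0%N = 0 /\ p n = T,
      (forall k, (k <= n)%N -> 0 <= p k <= T),
      (forall k, (k < n)%N -> p k < p k.+1)
    & forall k, (k < n)%N -> avoids s (p k) (p k.+1)].
Proof.
pose l0 := [:: 0, T & [seq x <- s | 0 <= x <= T]].
pose l := sort <=%R (undup l0).
have ml x : (x \in l) = (x \in l0) by rewrite mem_sort mem_undup.
have sl : sorted <%R l by rewrite sort_lt_sorted undup_uniq.
have l0l : 0 \in l by rewrite ml inE eqxx.
have Tl : T \in l by rewrite ml !inE eqxx orbT.
have itv x : x \in l -> 0 <= x <= T.
  rewrite ml !inE => /or3P[/eqP->|/eqP->|]; rewrite ?lexx ?(ltW T0)//.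
  by rewrite mem_filter => /andP[].
have sz0 : (0 < size l)%N by case: (l) l0l.
have szE : (size l).-1.+1 = size l by rewrite prednK.
have lt_p i k : (i < size l)%N -> (k < size l)%N -> (nth 0 l i < nth 0 l k) = (i < k)%N.
  by move=> il kl; rewrite (lt_sorted_ltn_nth 0 sl).
have le_p i k : (i < size l)%N -> (k < size l)%N -> (nth 0 l i <= nth 0 l k) = (i <= k)%N.
  by move=> il kl; rewrite (lt_sorted_leq_nth 0 sl).
exists (size l).-1, (nth 0 l); split.
- split; apply/eqP; rewrite eq_le.
    have /andP[-> _] := itv _ (mem_nth 0 sz0); rewrite andbT.
    by rewrite -{2}(nth_index 0 l0l) le_p// index_mem.
  have Ln : ((size l).-1 < size l)%N by rewrite szE.
  have /andP[_ ->] := itv _ (mem_nth 0 Ln).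
  rewrite -{1}(nth_index 0 Tl) le_p// ?index_mem//.
  by rewrite -ltnS szE index_mem.
- by move=> k kn; apply: itv; rewrite mem_nth// -szE ltnS.
- by move=> k kn; rewrite lt_p// -szE ltnS// ltnW.
- move=> k kn x xs; apply/negP => /andP[x1 x2].
  have k1 : (k < size l)%N by rewrite -szE ltnS ltnW.
  have k2 : (k.+1 < size l)%N by rewrite -szE ltnS.
  have xl : x \in l.
    have /andP[a1 _] := itv _ (mem_nth 0 k1); have /andP[_ a2] := itv _ (mem_nth 0 k2).
    by rewrite ml !inE mem_filter xs (le_trans a1 (ltW x1)) (le_trans (ltW x2) a2) !orbT.
  have ix : (index x l < size l)%N by rewrite index_mem.
  move: x1 x2; rewrite -(nth_index 0 xl) !lt_p// => x1 x2.
  by move: x2; rewrite ltnS leqNgt x1.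
Qed.

(** A cell contains its right end and not its left end: the value there is the
    value on the cell. *)
Lemma step_of_adapted (s : seq R) (n : nat) (p : nat -> R) Z :
  p 0%N = 0 -> p n = T ->
  (forall k, (k <= n)%N -> 0 <= p k <= T) ->
  (forall k, (k < n)%N -> p k < p k.+1) ->
  (forall k, (k < n)%N -> avoids s (p k) (p k.+1)) ->
  adapted_to s Z -> bounded_on_support Z ->
  exists z : step_process T H,
    [/\ step_size z = n, step_time z = p,
        step_val z = (fun k w => Z w (p k.+1)) & step_field z = Z].
Proof.
move=> p0 pn pT pmono pav aZ [[C CP] Zoff].
have vb : exists C : R, forall k (w : Om), (k < n)%N -> `|Z w (p k.+1)| <= C.
  by exists C => k w _; exact: CP.
have aZk k : (k < n)%N -> (forall w t, p k < t <= p k.+1 -> Z w t = Z w (p k.+1)) /\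
  F_measurable (F0 (p k)) (fun w => Z w (p k.+1)).
  move=> kn; apply: aZ; [by case/andP: (pT _ (ltnW kn))|exact: pmono|by case/andP: (pT _ kn)|exact: pav].
have vr k : (k < n)%N -> F_measurable (F0 (p k)) (fun w => Z w (p k.+1)).
  by move=> /aZk[].
exists (StepProcess pT pmono vb vr); split => //.
apply/funext => w; apply/funext => t; rewrite /step_field /=.
have [t0T|tN] := boolP (0 < t <= T); last first.
  rewrite Zoff//; apply: big1 => k _; case: ifP => // /andP[h1 h2].
  have /andP[a1 _] := pT _ (ltnW (ltn_ord k)).
  have /andP[_ a2] := pT _ (ltn_ord k).
  by exfalso; move/negP: tN; apply; apply/andP; split; lra.
have [k kn kt] : exists2 k, (k < n)%N & p k < t <= p k.+1.
  move/andP: t0T => [t0 tT].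
  have ex : exists m, (m <= n)%N && (t <= p m) by exists n; rewrite leqnn pn.
  case: (ex_minnP ex) => -[|m] /andP[mn tm] mmin; first by move: tm; rewrite p0 leNgt t0.
  exists m => //; rewrite tm andbT ltNge; apply/negP => tm'.
  by have := mmin m; rewrite (ltnW mn) tm' ltnn => /(_ isT).
have lt_p i m : (i < m)%N -> (m <= n)%N -> p i < p m.
  elim: m => // m IH; rewrite ltnS leq_eqVlt => /predU1P[->|im] mn; first exact: pmono.
  by apply: (lt_trans (IH im (ltnW mn))); exact: pmono.
rewrite (bigD1 (Ordinal kn))//= kt big1 ?addr0; first by case: (aZk _ kn) => ->.
move=> i /eqP ik; case: ifP => // /andP[i1 i2]; exfalso; apply: ik; apply: val_inj => /=.
move/andP: kt => [k1 k2]; apply/eqP; rewrite eqn_leq; apply/andP; split; rewrite leqNgt; apply/negP => h.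
  have : p k.+1 <= p i by move: h; rewrite leq_eqVlt => /predU1P[->//|h]; apply/ltW/lt_p => //; exact/ltnW/ltn_ord.
  lra.
have : p i.+1 <= p k by move: h; rewrite leq_eqVlt => /predU1P[->//|h]; apply/ltW/lt_p => //; exact: ltnW.
lra.
Qed.

Lemma elementaryP Z :
  elementary Z <-> exists2 s, adapted_to s Z & bounded_on_support Z.
Proof.
split=> [[z ->]|[s aZ bZ]].
  by eexists; [exact: step_field_adapted|exact: step_field_bounded].
have [n [p [[p0 pn] pT pm pav]]] := sorted_grid s.
have [z [_ _ _ zZ]] := step_of_adapted p0 pn pT pm pav aZ bZ.
by exists z.
Qed.

Lemma avoids_cat s1 s2 u v : avoids (s1 ++ s2) u v -> avoids s1 u v /\ avoids s2 u v.
Proof. by move=> av; split => x xs; apply: av; rewrite mem_cat xs ?orbT. Qed.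

Lemma field_linE c Z Z' w t : (c *: Z + Z') w t = c *: Z w t + Z' w t.
Proof. by []. Qed.

Lemma adapted_lin c s s' Z Z' : adapted_to s Z -> adapted_to s' Z' ->
  adapted_to (s ++ s') (c *: Z + Z').
Proof.
move=> aZ aZ' u v u0 uv vT /avoids_cat[av av'].
have [c1 m1] := aZ _ _ u0 uv vT av; have [c2 m2] := aZ' _ _ u0 uv vT av'.
split=> [w t utv|]; first by rewrite !field_linE (c1 _ _ utv) (c2 _ _ utv).
apply/F_measurableP; apply: bmeas_add => //; last exact/F_measurableP.
by apply: (@bmeas_scale _ _ _ _ c); exact/F_measurableP.
Qed.

Lemma elementary_lin c Z Z' : elementary Z -> elementary Z' -> elementary (c *: Z + Z').
Proof.
move=> /elementaryP[s aZ [[C CP] oZ]] /elementaryP[s' aZ' [[C' CP'] oZ']].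
apply/elementaryP; exists (s ++ s'); first exact: adapted_lin.
split; last by move=> w t ht; rewrite field_linE (oZ _ _ ht) (oZ' _ _ ht) scaler0 addr0.
exists (`|c| * C + C') => w t.
rewrite field_linE (le_trans (ler_normD _ _))// normrZ lerD//.
by rewrite ler_wpM2l.
Qed.

Lemma elementary_sub Z Z' : elementary Z -> elementary Z' -> elementary (Z - Z').
Proof.
move=> eZ eZ'; have := elementary_lin (-1) eZ' eZ.
by rewrite scaleN1r addrC.
Qed.

Section Restriction.
Variables (tau : Om -> R) (n : nat).
Hypothesis st : raw_stopping tau.
Let rho := dyadic_ceil tau n.

Lemma adapted_restrict s Z : adapted_to s Z ->
  adapted_to (s ++ dyadic_points T n) (Defs.restrict rho Z).
Proof.
move=> aZ u v u0 uv vT /avoids_cat[av avd].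
have [c1 m1] := aZ _ _ u0 uv vT av.
have rhoE w t : u < t <= v -> (0 <= t <= rho w) = ~~ (rho w <= u).
  move=> /andP[ut tv]; rewrite (le_trans u0 (ltW ut))/= -ltNge.
  apply/idP/idP => [|ur]; first exact: lt_le_trans.
  have := avd _ (dyadic_ceil_points T0 n st w); rewrite negb_and -!leNgt => /orP[h|].
    by move: ur; rewrite ltNge => /negP; case.
  exact: le_trans.
split=> [w t utv|].
  by rewrite /Defs.restrict rhoE// rhoE ?uv ?lexx// c1.
apply/F_measurableP.
rewrite (_ : (fun w => _) = (fun w => if rho w <= u then 0 else Z w v)); last first.
  by apply/funext => w; rewrite /Defs.restrict rhoE ?uv ?lexx//; case: (rho w <= u).
apply: bmeas_if; [|exact: bmeas_cst|exact/F_measurableP].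
by case: (dyadic_ceil_stopping T0 n st) => _; apply; rewrite u0/=; lra.
Qed.

Lemma bounded_restrict r Z : bounded_on_support Z -> bounded_on_support (Defs.restrict r Z).
Proof.
move=> [[C CP] oZ]; split; last by move=> w t ht; rewrite /Defs.restrict oZ//; case: ifP.
exists C => w t; rewrite /Defs.restrict; case: ifP => // _.
by rewrite normr0 (le_trans _ (CP w t)).
Qed.

Lemma elementary_restrict Z : elementary Z -> elementary (Defs.restrict rho Z).
Proof.
move=> /elementaryP[s aZ bZ]; apply/elementaryP.
by eexists; [exact: adapted_restrict aZ|exact: bounded_restrict].
Qed.

(** On a grid containing the dyadic points, cutting the integrand at the dyadic
    ceiling switches off exactly the increments after it, which is what stopping
    the integral does. *)
Lemma step_integral_restrict Z : elementary Z -> exists z z' : step_process T H,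
  [/\ step_field z = Z, step_field z' = Defs.restrict rho Z
    & step_integral ip z' = stopped rho (step_integral ip z)].
Proof.
move=> /elementaryP[s aZ bZ].
have aZr := adapted_restrict aZ.
have aZs : adapted_to (s ++ dyadic_points T n) Z.
  by move=> u v u0 uv vT /avoids_cat[av _]; exact: aZ.
have [m [p [[p0 pn] pT pm pav]]] := sorted_grid (s ++ dyadic_points T n).
have [z [zn zt zv zZ]] := step_of_adapted p0 pn pT pm pav aZs bZ.
have [z' [zn' zt' zv' zZ']] := step_of_adapted p0 pn pT pm pav aZr (bounded_restrict rho bZ).
exists z, z'; split => //.
apply/funext => w; apply/funext => t.
rewrite /stopped /step_integral zn zn' zt zt' zv zv'; apply: eq_bigr => k _.
have kn := ltn_ord k.
have /andP[pk0 _] := pT _ kn.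
have := pm _ kn => pk.
rewrite /Defs.restrict pk0/=.
have /avoids_cat[_ avd] := pav _ kn.
have := avd _ (dyadic_ceil_points T0 n st w); rewrite -/rho negb_and -!leNgt => /orP[h|h].
  rewrite ifF; last by apply/negbTE; rewrite -ltNge; lra.
  rewrite ip0l -!minA (min_idPl h) (min_idPl (le_trans h (ltW pk))).
  by rewrite subrr ip0r.
rewrite h -!minA (min_idPr h) (min_idPr (le_trans (ltW pk) h)).
by [].
Qed.

End Restriction.

End Grids.

(** * Square integrability and limits of expectations *)

Section Limits.
Context (R : realType).

Lemma cvg_EFinT (u : nat -> R) (l : R) : u @ \oo --> l ->
  (u n)%:E @[n --> \oo] --> l%:E.
Proof. by move=> h; apply: cvg_EFin => //; exact: nearW. Qed.

Lemma limn_einf_leub (u : nat -> \bar R) c : (forall n, (u n <= c)%E) -> (limn_einf u <= c)%E.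
Proof.
move=> uc; rewrite limn_einf_lim; apply: lime_le; first exact: is_cvg_einfs.
apply: nearW => n; apply: le_trans (uc n).
by apply: ereal_inf_lbound; exists n => /=.
Qed.

Lemma limn_einf_ge0 (u : nat -> \bar R) : (forall n, (0 <= u n)%E) -> (0 <= limn_einf u)%E.
Proof.
move=> u0; rewrite limn_einf_lim; apply: lime_ge; first exact: is_cvg_einfs.
by apply: nearW => n; apply: le_ereal_inf_tmp => _ [k _ <-].
Qed.

End Limits.

Section Expectation.
Context d (S : measurableType d) (R : realType) (P : probability S R).
Implicit Types f g : S -> R.

Local Notation intg f := (P.-integrable setT (EFin \o f)).

Definition sqint f := measurable_fun setT f /\ (\int[P]_w ((f w) ^+ 2)%:E < +oo)%E.

Lemma le_intg f g : measurable_fun setT f -> (forall w, `|f w| <= `|g w|) ->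
  intg g -> intg f.
Proof.
move=> mf fg ig; apply: (le_integrable measurableT _ _ ig).
  exact/measurable_EFinP.
by move=> w _; rewrite /= lee_fin.
Qed.

Lemma sqint_sqr f : sqint f -> intg (fun w => (f w) ^+ 2).
Proof.
move=> [mf If]; apply/integrableP; split.
  by apply/measurable_EFinP; exact: measurable_funX.
under eq_integral do rewrite /= ger0_norm ?sqr_ge0//.
exact: If.
Qed.

Lemma intgD f g : intg f -> intg g -> intg (fun w => f w + g w).
Proof. by move=> i1 i2; exact: (integrableD measurableT i1 i2). Qed.

Lemma intgB f g : intg f -> intg g -> intg (fun w => f w - g w).
Proof. by move=> i1 i2; exact: (integrableB measurableT i1 i2). Qed.

Lemma intgZ c f : intg f -> intg (fun w => c * f w).
Proof. by move=> i1; exact: (integrableZl measurableT c i1). Qed.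

Lemma intg_cst c : intg (fun _ : S => c).
Proof. exact: finite_measure_integrable_cst. Qed.

Lemma intg_meas f : intg f -> measurable_fun setT f.
Proof. by move=> /measurable_int/measurable_EFinP. Qed.

Lemma intg_sub (B : set S) f : measurable B -> intg f -> P.-integrable B (EFin \o f).
Proof. by move=> mB; apply: integrableS. Qed.

Lemma intg_bounded f C : measurable_fun setT f -> (forall w, `|f w| <= C) -> intg f.
Proof.
move=> mf fC; apply: (le_intg mf _ (intg_cst C)) => w.
by rewrite (le_trans (fC w))// ler_norm.
Qed.

Lemma sqint_mul f g : sqint f -> sqint g -> intg (fun w => f w * g w).
Proof.
move=> sf sg; have [mf _] := sf; have [mg _] := sg.
apply: (le_intg _ _ (intgD (sqint_sqr sf) (sqint_sqr sg))).
  exact: measurable_funM.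
move=> w; rewrite [leRHS]ger0_norm ?addr_ge0 ?sqr_ge0//.
rewrite normrM -(real_normK (num_real (f w))) -(real_normK (num_real (g w))).
have := sqr_ge0 (`|f w| - `|g w|).
have := mulr_ge0 (normr_ge0 (f w)) (normr_ge0 (g w)).
rewrite sqrrB; lra.
Qed.

Lemma sqint_cst c : sqint (fun _ => c).
Proof.
split; first exact: measurable_cst.
exact: (integrable_lty measurableT (intg_cst (c ^+ 2))).
Qed.

Lemma sqint_intg f : sqint f -> intg f.
Proof.
move=> sf; have := sqint_mul sf (sqint_cst 1).
by under eq_fun do rewrite /= mulr1.
Qed.

Lemma sqrintg_sqint f : measurable_fun setT f -> intg (fun w => (f w) ^+ 2) -> sqint f.
Proof.
by move=> mf i; split=> //; apply: (integrable_lty measurableT i).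
Qed.

Lemma sqintD f g : sqint f -> sqint g -> sqint (fun w => f w + g w).
Proof.
move=> sf sg; have [mf _] := sf; have [mg _] := sg.
apply: sqrintg_sqint; first exact: measurable_funD.
have := intgD (intgD (sqint_sqr sf) (intgZ 2 (sqint_mul sf sg))) (sqint_sqr sg).
by congr (P.-integrable _ _); apply/funext => w /=; congr EFin; ring.
Qed.

Lemma sqintZ c f : sqint f -> sqint (fun w => c * f w).
Proof.
move=> sf; have [mf _] := sf; apply: sqrintg_sqint.
  by apply: measurable_funM => //; exact: measurable_cst.
have := intgZ (c ^+ 2) (sqint_sqr sf).
by congr (P.-integrable _ _); apply/funext => w /=; congr EFin; ring.
Qed.

Lemma sqintB f g : sqint f -> sqint g -> sqint (fun w => f w - g w).
Proof.
move=> sf sg; have := sqintD sf (sqintZ (-1) sg).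
by congr sqint; apply/funext => w; rewrite mulN1r.
Qed.

Lemma le_sqint f g : measurable_fun setT f -> (forall w, `|f w| <= `|g w|) ->
  sqint g -> sqint f.
Proof.
move=> mf fg sg; apply: sqrintg_sqint => //.
apply: (le_intg _ _ (sqint_sqr sg)); first exact: measurable_funX.
move=> w; rewrite !normrX ler_sqr ?nnegrE//; exact: fg.
Qed.

Lemma sqint_abs f : sqint f -> sqint (fun w => `|f w|).
Proof.
move=> sf; have [mf _] := sf; apply: (le_sqint _ _ sf).
  exact: measurableT_comp.
by move=> w; rewrite normr_id.
Qed.

Lemma sqint_sum n (f : 'I_n -> S -> R) : (forall i, sqint (f i)) ->
  sqint (fun w => \sum_(i < n) f i w).
Proof.
elim: n f => [|n IH] f sf.
  by under eq_fun do rewrite big_ord0; exact: sqint_cst.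
by under eq_fun do rewrite big_ord_recr /=; apply: sqintD => //; exact: IH.
Qed.

Lemma sqint_max f g : sqint f -> sqint g -> sqint (fun w => Num.max (f w) (g w)).
Proof.
move=> sf sg; apply: (le_sqint _ _ (sqintD (sqint_abs sf) (sqint_abs sg))).
  by apply: measurable_maxr; [case: sf|case: sg].
move=> w; rewrite [leRHS]ger0_norm ?addr_ge0//.
have := normr_ge0 (f w); have := normr_ge0 (g w).
by case: (leP (f w) (g w)) => _ ? ?; lra.
Qed.

Lemma EFin_Rintegral B f : measurable B -> P.-integrable B (EFin \o f) ->
  ((\int[P]_(w in B) f w)%:E = \int[P]_(w in B) (f w)%:E)%E.
Proof. by move=> mB i; rewrite /Rintegral fineK// integrable_fin_num. Qed.

Lemma Rintegral_sum B n (f : 'I_n -> S -> R) : measurable B ->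
  (forall i, P.-integrable B (EFin \o f i)) ->
  \int[P]_(w in B) (\sum_(i < n) f i w) = \sum_(i < n) \int[P]_(w in B) f i w.
Proof.
move=> mB; elim: n f => [|n IH] f sf.
  rewrite big_ord0; under eq_Rintegral do rewrite big_ord0.
  by rewrite Rintegral_cst// mul0r.
rewrite big_ord_recr/=; under eq_Rintegral do rewrite big_ord_recr/=.
rewrite RintegralD//; first by rewrite IH.
rewrite [X in P.-integrable B X](_ : _ = fun w => (\sum_(i < n) (f (widen_ord (leqnSn n) i) w)%:E)%E).
  by apply: integrable_sum => // i _; exact: sf.
by apply/funext => w /=; rewrite sumEFin.
Qed.

Lemma Rintegral_prob_cst (c : R) : \int[P]_w c = c.
Proof.
rewrite Rintegral_cst//; apply: (@etrans _ _ (c * fine 1%E)); last by rewrite mulr1.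
by congr (c * fine _); exact: probability_setT.
Qed.

Lemma fatou_cvg (f : nat -> S -> R) (g : S -> R) (c : \bar R) :
  (forall n, measurable_fun setT (f n)) -> measurable_fun setT g ->
  (forall n w, 0 <= f n w) -> (forall w, 0 <= g w) ->
  {ae P, forall w, f n w @[n --> \oo] --> g w} ->
  (forall n, (\int[P]_w (f n w)%:E <= c)%E) ->
  (\int[P]_w (g w)%:E <= c)%E.
Proof.
move=> mf mg f0 g0 fg fc.
have mfE n : measurable_fun setT (fun w => (f n w)%:E) by apply/measurable_EFinP; exact: mf.
rewrite (ge0_ae_eq_integral (g := fun w => limn_einf (fun n => (f n w)%:E)))//.
- apply: le_trans (fatou P measurableT mfE _) _; first by move=> n w _; rewrite lee_fin.
  exact: limn_einf_leub.
- exact/measurable_EFinP.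
- rewrite (_ : (fun _ => _) = fun w => - limn_esup (-%E \o (fun n => (f n w)%:E)))%E.
    apply: measurableT_comp => //; apply: measurable_fun_limn_esup => n.
    exact: measurableT_comp.
  by apply/funext => w; rewrite limn_esupN oppeK.
- by move=> w _; rewrite lee_fin.
- by move=> w _; apply: limn_einf_ge0 => n; rewrite lee_fin.
- apply: filterS fg => w /cvg_EFinT h _.
  by rewrite is_cvg_limn_einfE; [rewrite (cvg_lim _ h)|apply/cvg_ex; eexists; exact: h].
Qed.

Lemma dct_cvg (f : nat -> S -> R) (g h : S -> R) B : measurable B ->
  (forall n, measurable_fun setT (f n)) -> measurable_fun setT g -> intg h ->
  {ae P, forall w, f n w @[n --> \oo] --> g w} ->
  {ae P, forall w n, `|f n w| <= h w} ->
  \int[P]_(w in B) f n w @[n --> \oo] --> \int[P]_(w in B) g w.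
Proof.
move=> mB mf mg ih fg fh.
have mfE n : measurable_fun B (fun w => (f n w)%:E).
  by apply/measurable_EFinP; apply: (measurable_funS measurableT) => //; exact: mf.
have mgE : measurable_fun B (fun w => (g w)%:E).
  by apply/measurable_EFinP; apply: (measurable_funS measurableT).
have [ig _ c] := dominated_convergence (mu := P) mB mfE mgE
  (filterS (fun w fw (_ : B w) => cvg_EFinT fw) fg)
  (intg_sub mB ih) (filterS (fun w fw n (_ : B w) => fw n) fh).
apply: fine_cvg.
by rewrite fineK; [exact: c|exact: integrable_fin_num].
Qed.

End Expectation.

(** * Martingale inequalities *)

Section Orthogonality.
Context (R : realType) (T : R) (H : completeNormedModType R).
Local Notation Om := (Omega T H).
Variable P : probability Om R.
Local Notation intg f := (P.-integrable setT (EFin \o f)).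

Lemma separable_real : separable_space R.
Proof.
exists (@ratr R @` setT); last exact: dense_rat.
exact: card_le_trans (card_image_le _ _) (countableP _).
Qed.

(** Conditional expectation zero extends from events to multipliers: replace the
    multiplier by a countably valued one at uniform distance e, for which the
    integral is a sum of zeros; the error is at most e times the first absolute
    moment of Y. *)
Lemma orthogonal_multiplier s (xi Y : Om -> R) : F_measurable (@F0 R T H s) xi ->
  intg Y -> intg (fun w => xi w * Y w) ->
  (forall B, F0 s B -> \int[P]_(w in B) Y w = 0) ->
  \int[P]_w (xi w * Y w) = 0.
Proof.
move=> mxi iY ixiY Y0.
apply/eqP; rewrite -normr_le0; apply/ler_addgt0Pl => e e0; rewrite addr0.
(* The summand 1 keeps c positive when Y vanishes. *)
pose c := 1 + \int[P]_w `|Y w|.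
have c0 : 0 < c by rewrite ltr_pwDl// Rintegral_ge0.
have [dd [idx [midx ddP]]] := bmeas_approx separable_real (divr_gt0 e0 c0)
  ((@F_measurableP _ _ _ _ _ xi).1 mxi).
pose xi' (w : Om) : R := dd (idx w).
have mxi' : F_measurable (@F0 R T H s) xi'.
  apply/F_measurable_realP; apply: (@measurable_glue _ (OmF T H s) _ _ idx (fun n _ => dd n)) => // n.
have mxi'T : measurable_fun setT xi' by exact: F_measurable_fun mxi'.
have err w : `|xi w - xi' w| <= e / c by exact: ltW.
have mY := intg_meas iY.
have mxiT : measurable_fun setT xi by exact: F_measurable_fun mxi.
have iD : intg (fun w => (xi w - xi' w) * Y w).
  apply: (le_intg _ _ (intgZ (e / c) iY)).
    by apply: measurable_funM => //; exact: measurable_funB.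
  by move=> w; rewrite normrM [leRHS]normrM (ger0_norm (ltW (divr_gt0 e0 c0))) ler_wpM2r.
have ixi' : intg (fun w => xi' w * Y w).
  have := intgB ixiY iD; congr (P.-integrable _ _); apply/funext => w /=.
  by congr EFin; ring.
pose A n : set Om := idx @^-1` [set n].
have FA n : F0 s (A n) by exact: midx.
have mA n : measurable (A n) by exact: F0_measurable (FA n).
have UA : \bigcup_n A n = setT by apply/seteqP; split => // w _; exists (idx w).
have z : \int[P]_w (xi' w * Y w) = 0.
  rewrite /Rintegral -UA integral_bigcup//.
  - rewrite eseries0// => n _ _.
    under eq_integral => w.
      rewrite inE /A/= => wA; rewrite /xi' wA; over.
    have iYA : P.-integrable (A n) (EFin \o Y) := intg_sub (mA n) iY.
    under eq_integral do rewrite EFinM.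
    rewrite integralZl// -(EFin_Rintegral (mA n) iYA) Y0//.
    by rewrite mule0.
  - by apply/trivIsetP => i j _ _ ij; apply/seteqP; split => // w [/= wi wj]; move: ij; rewrite -wi -wj eqxx.
  - by rewrite UA.
have -> : \int[P]_w (xi w * Y w) = \int[P]_w ((xi w - xi' w) * Y w).
  under [in RHS]eq_Rintegral do rewrite mulrBl.
  by rewrite RintegralB// z subr0.
rewrite (le_trans (le_normr_Rintegral measurableT iD))//.
apply: (@le_trans _ _ (\int[P]_w (e / c * `|Y w|))).
  apply: le_Rintegral => //; first exact: (integrable_norm iD).
    exact: (intgZ (e / c) (integrable_norm iY)).
  by move=> w _; rewrite normrM ler_wpM2r.
rewrite RintegralZl//; last exact: (integrable_norm iY).
by rewrite mulrAC ler_pdivrMr// ler_pM2l// /c lerDr.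
Qed.

End Orthogonality.

Section RunningMax.
Context (R : realType).

Fixpoint run_max (c : R) (f : nat -> R) (n : nat) : R :=
  if n is k.+1 then Num.max (run_max c f k) `|f k.+1| else c.

Lemma run_max_mono c f n m : (n <= m)%N -> run_max c f n <= run_max c f m.
Proof.
elim: m => [|m IH]; first by rewrite leqn0 => /eqP->.
rewrite leq_eqVlt => /predU1P[->//|]; rewrite ltnS => /IH h.
by rewrite /= le_max h.
Qed.

Lemma run_max_ge c f n : c <= run_max c f n.
Proof. exact: (@run_max_mono c f 0 n). Qed.

Lemma run_max_ub c f n k : (0 < k)%N -> (k <= n)%N -> `|f k| <= run_max c f n.
Proof.
case: k => // k _ kn; apply: (le_trans _ (run_max_mono c f kn)).
by rewrite /= le_max lexx orbT.
Qed.

(** Discrete summation by parts with the running maximum as weight, signed by the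
    current value.  At a step where the maximum increases, its new value is the
    current absolute value of the sequence, and the defect is a square. *)
Lemma doob_pathwise (f : nat -> R) n m : m = run_max `|f 0%N| f ->
  m n ^+ 2 <= 4 * f n ^+ 2 -
    4 * \sum_(k < n) (if f k < 0 then - m k else m k) * (f k.+1 - f k).
Proof.
move=> mE.
have m0 k : 0 <= m k by rewrite mE; apply: (le_trans (normr_ge0 (f 0%N))); exact: run_max_ge.
suff h : 2 * m n ^+ 2 - 4 * m n * `|f n| +
    4 * \sum_(k < n) (if f k < 0 then - m k else m k) * (f k.+1 - f k) <= 0.
  rewrite -(real_normK (num_real (f n))).
  have := sqr_ge0 (m n - 2 * `|f n|); rewrite sqrrB exprMn; lra.
elim: n => [|n IH]; first by rewrite big_ord0 mE /= mulr0 addr0 expr2; have := sqr_ge0 `|f 0%N|; rewrite expr2; lra.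
rewrite big_ord_recr/=.
have -> : m n.+1 = Num.max (m n) `|f n.+1| by rewrite mE.
move: IH; move: (\sum_(k < n) _) => S IH.
have key : m n * (`|f n.+1| - `|f n|) >= (if f n < 0 then - m n else m n) * (f n.+1 - f n).
  case: ltP => h.
    rewrite (ltr0_norm h) mulNr -mulrN ler_wpM2l// opprD.
    by have := ler_norm (- f n.+1); rewrite normrN; lra.
  by rewrite (ger0_norm h) ler_wpM2l// lerD2r ler_norm.
have : 2 * (Num.max (m n) `|f n.+1|) ^+ 2 - 4 * Num.max (m n) `|f n.+1| * `|f n.+1| -
   2 * m n ^+ 2 + 4 * m n * `|f n.+1| <= 0.
  case: (leP (m n) `|f n.+1|) => h; last by rewrite !expr2; lra.
  by have := sqr_ge0 (`|f n.+1| - m n); rewrite sqrrB !expr2; lra.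
move: key IH; move: (Num.max _ _) => M; move: ((if _ then _ else _) * _) => q.
rewrite mulrBr !expr2; lra.
Qed.

(** The same argument with the inverse of the running maximum as weight: it bounds
    a maximum linearly by increments of squares, so that mean bounds
    on the squares give mean bounds on the maximum. *)
Lemma lenglart_pathwise (f : nat -> R) n r : f 0%N = 0 -> r = run_max 1 f ->
  r n <= 1 + \sum_(k < n) (r k)^-1 * (f k.+1 ^+ 2 - f k ^+ 2).
Proof.
move=> f0 rE.
have r0 k : 0 < r k by rewrite rE; apply: (lt_le_trans ltr01); exact: run_max_ge.
suff h : r n + f n ^+ 2 / r n <= 1 + \sum_(k < n) (r k)^-1 * (f k.+1 ^+ 2 - f k ^+ 2).
  by apply: le_trans h; rewrite lerDl divr_ge0 ?sqr_ge0// ltW.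
elim: n => [|n IH]; first by rewrite big_ord0 f0 expr0n/= mul0r !addr0 rE.
rewrite big_ord_recr/= addrA.
have -> : r n.+1 = Num.max (r n) `|f n.+1| by rewrite rE.
apply: le_trans (lerD IH (lexx _)).
have -> : r n + f n ^+ 2 / r n + (r n)^-1 * (f n.+1 ^+ 2 - f n ^+ 2) =
   r n + f n.+1 ^+ 2 / r n by ring.
case: (leP (r n) `|f n.+1|) => h //.
have f1 : 0 < `|f n.+1| by exact: lt_le_trans h.
rewrite -(real_normK (num_real (f n.+1))).
set x := `|f n.+1| in h f1 *; have rn := r0 n.
rewrite -subr_ge0.
have -> : r n + x ^+ 2 / r n - (x + x ^+ 2 / x) = (x - r n) ^+ 2 / r n.
  by field; rewrite !gt_eqF.
by rewrite divr_ge0 ?sqr_ge0// ltW.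
Qed.

End RunningMax.

Section UniformSup.
Context (R : realType) (T : R).
Hypothesis T0 : 0 < T.

(** Real valued, so that the pathwise inequalities apply; on continuous paths it
    agrees with the extended supremum ([ereal_usup]). *)
Definition usup (f : R -> R) : R := sup [set `|f t| | t in `[0, T]%classic].

Lemma norm_max (f : R -> R) : continuous f ->
  exists2 c, 0 <= c <= T & forall t, 0 <= t <= T -> `|f t| <= `|f c|.
Proof.
move=> cf; have [] := @EVT_max R (fun t => `|f t|) 0 T (ltW T0).
  apply: continuous_subspaceT => t; apply: continuous_comp; first exact: cf.
  exact: norm_continuous.
by move=> c cT cmax; exists c => // t tT; apply: cmax; rewrite in_itv.
Qed.

Lemma usup_bounded (f : R -> R) : continuous f ->
  has_sup [set `|f t| | t in `[0, T]%classic].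
Proof.
move=> cf; split; first by exists `|f 0|, 0 => //=; rewrite in_itv/= lexx ltW.
have [c _ cmax] := norm_max cf.
by exists `|f c| => _ [t tT <-]; apply: cmax; move: tT; rewrite /= in_itv.
Qed.

Lemma usup_ub (f : R -> R) t : continuous f -> 0 <= t <= T -> `|f t| <= usup f.
Proof.
move=> cf tT; apply: ub_le_sup; last by exists t => //=; rewrite in_itv.
by case: (usup_bounded cf).
Qed.

Lemma usup_ge0 (f : R -> R) : continuous f -> 0 <= usup f.
Proof. by move=> cf; apply: (le_trans (normr_ge0 (f 0))); apply: usup_ub; rewrite // lexx ltW. Qed.

Lemma usup_le (f : R -> R) c : (forall t, 0 <= t <= T -> `|f t| <= c) -> usup f <= c.
Proof.
move=> fc; apply: ge_sup; first by exists `|f 0|, 0 => //=; rewrite in_itv/= lexx ltW.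
by move=> _ [t + <-]; rewrite /= in_itv/=; exact: fc.
Qed.

Lemma ereal_usup (f : R -> R) : continuous f ->
  ereal_sup [set (`|f t|)%:E | t in `[0, T]] = (usup f)%:E.
Proof.
move=> cf; apply/eqP; rewrite eq_le; apply/andP; split.
  apply: ge_ereal_sup => _ [t + <-]; rewrite /= in_itv/= => tT.
  by rewrite lee_fin usup_ub.
have [c cT cmax] := norm_max cf.
apply: (@le_trans _ _ (`|f c|)%:E).
  by rewrite lee_fin; exact: usup_le.
by apply: ereal_sup_ubound; exists c.
Qed.

Definition grid (n k : nat) : R := k%:R * (T / n.+1%:R).

Lemma grid_itv n k : (k <= n.+1)%N -> 0 <= grid n k <= T.
Proof.
move=> kn; rewrite /grid mulr_ge0 ?divr_ge0 ?(ltW T0)//=.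
by rewrite mulrCA ler_piMr ?(ltW T0)// ler_pdivrMr// mul1r ler_nat.
Qed.

Lemma grid_le n i k : (i <= k)%N -> grid n i <= grid n k.
Proof. by move=> ik; rewrite /grid ler_wpM2r ?divr_ge0 ?(ltW T0)// ler_nat. Qed.

Lemma grid_last n : grid n n.+1 = T.
Proof. by rewrite /grid mulrCA divff ?mulr1. Qed.

Lemma grid0 n : grid n 0 = 0. Proof. by rewrite /grid mul0r. Qed.

Definition grid_max (c : R) (f : R -> R) n := run_max c (fun k => f (grid n k)) n.+1.

(** The maximum over the grid lies between the value at the grid point just below
    a maximiser and the full supremum. *)
Lemma grid_max_cvg (c : R) (f : R -> R) : continuous f -> `|f 0| <= c ->
  grid_max c f n @[n --> \oo] --> Num.max c (usup f).
Proof.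
move=> cf f0c.
have ub n : grid_max c f n <= Num.max c (usup f).
  rewrite /grid_max; move: (leqnn n.+1); move: {1 3}n.+1 => m; elim: m => [|m IH] mn /=.
    by rewrite le_max lexx.
  by rewrite ge_max IH ?(ltnW mn)//= le_max usup_ub ?orbT// grid_itv.
have [t tT tmax] := norm_max cf.
have /andP[t0 tT'] := tT.
have supE : usup f <= `|f t| by exact: usup_le.
pose tn n := grid n (Num.truncn (t / (T / n.+1%:R))).
have Tn0 n : 0 < T / n.+1%:R by rewrite divr_gt0.
have tn0 n : 0 <= t / (T / n.+1%:R) by rewrite divr_ge0// ltW.
have tnt n : tn n <= t by rewrite /tn /grid -ler_pdivlMr// truncn_le.
have tnN n : (Num.truncn (t / (T / n.+1%:R)) <= n.+1)%N.
  have : tn n <= grid n n.+1 by rewrite grid_last (le_trans (tnt n)).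
  by rewrite /tn /grid ler_pM2r// ler_nat.
have tcvg : tn n @[n --> \oo] --> t.
  apply/cvgrPdist_lt => e e0; near=> n.
  rewrite ger0_norm ?subr_ge0// ltrBlDr.
  apply: (@lt_trans _ _ (T / n.+1%:R + tn n)).
    have := truncnS_gt (t / (T / n.+1%:R)).
    by rewrite -[X in _ < X]natr1 ltr_pdivrMr// mulrDl mul1r addrC.
  rewrite ltrD2r -ltr_pdivlMl// mulrC.
  near: n; exact: (near_infty_natSinv_lt (PosNum (divr_gt0 e0 T0))).
have fcvg : `|f (tn n)| @[n --> \oo] --> `|f t|.
  apply: cvg_norm; exact: (cvg_comp _ _ tcvg (cf t)).
have lb n : Num.max c `|f (tn n)| <= grid_max c f n.
  rewrite ge_max run_max_ge/=.
  rewrite /tn; have [k0|k0] := posnP (Num.truncn (t / (T / n.+1%:R))).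
    by rewrite k0 grid0 (le_trans f0c)// run_max_ge.
  by apply: (@run_max_ub _ c (fun k => f (grid n k))).
apply: (@squeeze_cvgr _ _ _ _ (fun n => Num.max c `|f (tn n)|) (cst (Num.max c (usup f)))).
- by apply: nearW => n; rewrite lb ub.
- have -> : usup f = `|f t| by apply/eqP; rewrite eq_le supE usup_ub// tT.
  apply/cvgrPdist_le => e e0; move/cvgrPdist_le: fcvg => /(_ e e0); apply: filterS => n.
  apply: le_trans; move: `|f t| `|f (tn n)| => x y.
  rewrite ler_norml; have := ler_norm (x - y); have := ler_norm (- (x - y)); rewrite normrN.
  by case: (leP c x) => ?; case: (leP c y) => ? ? ?; apply/andP; split; lra.
- exact: cvg_cst.
Unshelve. all: end_near. Qed.

End UniformSup.

Section Martingales.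
Context (R : realType) (T : R) (H : completeNormedModType R).
Hypothesis T0 : 0 < T.
Local Notation Om := (Omega T H).
Variable P : probability Om R.
Local Notation intg f := (P.-integrable setT (EFin \o f)).
Local Notation F := (@F0 R T H).

Lemma martingale_incr (M : Om -> R -> R) s t B : martingale P M -> 0 <= s -> s <= t ->
  t <= T -> F s B -> \int[P]_(w in B) (M w t - M w s) = 0.
Proof.
move=> [_ iM mM] s0 st tT FB; have mB := F0_measurable FB.
have it : P.-integrable B (EFin \o (M ^~ t)).
  by apply: intg_sub => //; apply: iM; rewrite tT (le_trans s0).
have is_ : P.-integrable B (EFin \o (M ^~ s)).
  by apply: intg_sub => //; apply: iM; rewrite s0 (le_trans st).
by rewrite RintegralB// /Rintegral -(mM s t B)// subrr.
Qed.

Lemma run_max_adapted c (f : nat -> Om -> R) (t : R) n :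
  (forall k, (0 < k <= n)%N -> F_measurable (F t) (f k)) -> F_measurable (F t) c ->
  F_measurable (F t) (fun w => run_max (c w) (fun k => f k w) n).
Proof.
elim: n => [//|n IH] mf mc /=; apply/F_measurable_realP.
apply: measurable_maxr.
  by apply/F_measurable_realP; apply: IH => // k /andP[k0 kn]; apply: mf; rewrite k0 ltnW.
by apply: measurableT_comp => //; apply/F_measurable_realP; apply: mf; rewrite ltnSn.
Qed.

Lemma run_max_sqint (f : nat -> Om -> R) c n :
  (forall k, (0 < k <= n)%N -> sqint P (f k)) -> sqint P c ->
  sqint P (fun w => run_max (c w) (fun k => f k w) n).
Proof.
elim: n => [//|n IH] mf mc /=; apply: sqint_max.
  by apply: IH => // k /andP[k0 kn]; apply: mf; rewrite k0 ltnW.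
by apply: sqint_abs; apply: mf; rewrite ltnSn.
Qed.

Lemma grid_max_measurable (c : Om -> R) (Y : Om -> R -> R) n : measurable_fun setT c ->
  (forall t, 0 <= t <= T -> measurable_fun setT (fun w => Y w t)) ->
  measurable_fun setT (fun w => grid_max T (c w) (Y w) n).
Proof.
move=> mc mY; rewrite /grid_max; move: (leqnn n.+1); move: {1 3}n.+1 => m.
elim: m => [//|m IH] mn /=; apply: measurable_maxr; first by apply: IH; exact: ltnW.
by apply: measurableT_comp => //; apply: mY; exact: grid_itv.
Qed.

Lemma usup_measurable (Y : Om -> R -> R) : (forall w, continuous (Y w)) ->
  (forall t, 0 <= t <= T -> measurable_fun setT (fun w => Y w t)) ->
  measurable_fun setT (fun w => usup T (Y w)).
Proof.
move=> cY mY.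
apply: (@measurable_fun_cvg _ _ _ _ (fun n w => grid_max T `|Y w 0| (Y w) n)).
  move=> n; apply: grid_max_measurable => //.
  by apply: measurableT_comp => //; apply: mY; rewrite lexx ltW.
move=> w _; have := @grid_max_cvg _ _ T0 `|Y w 0| (Y w) (cY w) (lexx _).
by rewrite (max_idPr _)// usup_ub// lexx ltW.
Qed.

(** In [doob_pathwise] the weight of each increment is known at the beginning of
    the increment, so the correction terms have mean zero. *)
Lemma doob_grid (M : Om -> R -> R) n : martingale P M ->
  (forall t, 0 <= t <= T -> sqint P (fun w => M w t)) ->
  (\int[P]_w ((grid_max T `|M w 0| (M w) n) ^+ 2)%:E <= 4%:E * \int[P]_w ((M w T) ^+ 2)%:E)%E.
Proof.
move=> mM sM; have [aM _ _] := mM.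
pose f k w := M w (grid T n k).
pose m k w := run_max `|f 0%N w| (fun k => f k w) k.
have g_itv k : (k <= n.+1)%N -> 0 <= grid T n k <= T by exact: grid_itv.
have f0E w : f 0%N w = M w 0 by rewrite /f grid0.
have sf k : (k <= n.+1)%N -> sqint P (f k) by move=> kn; apply: sM; exact: g_itv.
have sm k : (k <= n.+1)%N -> sqint P (m k).
  move=> kn; apply: run_max_sqint => [i /andP[_ ik]|]; first exact/sf/(leq_trans ik).
  exact/sqint_abs/sf.
have am k : (k <= n.+1)%N -> F_measurable (F (grid T n k)) (m k).
  have af i : (i <= k)%N -> (k <= n.+1)%N -> F_measurable (F (grid T n k)) (f i).
    move=> ik kn; apply: (F_measurable_mono (grid_le T0 n ik)).
    by apply: aM; apply: g_itv; exact: leq_trans kn.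
  move=> kn; apply: run_max_adapted => [i /andP[_ ik]|]; first exact: af.
  by apply/F_measurable_realP/measurableT_comp => //; apply/F_measurable_realP; exact: af.
pose xi k w := if f k w < 0 then - m k w else m k w.
have axi k : (k <= n.+1)%N -> F_measurable (F (grid T n k)) (xi k).
  move=> kn; have /F_measurable_realP mk := am _ kn.
  have /F_measurable_realP fk : F_measurable (F (grid T n k)) (f k) by apply: aM; exact: g_itv.
  apply/F_measurableP; apply: bmeas_if.
  - rewrite (_ : [set _ | _] = [set w | f k w < 0]) //.
    have := fk measurableT `]-oo, 0[%classic (measurable_itv _); rewrite setTI.
    by congr measurable; apply/seteqP; split => w /=; rewrite in_itv.
  - by apply/bmeas_realP; exact: measurableT_comp mk.
  - exact/bmeas_realP.
have sxi k : (k <= n.+1)%N -> sqint P (xi k).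
  move=> kn; apply: (le_sqint _ _ (sm k kn)).
    exact: F_measurable_fun (axi _ kn).
  by move=> w; rewrite /xi; case: ifP; rewrite ?normrN.
pose D (k : 'I_n.+1) w : R := xi k w * (f k.+1 w - f k w).
have sincr (k : 'I_n.+1) : sqint P (fun w => f k.+1 w - f k w).
  by apply: sqintB; apply: sf; rewrite ?ltn_ord// ltnW// ltn_ord.
have iD k : intg (D k).
  by apply: sqint_mul => //; apply: sxi; rewrite ltnW// ltn_ord.
have D0 k : \int[P]_w D k w = 0.
  have kn := ltn_ord k.
  apply: (orthogonal_multiplier (axi k (ltnW kn))) => //.
  - exact: sqint_intg.
  - exact: (iD k).
  move=> B FB; apply: martingale_incr => //.
  - by case/andP: (g_itv _ (ltnW kn)).
  - exact: grid_le.
  - by case/andP: (g_itv _ kn).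
have iS : intg (fun w => \sum_(k < n.+1) D k w).
  rewrite (_ : EFin \o _ = fun w => (\sum_(k < n.+1) (D k w)%:E)%E).
    by apply: integrable_sum => // k _; exact: iD.
  by apply/funext => w /=; rewrite sumEFin.
have iT : intg (fun w => 4 * f n.+1 w ^+ 2) by apply: intgZ; apply: sqint_sqr; exact: sf.
have im : intg (fun w => m n.+1 w ^+ 2) by apply: sqint_sqr; exact: sm.
have fT w : f n.+1 w = M w T by rewrite /f grid_last.
have mE w : grid_max T `|M w 0| (M w) n = m n.+1 w by rewrite /m f0E.
under eq_integral do rewrite mE.
under [X in (_ * X)%E]eq_integral do rewrite -fT.
have iQ : intg (fun w => f n.+1 w ^+ 2) by apply: sqint_sqr; exact: sf.
rewrite -(EFin_Rintegral measurableT im) -(EFin_Rintegral measurableT iQ).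
rewrite -EFinM lee_fin -(RintegralZl 4 measurableT iQ).
have -> : \int[P]_w (4 * f n.+1 w ^+ 2) =
   \int[P]_w (4 * f n.+1 w ^+ 2 - 4 * \sum_(k < n.+1) D k w).
  rewrite RintegralB//; last exact: intgZ.
  by rewrite (RintegralZl 4 measurableT iS) (Rintegral_sum measurableT iD) big1 ?mulr0 ?subr0.
apply: le_Rintegral => //.
  by apply: intgB => //; exact: intgZ.
by move=> w _; exact: (@doob_pathwise _ (f ^~ w) n.+1 (m ^~ w) erefl).
Qed.

Lemma doob_L2 (M : Om -> R -> R) : martingale P M -> (forall w, continuous (M w)) ->
  (forall t, 0 <= t <= T -> sqint P (fun w => M w t)) ->
  (\int[P]_w ((usup T (M w)) ^+ 2)%:E <= 4%:E * \int[P]_w ((M w T) ^+ 2)%:E)%E.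
Proof.
move=> mM cM sM.
have mMt t : 0 <= t <= T -> measurable_fun setT (fun w => M w t) by move=> /sM[].
have gc w : grid_max T `|M w 0| (M w) n @[n --> \oo] --> usup T (M w).
  have := @grid_max_cvg _ _ T0 `|M w 0| (M w) (cM w) (lexx _).
  by rewrite (max_idPr _)// usup_ub// lexx ltW.
apply: (fatou_cvg (f := fun n w => (grid_max T `|M w 0| (M w) n) ^+ 2)).
- move=> n; apply: measurable_funX; apply: grid_max_measurable => //.
  by apply: measurableT_comp => //; apply: mMt; rewrite lexx ltW.
- by apply: measurable_funX; exact: usup_measurable.
- by move=> *; exact: sqr_ge0.
- by move=> *; exact: sqr_ge0.
- apply: nearW => w.
  exact: (cvg_comp _ (fun x : R => x ^+ 2) (gc w) (@exprn_continuous _ 2 _)).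
- by move=> n; exact: doob_grid.
Qed.

(** The cross term has mean zero, [1_B * M s] being known at time s. *)
Lemma martingale_incr2 (M : Om -> R -> R) s t B : martingale P M ->
  (forall t, 0 <= t <= T -> sqint P (fun w => M w t)) ->
  0 <= s -> s <= t -> t <= T -> F s B ->
  \int[P]_(w in B) (M w t - M w s) ^+ 2 =
  \int[P]_(w in B) (M w t ^+ 2 - M w s ^+ 2).
Proof.
move=> mM sM s0 st tT FB; have mB := F0_measurable FB; have [aM _ _] := mM.
have hs : 0 <= s <= T by rewrite s0 (le_trans st).
have ht : 0 <= t <= T by rewrite tT (le_trans s0).
pose xi w := \1_B w * M w s.
have axi : F_measurable (F s) xi.
  apply/F_measurable_realP; apply: measurable_funM; last by apply/F_measurable_realP; exact: aM.
  exact: measurable_indic.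
have ind_le w : `|\1_B w : R| <= 1 by rewrite indicE; case: (_ \in _); rewrite ?normr1 ?normr0.
have sxi : sqint P xi.
  apply: (le_sqint _ _ (sM s hs)); first exact: F_measurable_fun axi.
  by move=> w; rewrite normrM ler_piMl.
have sD : sqint P (fun w => M w t - M w s) by apply: sqintB; exact: sM.
have z : \int[P]_w (xi w * (M w t - M w s)) = 0.
  apply: (orthogonal_multiplier axi) => //; [exact: sqint_intg|exact: sqint_mul|].
  by move=> C FC; exact: martingale_incr.
have z' : \int[P]_(w in B) (M w s * (M w t - M w s)) = 0.
  rewrite -z Rintegral_mkcond; apply: eq_Rintegral => w _.
  by rewrite /xi -mulrA patchE indicE; case: (_ \in _); rewrite ?mul1r ?mul0r.
have iB f : intg f -> P.-integrable B (EFin \o f) by exact: intg_sub.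
have i1 := iB _ (sqint_sqr sD).
have i2 := iB _ (sqint_mul (sM s hs) sD).
rewrite (_ : \int[P]_(w in B) (M w t ^+ 2 - M w s ^+ 2) =
  \int[P]_(w in B) ((M w t - M w s) ^+ 2 + 2 * (M w s * (M w t - M w s)))).
  rewrite RintegralD//; last exact: (integrableZl mB 2 i2).
  by rewrite RintegralZl// z' mulr0 addr0.
by apply: eq_Rintegral => w _; ring.
Qed.

Lemma localizing_near (sigma : nat -> Om -> R) : localizing P sigma ->
  {ae P, forall w, \forall n \near \oo, sigma n w = T}.
Proof.
move=> [st mono]; apply: filterS => w [n0 h0]; exists n0 => // n /= n0n.
have mn : {homo (fun n => sigma n w) : i k / (i <= k)%N >-> i <= k}.
  by apply: homo_leq => [x|y x z|i]; [exact: lexx|exact: le_trans|exact: mono].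
apply/eqP; rewrite eq_le; case: (st n) => /(_ w)/andP[_ ->] _ /=.
by rewrite -h0; exact: mn.
Qed.

Lemma stopped_cvg (sigma : nat -> Om -> R) (Y : Om -> R -> R) t : localizing P sigma ->
  t <= T -> {ae P, forall w, stopped (sigma n) Y w t @[n --> \oo] --> Y w t}.
Proof.
move=> /localizing_near; move=> h tT; apply: filterS h => w near_w.
apply: cvg_near_cst; apply: filterS near_w => n nT.
by rewrite /stopped nT (min_idPl tT).
Qed.

End Martingales.

(** * From local to square integrable martingales *)

Section LocalMartingale.
Context (R : realType) (T : R) (H : completeNormedModType R).
Hypothesis T0 : 0 < T.
Local Notation Om := (Omega T H).
Variable P : probability Om R.
Local Notation intg f := (P.-integrable setT (EFin \o f)).
Local Notation F := (@F0 R T H).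

(** N stands for a coordinate of the canonical process and A for its bracket,
    bounded by K; sigma localizes N and rho localizes [N^2 - A]. *)
Variables (N A : Om -> R -> R) (sigma rho : nat -> Om -> R) (K : R).
Hypothesis cN : forall w, continuous (N w).
Hypothesis aN : @raw_adapted R T H R N.
Hypothesis N0 : forall w, N w 0 = 0.
Hypothesis cA : forall w, continuous (A w).
Hypothesis mA : forall t, 0 <= t <= T -> measurable_fun setT (fun w => A w t).
Hypothesis A_mono : forall w s t, 0 <= s -> s <= t -> t <= T -> A w s <= A w t.
Hypothesis A0 : forall w, A w 0 = 0.
Hypothesis AK : forall w t, 0 <= t <= T -> A w t <= K.
Hypothesis lsig : localizing P sigma.
Hypothesis msig : forall n, martingale P (stopped (sigma n) N).
Hypothesis lrho : localizing P rho.
Hypothesis irho : forall n t, 0 <= t <= T ->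
  intg (fun w => stopped (rho n) N w t ^+ 2 - stopped (rho n) A w t).
Hypothesis mrho : forall n s t B, 0 <= s -> s <= t -> t <= T -> F s B ->
  \int[P]_(w in B) ((stopped (rho n) N w t ^+ 2 - stopped (rho n) A w t) -
                    (stopped (rho n) N w s ^+ 2 - stopped (rho n) A w s)) = 0.

Let A_ge0 w t : 0 <= t <= T -> 0 <= A w t.
Proof. by move=> /andP[t0 tT]; rewrite -(A0 w) A_mono. Qed.

Let T00 : 0 <= (0 : R) <= T. Proof. by rewrite lexx ltW. Qed.

Let K0 : 0 <= K.
Proof. by rewrite (le_trans _ (AK point T00))// A_ge0. Qed.

Let min_itv n w t : 0 <= t <= T -> 0 <= Num.min t (rho n w) <= T.
Proof.
case: lrho => /(_ n)[+ _] _ _ => /(_ w)/andP[r0 rT] /andP[t0 tT].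
by rewrite le_min t0 r0 ge_min tT.
Qed.

Let mN t : 0 <= t <= T -> measurable_fun setT (fun w => N w t).
Proof. by move=> tT; apply: (@F_measurable_fun _ _ _ t); exact: aN. Qed.

Let rho_stopping n : raw_stopping (rho n). Proof. by case: lrho. Qed.

Let mNs n t : 0 <= t <= T -> measurable_fun setT (fun w => stopped (rho n) N w t).
Proof. by move=> /andP[t0 _]; apply: stopped_measurable. Qed.

Let mAs n t : 0 <= t <= T -> measurable_fun setT (fun w => stopped (rho n) A w t).
Proof. by move=> /andP[t0 _]; apply: stopped_measurable. Qed.

Let As_le n w t : 0 <= t <= T -> 0 <= stopped (rho n) A w t <= K.
Proof. by move=> tT; rewrite /stopped A_ge0 ?AK ?min_itv. Qed.

Let iAs n t : 0 <= t <= T -> intg (fun w => stopped (rho n) A w t).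
Proof.
move=> tT; apply: (@intg_bounded _ _ _ P _ K); first exact: mAs.
by move=> w; have /andP[a0 aK] := As_le n w tT; rewrite ger0_norm.
Qed.

Let sNs n t : 0 <= t <= T -> sqint P (fun w => stopped (rho n) N w t).
Proof.
move=> tT; apply: sqrintg_sqint; first exact: mNs.
have := intgD (irho n tT) (iAs n tT).
by congr (P.-integrable _ _); apply/funext => w /=; rewrite subrK.
Qed.

Let run_max_bound n m :
  \int[P]_w run_max 1 (fun k => stopped (rho m) N w (grid T n k)) n.+1 <= 1 + K.
Proof.
pose f k w := stopped (rho m) N w (grid T n k).
pose a k w := stopped (rho m) A w (grid T n k).
pose r k w := run_max 1 (fun k => f k w) k.
have g_itv k : (k <= n.+1)%N -> 0 <= grid T n k <= T by exact: grid_itv.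
have f0 w : f 0%N w = 0 by rewrite /f grid0 /stopped min_l ?N0//; case: (rho_stopping m) => /(_ w)/andP[].
have a0 w : a 0%N w = 0 by rewrite /a grid0 /stopped min_l ?A0//; case: (rho_stopping m) => /(_ w)/andP[].
have r1 k w : 1 <= r k w by exact: run_max_ge.
have ar k : (k <= n.+1)%N -> F_measurable (F (grid T n k)) (fun w => (r k w)^-1).
  move=> kn; apply/F_measurable_realP.
  have mr : measurable_fun setT (r k : OmF T H (grid T n k) -> R).
    apply/F_measurable_realP; apply: (@run_max_adapted _ _ _ (cst 1)) => [i /andP[_ ik]|].
      apply: (F_measurable_mono (grid_le T0 n ik)).
      by apply: stopped_adapted => //; apply: g_itv; exact: leq_trans kn.
    by apply/F_measurableP; exact: bmeas_cst.
  have mV : measurable_fun setT (fun x : R => (Num.max 1 x)^-1).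
    apply: continuous_measurable_fun => x.
    have mx : {for x, continuous (fun x : R => Num.max 1 x)}.
      by apply: continuous_max; [exact: cvg_cst|exact: cvg_id].
    by apply: continuousV => //; rewrite gt_eqF// lt_max ltr01.
  have := measurableT_comp mV mr; congr measurable_fun.
  by apply/funext => w /=; rewrite (max_idPr (r1 k w)).
have mr k : (k <= n.+1)%N -> measurable_fun setT (fun w => (r k w)^-1).
  by move=> /ar; exact: F_measurable_fun.
have rle k w : `|(r k w)^-1| <= 1.
  by rewrite ger0_norm ?invr_ge0 ?invf_le1// (lt_le_trans ltr01 (r1 k w), le_trans ler01 (r1 k w)).
have sf k : (k <= n.+1)%N -> sqint P (f k) by move=> /g_itv; exact: sNs.
have ia k : (k <= n.+1)%N -> intg (a k) by move=> /g_itv; exact: iAs.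
have iV k (g : Om -> R) : (k <= n.+1)%N -> intg g -> intg (fun w => (r k w)^-1 * g w).
  move=> kn ig; apply: (le_intg _ _ ig).
    by apply: measurable_funM; [exact: mr|exact: intg_meas ig].
  by move=> w; rewrite normrM ler_piMl.
have ik (k : 'I_n.+1) := ltnW (ltn_ord k).
pose D (k : 'I_n.+1) w : R := (r k w)^-1 * (f k.+1 w ^+ 2 - f k w ^+ 2).
pose E (k : 'I_n.+1) w : R := (r k w)^-1 * (a k.+1 w - a k w).
have iff (k : 'I_n.+1) : intg (fun w => f k.+1 w ^+ 2 - f k w ^+ 2).
  by apply: intgB; apply: sqint_sqr; apply: sf => //.
have iaa (k : 'I_n.+1) : intg (fun w => a k.+1 w - a k w).
  by apply: intgB; apply: ia.
have iD k : intg (D k) by exact: iV.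
have iE k : intg (E k) by exact: iV.
have DE k : \int[P]_w D k w = \int[P]_w E k w.
  apply/eqP; rewrite -subr_eq0 -RintegralB//; apply/eqP.
  pose Y w := (f k.+1 w ^+ 2 - a k.+1 w) - (f k w ^+ 2 - a k w).
  have YE w : Y w = (f k.+1 w ^+ 2 - f k w ^+ 2) - (a k.+1 w - a k w) by rewrite /Y; ring.
  have iY : intg Y.
    by have := intgB (iff k) (iaa k); congr (P.-integrable _ _); apply/funext => w /=; rewrite YE.
  rewrite (_ : (fun w => D k w - E k w) = (fun w => (r k w)^-1 * Y w)); last first.
    by apply/funext => w; rewrite YE /D /E -mulrBr.
  apply: (orthogonal_multiplier (ar k (ik k))) => //; first exact: iV.
  move=> B FB; apply: mrho => //.
  - by case/andP: (g_itv _ (ik k)).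
  - exact: grid_le.
  - by case/andP: (g_itv _ (ltn_ord k)).
have irun : intg (r n.+1).
  apply: sqint_intg; apply: run_max_sqint => [k /andP[_ kn]|]; first exact: sf.
  exact: sqint_cst.
have iS (G : 'I_n.+1 -> Om -> R) : (forall k, intg (G k)) -> intg (fun w => \sum_(k < n.+1) G k w).
  move=> iG; rewrite (_ : EFin \o _ = fun w => (\sum_(k < n.+1) (G k w)%:E)%E).
    by apply: integrable_sum => // k _; exact: iG.
  by apply/funext => w /=; rewrite sumEFin.
apply: (@le_trans _ _ (\int[P]_w (1 + \sum_(k < n.+1) D k w))).
  apply: le_Rintegral => //; first by apply: intgD; [exact: intg_cst|exact: iS].
  by move=> w _; exact: (@lenglart_pathwise _ (f ^~ w) n.+1 (r ^~ w) (f0 w) erefl).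
have c1 := Rintegral_prob_cst P.
rewrite RintegralD//; last 2 first.
- exact: (intg_cst P 1).
- exact: iS.
rewrite c1 lerD2l (Rintegral_sum measurableT iD).
under eq_bigr do rewrite DE.
rewrite -(Rintegral_sum measurableT iE) -[leRHS]c1.
apply: le_Rintegral => //; [exact: iS|exact: intg_cst|].
move=> w _; apply: (@le_trans _ _ (\sum_(k < n.+1) (a k.+1 w - a k w))).
  apply: ler_sum => k _; rewrite /E ler_piMl//.
    rewrite subr_ge0 /a /stopped A_mono//.
    - by case/andP: (min_itv m w (g_itv _ (ik k))).
    - by rewrite le_min !ge_min lexx orbT andbT (grid_le T0 n (leqnSn k)).
    - by case/andP: (min_itv m w (g_itv _ (ltn_ord k))).
  exact: le_trans (ler_norm _) (rle _ _).
rewrite -(big_mkord xpredT (fun k => a k.+1 w - a k w)) telescope_sumr//.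
rewrite a0 subr0; have := As_le m w (g_itv _ (leqnn n.+1)).
by case/andP.
Qed.

(** A bound on the mean of the running maximum that depends on neither the
    localization nor the grid passes to the limit by Fatou; the supremum then
    dominates all the stopped processes at once. *)
Lemma sup_integrable : intg (fun w => usup T (N w)).
Proof.
have mu : measurable_fun setT (fun w => usup T (N w)) by apply: usup_measurable => //.
have nonneg w : 0 <= usup T (N w) by exact: usup_ge0.
apply/integrableP; split; first exact/measurable_EFinP.
under eq_integral do rewrite /= ger0_norm//.
apply: (@le_lt_trans _ _ (1 + K)%:E); last exact: ltry.
apply: (@le_trans _ _ (\int[P]_w (Num.max 1 (usup T (N w)))%:E)%E).
  apply: ge0_le_integral => //.
  - by move=> w _; rewrite lee_fin.
  - exact/measurable_EFinP.
  - by apply/measurable_EFinP; apply: measurable_maxr.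
  - by move=> w _; rewrite lee_fin le_max lexx orbT.
apply: (fatou_cvg (f := fun n w => grid_max T 1 (N w) n)).
- by move=> n; apply: grid_max_measurable.
- by apply: measurable_maxr.
- by move=> n w; apply: (le_trans ler01); exact: run_max_ge.
- by move=> w; rewrite le_max ler01.
- by apply: nearW => w; apply: grid_max_cvg; rewrite ?N0 ?normr0.
move=> n; apply: (fatou_cvg (f := fun m w => grid_max T 1 (stopped (rho m) N w) n)).
- by move=> m; apply: grid_max_measurable => // t tT; exact: mNs.
- exact: grid_max_measurable.
- by move=> m w; apply: (le_trans ler01); exact: run_max_ge.
- by move=> w; apply: (le_trans ler01); exact: run_max_ge.
- apply: filterS (localizing_near lrho) => w near_w.
  apply: cvg_near_cst; apply: filterS near_w => m mT.
  rewrite /grid_max; move: (leqnn n.+1); move: {1 3 4}n.+1 => k.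
  elim: k => [//|k IH] kn /=; rewrite IH ?(ltnW kn)// /stopped mT min_l//.
  by case/andP: (grid_itv T0 kn).
- move=> m; rewrite -(EFin_Rintegral measurableT) ?lee_fin; first exact: run_max_bound.
  apply: sqint_intg; apply: run_max_sqint => [k /andP[_ kn]|]; last exact: sqint_cst.
  by apply: sNs; exact: grid_itv.
Qed.

Let sup_ge n w t (tau : nat -> Om -> R) : (forall n, raw_stopping (tau n)) -> 0 <= t <= T ->
  `|stopped (tau n) N w t| <= usup T (N w).
Proof.
move=> st /andP[t0 tT]; rewrite /stopped usup_ub//.
by case: (st n) => /(_ w)/andP[r0 rT] _; rewrite le_min t0 r0 ge_min tT.
Qed.

Lemma local_martingale_martingale : martingale P N.
Proof.
have [st _ _] := lsig.
have iN t : 0 <= t <= T -> intg (fun w => N w t).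
  move=> tT; apply: (le_intg _ _ sup_integrable); first exact: mN.
  by move=> w; rewrite [leRHS]ger0_norm ?usup_ge0// usup_ub.
split=> // s t B s0 stt tT FB; have mB := F0_measurable FB.
have hs : 0 <= s <= T by rewrite s0 (le_trans stt).
have ht : 0 <= t <= T by rewrite tT (le_trans s0).
have lim u : 0 <= u <= T ->
    \int[P]_(w in B) stopped (sigma n) N w u @[n --> \oo] --> \int[P]_(w in B) N w u.
  move=> uT; apply: (dct_cvg (h := fun w => usup T (N w))) => //.
  - by move=> n; case/andP: uT => u0 _; apply: stopped_measurable.
  - exact: mN.
  - exact: sup_integrable.
  - by case/andP: uT => _; exact: stopped_cvg.
  - by apply: nearW => w n; exact: sup_ge.
have e n : \int[P]_(w in B) stopped (sigma n) N w s = \int[P]_(w in B) stopped (sigma n) N w t.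
  by case: (msig n) => _ _ /(_ s t B s0 stt tT FB) h; rewrite /Rintegral h.
have : \int[P]_(w in B) N w s = \int[P]_(w in B) N w t.
  have h := lim s hs; rewrite (funext e) in h.
  exact: (cvg_unique (@Rhausdorff R) h (lim t ht)).
move=> h; have := congr1 EFin h.
by rewrite !EFin_Rintegral//; apply: intg_sub => //; exact: iN.
Qed.

Lemma local_martingale_sqr t : 0 <= t <= T ->
  sqint P (fun w => N w t) /\ (\int[P]_w (N w t ^+ 2)%:E <= K%:E)%E.
Proof.
move=> tT; have mNt := mN tT.
suff h : (\int[P]_w (N w t ^+ 2)%:E <= K%:E)%E by split => //; split => //; exact: (le_lt_trans h (ltry _)).
apply: (fatou_cvg (f := fun n w => stopped (rho n) N w t ^+ 2)).
- by move=> n; apply: measurable_funX; exact: mNs.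
- exact: measurable_funX.
- by move=> *; exact: sqr_ge0.
- by move=> *; exact: sqr_ge0.
- have /andP[_ tT'] := tT.
  apply: filterS (stopped_cvg N lrho tT') => w cw.
  exact: (cvg_comp _ (fun x : R => x ^+ 2) cw (@exprn_continuous _ 2 _)).
move=> n; have i2 := sqint_sqr (sNs n tT); have i1 := iAs n tT.
rewrite -(EFin_Rintegral measurableT i2) lee_fin.
have z0 : \int[P]_w (stopped (rho n) N w t ^+ 2 - stopped (rho n) A w t) = 0.
  rewrite -[RHS](mrho n (lexx 0) (proj1 (andP tT)) (proj2 (andP tT)) (@measurableT _ (OmF T H 0))).
  apply: eq_Rintegral => w _.
  have r0 : 0 <= rho n w by case: (rho_stopping n) => /(_ w)/andP[].
  have stop0 Y : stopped (rho n) Y w 0 = Y w 0 by rewrite /stopped (min_idPl r0).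
  by rewrite !stop0 N0 A0 expr0n/= !subr0.
have : \int[P]_w stopped (rho n) N w t ^+ 2 = \int[P]_w stopped (rho n) A w t.
  by apply/eqP; rewrite -subr_eq0 -RintegralB// z0.
move=> ->; rewrite -[leRHS](Rintegral_prob_cst P); apply: le_Rintegral => //; first exact: intg_cst.
by move=> w _; case/andP: (As_le n w tT).
Qed.

(** The square of the supremum, integrable by Doob, dominates the squares of the
    stopped processes, so the localization of [N^2 - A] can be removed. *)
Lemma local_martingale_bracket s t B : 0 <= s -> s <= t -> t <= T -> F s B ->
  \int[P]_(w in B) (N w t - N w s) ^+ 2 = \int[P]_(w in B) (A w t - A w s).
Proof.
move=> s0 stt tT FB; have mB := F0_measurable FB.
have hs : 0 <= s <= T by rewrite s0 (le_trans stt).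
have ht : 0 <= t <= T by rewrite tT (le_trans s0).
have hT : 0 <= T <= T by rewrite lexx ltW.
have mart := local_martingale_martingale.
have sN u : 0 <= u <= T -> sqint P (fun w => N w u) by move=> /local_martingale_sqr[].
rewrite (martingale_incr2 mart sN)//.
have iA u : 0 <= u <= T -> intg (fun w => A w u).
  move=> uT; apply: (@intg_bounded _ _ _ P _ K); first exact: mA.
  by move=> w; rewrite ger0_norm ?A_ge0// AK.
have mu : measurable_fun setT (fun w => usup T (N w)) by apply: usup_measurable => //.
have supsq : intg (fun w => usup T (N w) ^+ 2).
  apply/integrableP; split; first by apply/measurable_EFinP; exact: measurable_funX.
  under eq_integral do rewrite /= ger0_norm ?sqr_ge0//.
  apply: (le_lt_trans (doob_L2 T0 mart cN sN)).
  apply: (@le_lt_trans _ _ (4%:E * K%:E)%E); last by rewrite -EFinM ltry.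
  by apply: lee_wpmul2l; [rewrite lee_fin|case: (local_martingale_sqr hT)].
have lim u : 0 <= u <= T ->
    \int[P]_(w in B) (stopped (rho n) N w u ^+ 2 - stopped (rho n) A w u) @[n --> \oo] -->
    \int[P]_(w in B) (N w u ^+ 2 - A w u).
  move=> uT; apply: (dct_cvg (h := fun w => usup T (N w) ^+ 2 + K)) => //.
  - by move=> n; apply: measurable_funB; [apply: measurable_funX; exact: mNs|exact: mAs].
  - by apply: measurable_funB; [apply: measurable_funX; exact: mN|exact: mA].
  - by apply: intgD => //; exact: intg_cst.
  - have /andP[_ uT'] := uT.
    apply: filterS2 (stopped_cvg N lrho uT') (stopped_cvg A lrho uT') => w cw cw'.
    apply: cvgB => //.
    exact: (cvg_comp _ (fun x : R => x ^+ 2) cw (@exprn_continuous _ 2 _)).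
  - apply: nearW => w n; rewrite (le_trans (ler_normB _ _))// lerD//.
      by rewrite normrX ler_sqr ?nnegrE ?usup_ge0// sup_ge.
    by have /andP[a0 aK] := As_le n w uT; rewrite ger0_norm.
have e n : \int[P]_(w in B) (stopped (rho n) N w t ^+ 2 - stopped (rho n) A w t) =
   \int[P]_(w in B) (stopped (rho n) N w s ^+ 2 - stopped (rho n) A w s).
  apply/eqP; rewrite -subr_eq0 -RintegralB//; [|exact/intg_sub/irho|exact/intg_sub/irho].
  by apply/eqP; exact: mrho.
have eq : \int[P]_(w in B) (N w t ^+ 2 - A w t) = \int[P]_(w in B) (N w s ^+ 2 - A w s).
  have h := lim t ht; rewrite (funext e) in h.
  exact: (cvg_unique (@Rhausdorff R) h (lim s hs)).
have i2 u : 0 <= u <= T -> P.-integrable B (EFin \o (fun w => N w u ^+ 2)).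
  by move=> uT; apply: intg_sub => //; apply: sqint_sqr; exact: sN.
have i1 u : 0 <= u <= T -> P.-integrable B (EFin \o (fun w => A w u)).
  by move=> uT; apply: intg_sub => //; exact: iA.
move: eq; rewrite (RintegralB mB (i2 _ ht) (i1 _ ht)) (RintegralB mB (i2 _ hs) (i1 _ hs)).
rewrite (RintegralB mB (i2 _ ht) (i2 _ hs)) (RintegralB mB (i1 _ ht) (i1 _ hs)); lra.
Qed.

End LocalMartingale.

(** * Bracket density and coordinates of the canonical process *)

Section LinearBound.
Context (R : realType) (H : completeNormedModType R) (ip : inner_product H).

Lemma nonneg_op_bound (A : H -> H) : nonneg_op ip A ->
  exists2 G : R, 0 <= G & forall x, ip (A x) x <= G * `|x| ^+ 2.
Proof.
move=> [[lin cont _] _].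
have A0 : A 0 = 0.
  by have := lin (-1) 0 0; rewrite scaler0 addr0 scaleN1r addNr.
have AZ c x : A (c *: x) = c *: A x by have := lin c x 0; rewrite A0 !addr0.
have [d /= d0 dP] : exists2 d : R, 0 < d & forall x, `|x| < d -> `|A x| < 1.
  have /cvgrPdist_lt/(_ 1 ltr01) := cont 0; rewrite A0.
  move=> /nbhs_ballP[d /= d0 dP]; exists d => // x xd.
  by have := dP x; rewrite -ball_normE /= !sub0r !normrN; exact.
have d20 : 0 < d / 2 by rewrite divr_gt0.
exists (2 / d); first by rewrite divr_ge0// ltW.
move=> x; have [->|x0] := eqVneq x 0; first by rewrite ip0r normr0 expr0n mulr0.
have nx : 0 < `|x| by rewrite normr_gt0.
have c0 : 0 <= d / 2 / `|x| by rewrite divr_ge0// ltW.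
have : `|A ((d / 2 / `|x|) *: x)| < 1.
  apply: dP; rewrite normrZ (ger0_norm c0) divfK ?gt_eqF//; lra.
rewrite AZ normrZ (ger0_norm c0) => h.
have bd : `|A x| <= 2 / d * `|x|.
  have e : d / 2 / `|x| * (2 / d * `|x|) = 1 by field; rewrite !gt_eqF.
  by rewrite -(ler_pM2l (divr_gt0 d20 nx)) e ltW.
apply: (le_trans (ler_norm _)); apply: (le_trans (ip_CS _ _ _)).
by rewrite expr2 mulrA ler_wpM2r.
Qed.

End LinearBound.

Section RegularDensity.
Context (R : realType) (T : R) (H : completeNormedModType R) (ip : inner_product H).
Hypothesis T0 : 0 < T.
Hypothesis Hsep : separable_space H.
Local Notation Om := (Omega T H).
Local Notation leb := (@lebesgue_measure R).

(** The bracket density is nonnegative and dominated only almost everywhere; a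
    version with these properties at every point has finite quadratic forms along
    every path, to which Tonelli's theorem applies. *)
Definition regular_density (G : R) (b : Om -> R -> H -> H) : Prop :=
  [/\ 0 <= G,
      (forall w t, continuous (b w t)),
      (forall w t x, 0 <= ip (b w t x) x <= G * `|x| ^+ 2)
    & (forall h k, measurable_fun setT (fun p : R * Om => ip (b p.2 p.1 h) k))].

Lemma predictable_measurable (Y : Om -> R -> R) : predictable Y ->
  measurable_fun (`[0, T]%classic `*` setT) (fun p : R * Om => Y p.2 p.1).
Proof.
move=> pY; apply: (measurability _ (RGenOpens.measurableE R)).
move=> _ [_ [c [d ->] <-]].
have : @predictable_sets R T H `<=` (measurable : set (set (R * Om))).
  apply: smallest_sub.
    split => //; first by move=> A mA; apply: measurableD => //; exact: measurableX.
    by move=> F mF; exact: bigcup_measurable.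
  move=> C [[A FA ->]|[s [t [A [_ _ _ FA ->]]]]]; apply: measurableX => //.
    exact: F0_measurable FA.
  exact: F0_measurable FA.
apply; have := pY `]c, d[%classic.
rewrite (_ : [set _ | _] = (`[0, T] `*` setT) `&` ((fun p : R * Om => Y p.2 p.1) @^-1` `]c, d[%classic)).
  by apply; apply: sub_sigma_algebra; exact: interval_open.
by apply/seteqP; split => -[t w] /= []; [move=> ? ?; split|move=> [? _] ?; split].
Qed.

Lemma section_measurable (Y : Om -> R -> R) w : predictable Y ->
  measurable_fun `[0, T] (fun t => Y w t).
Proof.
move=> /predictable_measurable mY _ B mB.
have := measurable_ysection w (mY (measurableX (measurable_itv _) measurableT) B mB).
congr measurable; apply/seteqP; split => t; rewrite /ysection/= inE/=.
  by case=> -[].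
by move=> [? ?]; split.
Qed.

(** Put 0 for the density on a measurable null set containing the exceptional
    points; by Tonelli almost every path meets this set in a null set of times. *)
Lemma regular_version (Gamma : H -> H) (G : R) (P : probability Om R) a : 0 <= G ->
  (forall x, ip (Gamma x) x <= G * `|x| ^+ 2) -> bracket_density ip Gamma P a ->
  exists2 b, regular_density G b &
    {ae P, forall w, {ae leb, forall t, t \in `[0, T] -> a w t = b w t}}.
Proof.
move=> G0 GP [sa pa [Nn [mNn N0 Nsub]] _].
pose D : set (R * Om) := (`[0, T]%classic `*` setT) `\` Nn.
have mD0 : measurable (`[0, T]%classic `*` [set: Om] : set (R * Om)) by exact: measurableX.
have mD : measurable D by exact: measurableD.
pose b w t := if `[< D (t, w) >] then a w t else fun=> 0.
have Dgood t w : D (t, w) -> nonneg_op ip (a w t) /\ loewner_le ip (a w t) Gamma.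
  move=> [[/= tT _] nN]; apply: contrapT => bad; apply: nN; apply: Nsub => /=.
  by move=> h; apply: bad; exact: h.
exists b.
  split => //.
  - move=> w t; rewrite /b; case: ifP => _; first by case: (sa w t).
    exact: cst_continuous.
  - move=> w t x; rewrite /b; case: ifPn => [/asboolP/Dgood[[_ pos] lo]|_].
      by rewrite pos (le_trans (lo x)).
    by rewrite ip0l lexx mulr_ge0// exprn_ge0.
  - move=> h k.
    rewrite (_ : (fun p => _) = (fun p : R * Om => ip (a p.2 p.1 h) k) \_ D).
        apply: (measurable_restrictT _ mD).1.
      apply: (measurable_funS mD0); first by move=> p [].
      exact: (predictable_measurable (pa h k)).
    apply/funext => -[t w]; rewrite patchE /b /=.
    have [h'|h'] := pselect (D (t, w)); first by rewrite asboolT// mem_set.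
    by rewrite asboolF// memNset// ip0l.
have : {ae P, forall w, leb (ysection Nn w) = 0%E}.
  have m1 : measurable_fun setT (fun p : R * Om => ((\1_Nn p)%:E : \bar R)).
    by apply/measurable_EFinP; exact: measurable_indic.
  have p0 (p : R * Om) : (0 <= (\1_Nn p)%:E :> \bar R)%E by rewrite lee_fin.
  have := @fubini_tonelli2 _ _ _ _ _ leb P _ m1 p0.
  have -> : (\int[leb \x P]_z (\1_Nn z)%:E = 0)%E by rewrite integral_indic// setIT; exact: N0.
  move=> /esym h.
  have mG : measurable_fun setT (fubini_G leb (fun p : R * Om => (\1_Nn p)%:E) : Om -> \bar R).
    exact: (@measurable_fun_fubini_tonelli_G _ _ _ _ _ leb _ m1 p0).
  have [+ _] := ae_eq_integral_abs P measurableT mG.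
  rewrite (eq_integral (fubini_G leb (fun p => (\1_Nn p)%:E))); last first.
    by move=> w _; rewrite gee0_abs//; apply: integral_ge0 => t _; rewrite lee_fin.
  move=> /(_ h); apply: filterS => w /(_ I) /=.
  rewrite /fubini_G => <-.
  rewrite -[ysection _ _]setIT -integral_indic//; last exact: measurable_ysection.
  by apply: eq_integral => t _; rewrite !indicE mem_ysection.
apply: filterS => w w0.
exists (ysection Nn w); split => //; first exact: measurable_ysection.
move=> t /= bad; rewrite /ysection/= inE; apply: contrapT => nN; apply: bad => tT.
by rewrite /b ifT//; apply/asboolP; split => //; split.
Qed.

Section Quadratic.
Variables (G : R) (b : Om -> R -> H -> H).
Hypothesis reg : regular_density G b.

(** The increment over ]s,t] of the bracket of [<X,x>]. *)
Definition quad s t (x : H) (w : Om) : \bar R :=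
  (\int[leb]_(u in `]s, t]) (ip (b w u x) x)%:E)%E.

Lemma quad_measurable (Z : Om -> H) s t : bmeas Z ->
  measurable_fun setT (fun w => quad s t (Z w) w).
Proof.
move=> mZ; have mS : measurable ((`]s, t]%classic `*` [set: Om]) : set (R * Om)) by exact: measurableX.
pose g := (fun p : R * Om => (ip (b p.2 p.1 (Z p.2)) (Z p.2))%:E) \_ (`]s, t]%classic `*` [set: Om]).
have mg : measurable_fun setT g.
  apply: (measurable_restrictT _ mS).1; apply: (measurable_funS measurableT) => //.
  apply/measurable_EFinP; apply: (bmeas_form Hsep (c := fun p => b p.2 p.1) (Z := fun p : R * Om => Z p.2)).
  - by move=> p; case: reg.
  - by case: reg.
  move=> U oU; have := mZ U oU => mU.
  rewrite (_ : _ @^-1` U = setT `*` (Z @^-1` U)); first exact: measurableX.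
  by apply/seteqP; split => p //= [].
have g0 p : (0 <= g p)%E.
  rewrite /g patchE; case: ifP => // _; rewrite lee_fin.
  by case: reg => _ _ /(_ p.2 p.1 (Z p.2))/andP[].
have := @measurable_fun_fubini_tonelli_G _ _ _ _ _ leb _ mg g0.
congr measurable_fun; apply/funext => w; rewrite /fubini_G /quad [RHS]integral_mkcond.
apply: eq_integral => u _; rewrite /g !patchE.
congr (if _ then _ else _); apply/idP/idP; rewrite !inE //=.
by case.
Qed.

Lemma quad_section_measurable x w (D : set R) : measurable D ->
  measurable_fun D (fun u => (ip (b w u x) x)%:E).
Proof.
move=> mD; apply/measurable_EFinP; apply: (measurable_funS measurableT) => //.
case: reg => _ _ _ mb.
exact: (measurableT_comp (mb x x) (@pair2_measurable _ _ _ _ w)).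
Qed.

Lemma quad_integrand_ge0 x w u : (0 <= (ip (b w u x) x)%:E)%E.
Proof. by rewrite lee_fin; case: reg => _ _ /(_ w u x)/andP[]. Qed.

Lemma quad_ge0 s t x w : (0 <= quad s t x w)%E.
Proof. by apply: integral_ge0 => u _; exact: quad_integrand_ge0. Qed.

Lemma quad_le s t x w : s <= t -> (quad s t x w <= (G * `|x| ^+ 2 * (t - s))%:E)%E.
Proof.
move=> st; apply: (@le_trans _ _ (\int[leb]_(u in `]s, t]) (G * `|x| ^+ 2)%:E)%E).
  apply: ge0_le_integral => //.
  - by move=> u _; exact: quad_integrand_ge0.
  - exact: quad_section_measurable.
  - by move=> u _; rewrite lee_fin; case: reg => _ _ /(_ w u x)/andP[].
rewrite integral_cst//= lebesgue_measure_itv/= lte_fin.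
case: ifPn => [_|]; first by rewrite -EFinB -EFinM.
by rewrite -leNgt => ts; rewrite mule0 lee_fin mulr_ge0 ?subr_ge0//; case: reg => G0 *; rewrite mulr_ge0// exprn_ge0.
Qed.

Lemma quad_fin s t x w : quad s t x w \is a fin_num.
Proof.
have [st|ts] := leP s t; last first.
  by rewrite /quad set_itv_ge ?integral_set0//= -leNgt bnd_simp ltW.
by rewrite ge0_fin_numE ?quad_ge0// (le_lt_trans (quad_le x w st)) ?ltry.
Qed.

Lemma quad_add r s t x w : r <= s -> s <= t ->
  quad r t x w = (quad r s x w + quad s t x w)%E.
Proof.
move=> rs st; rewrite /quad (@itv_bndbnd_setU _ _ _ (BRight s)) ?bnd_simp//.
rewrite ge0_integral_setU//=.
- apply: quad_section_measurable; exact: measurableU.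
- by move=> u _; exact: quad_integrand_ge0.
rewrite disj_set2E; apply/eqP/seteqP; split => u //= []; rewrite !in_itv/=.
by move=> /andP[_ h1] /andP[h2 _]; move: (le_lt_trans h1 h2); rewrite ltxx.
Qed.

Definition quad_primitive (x : H) (w : Om) (t : R) : R := fine (quad 0 t x w).

Lemma quad_primitive0 x w t : t <= 0 -> quad_primitive x w t = 0.
Proof. by move=> t0; rewrite /quad_primitive /quad set_itv_ge ?integral_set0//= -leNgt bnd_simp. Qed.

Lemma quad_primitive_incr x w s t : 0 <= s -> s <= t ->
  ((quad_primitive x w t - quad_primitive x w s)%:E = quad s t x w)%E.
Proof.
move=> s0 st; rewrite EFinB !fineK ?quad_fin// (quad_add x w s0 st).
by rewrite addeAC subee ?quad_fin// add0e.
Qed.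

Lemma quad_primitive_lip x w s t : s <= t ->
  0 <= quad_primitive x w t - quad_primitive x w s <= G * `|x| ^+ 2 * (t - s).
Proof.
move=> st; have GG : 0 <= G * `|x| ^+ 2 by case: reg => G0 *; rewrite mulr_ge0// exprn_ge0.
have [s0|s0] := leP 0 s.
  by rewrite -!lee_fin quad_primitive_incr// quad_ge0 quad_le.
rewrite (quad_primitive0 _ _ (ltW s0)) subr0.
have [t0|t0] := leP t 0; first by rewrite quad_primitive0// lexx mulr_ge0// subr_ge0.
rewrite -!lee_fin fineK ?quad_fin// quad_ge0/= (le_trans (quad_le _ _ (ltW t0)))// lee_fin.
by rewrite ler_wpM2l// lerD2l lerN2 ltW.
Qed.

Lemma quad_primitive_continuous x w : continuous (quad_primitive x w).
Proof.
have GG : 0 <= G * `|x| ^+ 2 by case: reg => G0 *; rewrite mulr_ge0// exprn_ge0.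
move=> t; apply/cvgrPdist_lt => e e0.
have c0 : 0 < G * `|x| ^+ 2 + 1 by rewrite ltr_wpDl.
near=> s.
have h : `|t - s| * (G * `|x| ^+ 2 + 1) < e.
  rewrite -ltr_pdivlMr//; near: s; apply: cvgr_dist_lt; last exact: divr_gt0.
  exact: cvg_id.
apply: le_lt_trans h.
have key r u : r <= u -> `|quad_primitive x w u - quad_primitive x w r| <= `|u - r| * (G * `|x| ^+ 2 + 1).
  move=> ru; have /andP[h1 h2] := quad_primitive_lip x w ru.
  rewrite ger0_norm// (le_trans h2)// ger0_norm ?subr_ge0// mulrC ler_wpM2l ?subr_ge0//.
  by rewrite lerDl.
by have [ts|st] := leP s t; [exact: key|rewrite distrC (distrC t); apply/key/ltW].
Unshelve. all: end_near. Qed.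

Lemma quad_primitive_measurable x t : measurable_fun setT (fun w => quad_primitive x w t).
Proof.
apply: (measurableT_comp (fine_measurable measurableT)).
by apply: (quad_measurable (Z := cst x)); exact: bmeas_cst.
Qed.

End Quadratic.

End RegularDensity.

Section CoordinateMartingales.
Context (R : realType) (T : R) (H : completeNormedModType R) (ip : inner_product H).
Hypothesis T0 : 0 < T.
Hypothesis Hsep : separable_space H.
Local Notation Om := (Omega T H).
Local Notation leb := (@lebesgue_measure R).
Variable P : probability Om R.
Local Notation intg f := (P.-integrable setT (EFin \o f)).
Local Notation F := (@F0 R T H).

Lemma ae_eq_intg (f g : Om -> R) : measurable_fun setT f -> intg g ->
  {ae P, forall w, f w = g w} -> intg f.
Proof.
move=> mf ig fg; have mg := intg_meas ig.
apply/integrableP; split; first exact/measurable_EFinP.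
move/integrableP : ig => [_]; congr (_ < _)%E; apply: ae_eq_integral => //.
- by apply: measurableT_comp => //; exact/measurable_EFinP.
- by apply: measurableT_comp => //; exact/measurable_EFinP.
- by apply: filterS fg => w /= -> _.
Qed.

Lemma ae_eq_Rintegral B (f g : Om -> R) : measurable B -> measurable_fun setT f ->
  measurable_fun setT g -> {ae P, forall w, f w = g w} ->
  \int[P]_(w in B) f w = \int[P]_(w in B) g w.
Proof.
move=> mB mf mg fg; congr fine; apply: ae_eq_integral => //.
- by apply/measurable_EFinP; exact: (measurable_funS measurableT).
- by apply/measurable_EFinP; exact: (measurable_funS measurableT).
- by apply: filterS fg => w /= -> _.
Qed.

Variables (Gamma : H -> H) (G : R) (a b : Om -> R -> H -> H).
Hypothesis law : coord_local_martingale ip P.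
Hypothesis dens : bracket_density ip Gamma P a.
Hypothesis reg : regular_density ip G b.
Hypothesis ab : {ae P, forall w, {ae leb, forall t, t \in `[0, T] -> a w t = b w t}}.

Variable h : H.
Let N (w : Om) t := ip (X t w) h.
Let A := quad_primitive ip b h.

Let cN w : continuous (N w).
Proof.
move=> t; apply: (@continuous_comp _ _ _ (fun t => X t w) (fun x => ip x h) t).
  exact: X_cont.
exact: ip_continuousl.
Qed.

Let aN : @raw_adapted R T H R N.
Proof.
move=> t /andP[t0 tT]; apply/F_measurableP.
apply: (bmeas_comp (phi := fun x => ip x h)); first exact: ip_continuousl.
by apply/F_measurableP; apply: F_measurable_X; rewrite t0 lexx.
Qed.

Let N0 w : N w 0 = 0. Proof. by rewrite /N X0 ip0l. Qed.

Let A_mono w s t : 0 <= s -> s <= t -> t <= T -> A w s <= A w t.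
Proof. by move=> _ st _; have /andP[] := quad_primitive_lip reg h w st; rewrite subr_ge0. Qed.

Let A0 w : A w 0 = 0. Proof. exact: quad_primitive0. Qed.

Let AK w t : 0 <= t <= T -> A w t <= G * `|h| ^+ 2 * T.
Proof.
move=> /andP[t0 tT]; have /andP[_] := quad_primitive_lip reg h w t0.
rewrite -/(A w t) -/(A w 0) A0 !subr0 => /le_trans; apply.
by rewrite ler_wpM2l//; case: reg => G0 *; rewrite mulr_ge0// exprn_ge0.
Qed.

Let bracket_primitive : {ae P, forall w, forall t, 0 <= t <= T ->
  \int[leb]_(s in `[0, t]) ip (a w s h) h = A w t}.
Proof.
case: dens => _ pa _ _.
apply: filterS ab => w ae_w t /andP[t0 tT].
have sub : `[0, t]%classic `<=` `[0, T]%classic.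
  by move=> s /=; rewrite !in_itv/= => /andP[-> st]; exact: le_trans tT.
rewrite /A /quad_primitive /quad; congr fine.
rewrite [RHS]integral_itv_obnd_cbnd; last exact: (quad_section_measurable reg).
apply: ae_eq_integral => //.
- apply/measurable_EFinP; apply: (measurable_funS _ sub) => //.
  exact: section_measurable (pa h h).
- exact: (quad_section_measurable reg).
case: ae_w => M [mM M0 sM]; exists M; split => // s /= bad; apply: sM => /= as_.
by apply: bad => st; rewrite as_//; exact: sub.
Qed.

(** The primitive of the regular density is an increasing continuous process
    bounded by [G |h|^2 T], and almost surely equal to the primitive of the given
    density: the results on localized martingales apply with this bound. *)
Lemma coordinate_martingale : [/\ martingale P N,
    (forall t, 0 <= t <= T -> sqint P (fun w => N w t))
  & forall s t B, 0 <= s -> s <= t -> t <= T -> F s B ->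
    (\int[P]_(w in B) ((ip (X t w - X s w) h) ^+ 2)%:E = \int[P]_(w in B) quad ip b s t h w)%E].
Proof.
have [sigma lsig msig] := law.
have msigN n : martingale P (stopped (sigma n) N) by have [_ /(_ h)] := msig n.
have [_ _ _ br] := dens; have [rho lrho mrho] := br h h.
set M := fun w t => _ - _ in mrho.
have cA : forall w, continuous (A w) by move=> w; exact: (quad_primitive_continuous reg).
have mA t : measurable_fun setT (fun w => A w t) by exact: (quad_primitive_measurable Hsep reg).
have st n : raw_stopping (rho n) by case: lrho.
have mN s : 0 <= s <= T -> measurable_fun setT (fun w => N w s).
  by move=> sT; exact: (F_measurable_fun (aN sT)).
have mS n t : 0 <= t <= T ->
    measurable_fun setT (fun w => stopped (rho n) N w t ^+ 2 - stopped (rho n) A w t).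
  move=> /andP[t0 tT]; apply: measurable_funB.
    apply: measurable_funX; exact: (stopped_measurable T0 (st n) mN cN t0).
  by apply: (stopped_measurable T0 (st n) _ cA t0).
have eqM n t : 0 <= t <= T -> {ae P, forall w,
    stopped (rho n) N w t ^+ 2 - stopped (rho n) A w t = stopped (rho n) M w t - M w 0}.
  move=> /andP[t0 tT]; apply: filterS bracket_primitive => w bw.
  have [r0 rT] : 0 <= rho n w /\ rho n w <= T by case: (st n) => /(_ w)/andP[].
  have z : M w 0 = 0.
    by rewrite /M X0 !ip0l mulr0 set_itv1 Rintegral_set1 subrr.
  rewrite z subr0 /stopped /M bw ?expr2//.
  by rewrite le_min t0 r0 ge_min tT.
have irho n t : 0 <= t <= T ->
    intg (fun w => stopped (rho n) N w t ^+ 2 - stopped (rho n) A w t).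
  move=> tT; apply: (ae_eq_intg (mS n t tT) _ (eqM n t tT)).
  by case: (mrho n) => _ + _; apply.
have mrho' n s t B : 0 <= s -> s <= t -> t <= T -> F s B ->
  \int[P]_(w in B) ((stopped (rho n) N w t ^+ 2 - stopped (rho n) A w t) -
                    (stopped (rho n) N w s ^+ 2 - stopped (rho n) A w s)) = 0.
  move=> s0 stt tT FB; rewrite -[RHS](martingale_incr (mrho n) s0 stt tT FB).
  have hs : 0 <= s <= T by rewrite s0 (le_trans stt).
  have ht : 0 <= t <= T by rewrite tT (le_trans s0).
  case: (mrho n) => _ iM _.
  apply: ae_eq_Rintegral.
  - exact: F0_measurable FB.
  - by apply: measurable_funB; exact: mS.
  - by apply: measurable_funB; apply: intg_meas (iM _ _).
  - by apply: filterS2 (eqM n s hs) (eqM n t ht) => w -> ->.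
have mAt t : 0 <= t <= T -> measurable_fun setT (fun w => A w t) by [].
have mart := local_martingale_martingale T0 cN aN N0 cA mAt A_mono A0 AK lsig msigN lrho irho mrho'.
have sq := local_martingale_sqr T0 cN aN N0 cA mAt A_mono A0 AK lrho irho mrho'.
have brk := local_martingale_bracket T0 cN aN N0 cA mAt A_mono A0 AK lsig msigN lrho irho mrho'.
split => [//|t tT|s t B s0 stt tT FB]; first by case: (sq t tT).
have mB := F0_measurable FB.
have hs : 0 <= s <= T by rewrite s0 (le_trans stt).
have ht : 0 <= t <= T by rewrite tT (le_trans s0).
have sD : sqint P (fun w => N w t - N w s).
  by apply: sqintB; [case: (sq t ht)|case: (sq s hs)].
have iAB : P.-integrable B (EFin \o (fun w => A w t - A w s)).
  apply: intg_sub => //; apply: (@intg_bounded _ _ _ P _ (G * `|h| ^+ 2 * (t - s))).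
    exact: measurable_funB.
  by move=> w; have /andP[h1 h2] := quad_primitive_lip reg h w stt; rewrite ger0_norm.
have := congr1 EFin (brk s t B s0 stt tT FB).
rewrite (EFin_Rintegral mB (intg_sub mB (sqint_sqr sD))) (EFin_Rintegral mB iAB).
under eq_integral do rewrite -ipBl.
move=> ->; apply: eq_integral => w _.
exact: (quad_primitive_incr reg h w s0 stt).
Qed.

End CoordinateMartingales.

(** * Energy of elementary fields *)

Section PathEnergy.
Context (R : realType) (T : R) (H : completeNormedModType R) (ip : inner_product H).
Hypothesis T0 : 0 < T.
Hypothesis Hsep : separable_space H.
Local Notation Om := (Omega T H).
Local Notation leb := (@lebesgue_measure R).
Implicit Types Z : Om -> R -> H.

Definition path_energy (c : Om -> R -> H -> H) Z (w : Om) : \bar R :=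
  (\int[leb]_(t in `[0%R, T]) (ip (c w t (Z w t)) (Z w t))%:E)%E.

Lemma step_field_bmeas (z : step_process T H) :
  bmeas (fun p : R * Om => step_field z p.2 p.1).
Proof.
apply: bmeas_sum => // k; apply: bmeas_if; last exact: bmeas_cst.
  rewrite (_ : [set _ | _] = `]step_time z k, step_time z k.+1]%classic `*` setT).
    exact: measurableX.
  by apply/seteqP; split => p /=; rewrite in_itv/=; [move=> ->|case].
move=> U oU; have := F_measurable_bmeas (step_val_raw (ltn_ord k)) oU => mU.
rewrite (_ : _ @^-1` U = setT `*` (step_val z k @^-1` U)); first exact: measurableX.
by apply/seteqP; split => p //= [].
Qed.

Section Integrand.
Variables (c : Om -> R -> H -> H) (Z : Om -> R -> H).
Hypothesis cont : forall w t, continuous (c w t).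
Hypothesis mc : forall h k,
  measurable_fun (`[0, T]%classic `*` setT) (fun p : R * Om => ip (c p.2 p.1 h) k).
Hypothesis eZ : elementary Z.

Let f := (fun p : R * Om => ip (c p.2 p.1 (Z p.2 p.1)) (Z p.2 p.1)) \_ (`[0, T]%classic `*` setT).

Let mD : measurable (`[0, T]%classic `*` [set: Om] : set (R * Om)).
Proof. exact: measurableX. Qed.

Let f_in w t : t \in `[0, T] -> f (t, w) = ip (c w t (Z w t)) (Z w t).
Proof. by move=> tT; rewrite /f patchE mem_set. Qed.

Let f_out w t : t \notin `[0, T] -> f (t, w) = 0.
Proof. by move=> tT; rewrite /f patchE memNset// => -[h _]; move/negP: tT; apply. Qed.

Let mf : measurable_fun setT f.
Proof.
pose c0 (p : R * Om) := if p.1 \in `[0, T] then c p.2 p.1 else fun=> 0.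
have -> : f = (fun p => ip (c0 p (Z p.2 p.1)) (Z p.2 p.1)).
  apply/funext => -[t w]; rewrite /c0/=; case: ifPn => tT; first by rewrite f_in.
  by rewrite f_out// ip0l.
apply: bmeas_form => //.
- by move=> p; rewrite /c0; case: ifP => _; [exact: cont|exact: cst_continuous].
- move=> h k; rewrite (_ : (fun _ => _) = (fun p : R * Om => ip (c p.2 p.1 h) k) \_ (`[0, T]%classic `*` setT)).
    exact: (measurable_restrictT _ mD).1.
  apply/funext => -[t w]; rewrite /c0 patchE/=; case: ifPn => tT; first by rewrite mem_set.
  by rewrite memNset ?ip0l// => -[h' _]; move/negP: tT; apply.
- by case: eZ => z ->; exact: step_field_bmeas.
Qed.

Lemma path_integrand_measurable w :
  measurable_fun `[0, T] (fun t => (ip (c w t (Z w t)) (Z w t))%:E).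
Proof.
apply/measurable_EFinP; have m := measurableT_comp mf (@pair2_measurable _ _ R Om w).
apply: (eq_measurable_fun (fun t => f (t, w))); last exact: (measurable_funS measurableT).
by move=> t; rewrite inE /= => tT; rewrite f_in.
Qed.

Lemma path_energy_measurable : measurable_fun setT (path_energy c Z).
Proof.
have e w : path_energy c Z w = (\int[leb]_t (f (t, w))%:E)%E.
  rewrite /path_energy integral_mkcond; apply: eq_integral => t _; rewrite patchE.
  have [tT|tT] := boolP (t \in `[0, T]).
    by rewrite mem_set// f_in.
  by rewrite f_out// memNset//; apply/negP.
have mfE : measurable_fun setT (fun p : R * Om => (f p)%:E).
  by apply/measurable_EFinP; exact: mf.
have mp : measurable_fun setT (fun p : R * Om => (fun p => (f p)%:E)^\+ p)%E by exact: measurable_funepos.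
have mn : measurable_fun setT (fun p : R * Om => (fun p => (f p)%:E)^\- p)%E by exact: measurable_funeneg.
have mP := @measurable_fun_fubini_tonelli_G _ _ _ _ _ leb _ mp (fun p => funepos_ge0 _ p).
have mN := @measurable_fun_fubini_tonelli_G _ _ _ _ _ leb _ mn (fun p => funeneg_ge0 _ p).
have := emeasurable_funB mP mN; congr measurable_fun; apply/funext => w /=.
rewrite e [RHS]integralE /fubini_G; congr (_ - _)%E.
- by apply: eq_integral => t _; rewrite !funeposE.
- by apply: eq_integral => t _; rewrite !funenegE.
Qed.

End Integrand.

Lemma bracket_path_energy (P : probability Om R) (Gamma : H -> H) (G : R) a b Z :
  bracket_density ip Gamma P a -> regular_density ip G b ->
  {ae P, forall w, {ae leb, forall t, t \in `[0, T] -> a w t = b w t}} ->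
  elementary Z ->
  (\int[P]_w path_energy a Z w = \int[P]_w path_energy b Z w)%E.
Proof.
move=> [sa pa _ _] [_ cb _ mb] ab eZ.
have ca w t : continuous (a w t) by case: (sa w t).
have ma h k := predictable_measurable (pa h k).
have mb' h k : measurable_fun (`[0, T]%classic `*` setT) (fun p : R * Om => ip (b p.2 p.1 h) k).
  exact: (measurable_funS measurableT).
apply: ae_eq_integral => //; [exact: path_energy_measurable|exact: path_energy_measurable|].
apply: filterS ab => w abw _; apply: ae_eq_integral => //.
- exact: path_integrand_measurable.
- exact: path_integrand_measurable.
by case: abw => M [mM M0 sM]; exists M; split => // s /= bad; apply: sM => /= as_;
  apply: bad => st; rewrite as_.
Qed.

Section RegularEnergy.
Variables (G : R) (b : Om -> R -> H -> H).
Hypothesis reg : regular_density ip G b.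

Let cb w t : continuous (b w t). Proof. by case: reg. Qed.
Let mb h k : measurable_fun (`[0, T]%classic `*` setT) (fun p : R * Om => ip (b p.2 p.1 h) k).
Proof. by case: reg => *; exact: (measurable_funS measurableT). Qed.

Lemma regular_integrand_measurable Z w : elementary Z ->
  measurable_fun `[0, T] (fun t => (ip (b w t (Z w t)) (Z w t))%:E).
Proof. by move=> eZ; exact: path_integrand_measurable. Qed.

Lemma regular_energy_measurable Z : elementary Z -> measurable_fun setT (path_energy b Z).
Proof. by move=> eZ; exact: path_energy_measurable. Qed.

Lemma regular_energy_ge0 Z w : (0 <= path_energy b Z w)%E.
Proof. by apply: integral_ge0 => t _; exact: (quad_integrand_ge0 reg). Qed.

Lemma regular_energy_restrict r Z w : elementary Z -> elementary (Defs.restrict r Z) ->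
  (path_energy b (Defs.restrict r Z) w <= path_energy b Z w)%E.
Proof.
move=> eZ er; apply: ge0_le_integral => //.
- by move=> t _; exact: (quad_integrand_ge0 reg).
- exact: regular_integrand_measurable.
- exact: regular_integrand_measurable.
move=> t _; rewrite /Defs.restrict; case: ifP => // _.
by rewrite ip0r; exact: (quad_integrand_ge0 reg).
Qed.

(** The source of every convergence in the horizon: two truncations of one bounded
    field differ on a short interval of times. *)
Lemma regular_energy_le Z w C u v : elementary Z -> u <= v ->
  (forall t, `|Z w t| <= C) -> (forall t, ~~ (u < t <= v) -> Z w t = 0) ->
  (path_energy b Z w <= (G * C ^+ 2 * (v - u))%:E)%E.
Proof.
move=> eZ uv ZC Zoff.
have [G0 _ pos _] := reg.
have C0 : 0 <= C by exact: le_trans (ZC 0).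
have cge : (0 <= (G * C ^+ 2)%:E)%E by rewrite lee_fin mulr_ge0// exprn_ge0.
apply: (@le_trans _ _ (\int[leb]_(t in `[0%R, T]) (cst (G * C ^+ 2)%:E \_ `]u, v]) t)%E).
  apply: ge0_le_integral => //.
  - by move=> t _; exact: (quad_integrand_ge0 reg).
  - exact: regular_integrand_measurable.
  - by apply: (measurable_funS measurableT) => //; apply/(measurable_restrictT _ _).1.
  move=> t _; rewrite patchE; case: ifPn => tuv.
    rewrite lee_fin; have /andP[_ h] := pos w t (Z w t); apply: (le_trans h).
    by rewrite ler_wpM2l// ler_sqr ?nnegrE.
  rewrite Zoff ?ip0r//; apply: contra tuv => tuv.
  by rewrite inE/= in_itv.
apply: (@le_trans _ _ (\int[leb]_t (cst (G * C ^+ 2)%:E \_ `]u, v]) t)%E).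
  apply: ge0_subset_integral => //; first by apply/(measurable_restrictT _ _).1.
  by move=> t _; rewrite patchE; case: ifP.
rewrite -integral_mkcond integral_cst//= lebesgue_measure_itv/= lte_fin.
case: ifPn => _; first by rewrite -EFinB -EFinM.
by rewrite mule0 lee_fin !mulr_ge0 ?subr_ge0// exprn_ge0.
Qed.

(** At most one cell contains t, so there are no cross terms. *)
Lemma step_form (z : step_process T H) (c : H -> H) w t :
  ip (c (step_field z w t)) (step_field z w t) =
  \sum_(k < step_size z) if step_time z k < t <= step_time z k.+1
    then ip (c (step_val z k w)) (step_val z k w) else 0.
Proof.
have [[k kt]|no] := pselect (exists k : 'I_(step_size z), step_time z k < t <= step_time z k.+1).
  have uniq (i : 'I_(step_size z)) : i != k -> (step_time z i < t <= step_time z i.+1) = false.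
    move=> /eqP ik; apply/negP => /andP[i1 i2]; apply: ik; apply: val_inj => /=.
    move/andP: kt => [k1 k2]; apply/eqP; rewrite eqn_leq; apply/andP; split; rewrite leqNgt; apply/negP => h.
      have : step_time z k.+1 <= step_time z i.
        move: h; rewrite leq_eqVlt => /predU1P[->//|h]; apply/ltW/step_time_lt => //.
        exact/ltnW/ltn_ord.
      by move=> /(le_trans k2) /(lt_le_trans i1); rewrite ltxx.
    have : step_time z i.+1 <= step_time z k.
      move: h; rewrite leq_eqVlt => /predU1P[->//|h]; apply/ltW/step_time_lt => //.
      exact/ltnW/ltn_ord.
    by move=> /(le_trans i2) /(lt_le_trans k1); rewrite ltxx.
  rewrite /step_field (bigD1 k)//= kt big1 ?addr0; last by move=> i /uniq ->.
  by rewrite (bigD1 k)//= kt big1 ?addr0// => i /uniq ->.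
have none (i : 'I_(step_size z)) : (step_time z i < t <= step_time z i.+1) = false.
  by apply/negP => h; apply: no; exists i.
rewrite /step_field [RHS]big1; last by move=> i _; rewrite none.
by rewrite big1 ?ip0r// => i _; rewrite none.
Qed.

Lemma regular_energy_step (z : step_process T H) w :
  path_energy b (step_field z) w =
  (\sum_(k < step_size z) quad ip b (step_time z k) (step_time z k.+1) (step_val z k w) w)%E.
Proof.
rewrite /path_energy; under eq_integral do rewrite step_form -sumEFin.
rewrite ge0_integral_sum//; last 2 first.
- move=> k; apply/measurable_EFinP.
  rewrite (_ : (fun _ => _) = (fun t => ip (b w t (step_val z k w)) (step_val z k w)) \_
     `]step_time z k, step_time z k.+1]).
    apply: (measurable_funS measurableT) => //; apply: (measurable_restrictT _ _).1 => //.
    by apply/measurable_EFinP; exact: (quad_section_measurable reg).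
  apply/funext => t; rewrite patchE; case: ifPn => h; first by rewrite mem_set//= in_itv.
  by rewrite memNset//= in_itv/=; apply/negP.
- move=> k t _; rewrite lee_fin; case: ifP => // _.
  by rewrite -lee_fin; exact: (quad_integrand_ge0 reg).
apply: eq_bigr => k _; rewrite /quad integral_mkcond [RHS]integral_mkcond.
apply: eq_integral => t _; rewrite !patchE.
have /andP[k0 _] := step_time_itv (ltnW (ltn_ord k)).
have /andP[_ kT] := step_time_itv (ltn_ord k).
have [h|h] := boolP (step_time z k < t <= step_time z k.+1).
  have m1 : t \in `]step_time z k, step_time z k.+1]%classic by rewrite inE /= in_itv.
  have m2 : t \in `[0, T]%classic.
    case/andP: h => h1 h2.
    by rewrite inE /= in_itv/= (le_trans k0 (ltW h1)) (le_trans h2 kT).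
  by rewrite m1 m2.
have m1 : (t \in `]step_time z k, step_time z k.+1]%classic) = false.
  by apply/negP; rewrite inE /= in_itv/=; apply/negP.
by rewrite m1 if_same.
Qed.

End RegularEnergy.

End PathEnergy.

(** * Ito isometry for countably valued step processes *)

Section CountablyValued.
Context (R : realType) (T : R) (H : completeNormedModType R) (ip : inner_product H).
Hypothesis T0 : 0 < T.
Hypothesis Hsep : separable_space H.
Local Notation Om := (Omega T H).
Local Notation leb := (@lebesgue_measure R).
Variable P : probability Om R.
Local Notation intg f := (P.-integrable setT (EFin \o f)).
Local Notation F := (@F0 R T H).

Variables (G : R) (b : Om -> R -> H -> H).
Hypothesis reg : regular_density ip G b.
Hypothesis coord_mart : forall h, [/\ martingale P (fun w t => ip (X t w) h),
    (forall t, 0 <= t <= T -> sqint P (fun w => ip (X t w) h))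
  & forall s t B, 0 <= s -> s <= t -> t <= T -> F s B ->
    (\int[P]_(w in B) ((ip (X t w - X s w) h) ^+ 2)%:E = \int[P]_(w in B) quad ip b s t h w)%E].

(** On a level set of idx, an event known at time s, the value is one fixed vector
    and the integral of the increment is the increment of one coordinate. *)
Definition countably_valued (s : R) (Z : Om -> H) : Prop :=
  exists (dd : nat -> H) (idx : Om -> nat),
    (forall n, F s (idx @^-1` [set n])) /\ forall w, Z w = dd (idx w).

Lemma countably_valued_mono s t Z : s <= t -> countably_valued s Z -> countably_valued t Z.
Proof.
by move=> st [dd [idx [midx ZE]]]; exists dd, idx; split => // n; apply: F0_mono st _ _.
Qed.

Lemma countably_valued_adapted s Z : countably_valued s Z -> F_measurable (F s) Z.
Proof.
move=> [dd [idx [midx ZE]]]; apply/F_measurableP => U oU.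
rewrite (_ : Z @^-1` U = \bigcup_(n in [set n | U (dd n)]) (idx @^-1` [set n])).
  by apply: bigcup_measurable => n _; exact: midx.
apply/seteqP; split => w /=; first by rewrite ZE => Uw; exists (idx w).
by move=> [n Un /= wn]; rewrite ZE wn.
Qed.

Section Increment.
Variables (s t : R) (Z : Om -> H).
Hypothesis s0 : 0 <= s.
Hypothesis st : s <= t.
Hypothesis tT : t <= T.
Hypothesis cZ : countably_valued s Z.

Let D w := ip (Z w) (X t w - X s w).

Let mZ : bmeas Z. Proof. exact: F_measurable_bmeas (countably_valued_adapted cZ). Qed.

Let mD : measurable_fun setT D.
Proof.
apply: bmeas_ip => //.
by apply: bmeas_sub => //; exact: bmeas_X.
Qed.

(** On each level set the integrand is a constant, and the second moment of the
    increment in that direction is the integral of the bracket. *)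
Lemma increment_isometry :
  (\int[P]_w ((D w) ^+ 2)%:E = \int[P]_w quad ip b s t (Z w) w)%E.
Proof.
have [dd [idx [midx ZE]]] := cZ.
pose A n : set Om := idx @^-1` [set n].
have mA n : measurable (A n) by exact: F0_measurable (midx n).
have UA : \bigcup_n A n = setT by apply/seteqP; split => // w _; exists (idx w).
have tA : trivIset setT A.
  apply/trivIsetP => i j _ _ ij; apply/seteqP; split => // w [/= wi wj].
  by move: ij; rewrite -wi -wj eqxx.
rewrite -UA !ge0_integral_bigcup//.
- apply: eq_eseriesr => n _.
  have [_ _ br] := coord_mart (dd n).
  rewrite (eq_integral (fun w => ((ip (X t w - X s w) (dd n)) ^+ 2)%:E)); last first.
    by move=> w; rewrite inE /A /= => wn; rewrite /D ZE wn (ip_sym ip (dd n)).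
  rewrite (br s t (A n) s0 st tT (midx n)).
  by apply: eq_integral => w; rewrite inE /A /= => wn; rewrite ZE wn.
- by rewrite UA; exact: (quad_measurable Hsep reg).
- by move=> w _; exact: (quad_ge0 reg).
- by rewrite UA; apply/measurable_EFinP; exact: measurable_funX.
- by move=> w _; rewrite lee_fin sqr_ge0.
Qed.

Lemma increment_sqint (C : R) : (forall w, `|Z w| <= C) -> sqint P D.
Proof.
move=> ZC; split => //; rewrite increment_isometry.
have C0 : 0 <= C by exact: le_trans (ZC point).
apply: (@le_lt_trans _ _ (\int[P]_w (G * C ^+ 2 * (t - s))%:E)%E).
  apply: ge0_le_integral => //.
  - by move=> w _; exact: (quad_ge0 reg).
  - exact: (quad_measurable Hsep reg).
  move=> w _; apply: (le_trans (quad_le reg _ _ st)).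
  rewrite lee_fin ler_wpM2r ?subr_ge0// ler_wpM2l//; first by case: reg.
  by rewrite ler_sqr ?nnegrE.
exact: (integrable_lty measurableT (intg_cst P (G * C ^+ 2 * (t - s)))).
Qed.

(** Square integrability of the whole increment allows the mean to be computed as
    the series of the means over the level sets. *)
Lemma increment_mean0 B : sqint P D -> F s B -> \int[P]_(w in B) D w = 0.
Proof.
move=> sD FB.
have [dd [idx [midx ZE]]] := cZ.
pose A n : set Om := B `&` idx @^-1` [set n].
have FA n : F s (A n) by exact: (@measurableI _ (OmF T H s) _ _ FB (midx n)).
have mA n : measurable (A n) by exact: F0_measurable (FA n).
have UA : \bigcup_n A n = B.
  by apply/seteqP; split => w; [move=> [n _ []]|move=> Bw; exists (idx w)].
have tA : trivIset setT A.
  apply/trivIsetP => i j _ _ ij; apply/seteqP; split => // w [[_ /= wi] [_ /= wj]].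
  by move: ij; rewrite -wi -wj eqxx.
have mB := F0_measurable FB.
rewrite /Rintegral -UA integral_bigcup//; last first.
  by rewrite UA; apply: intg_sub => //; exact: sqint_intg.
rewrite eseries0// => n _ _.
have [mart sq _] := coord_mart (dd n).
have iN : intg (fun w => ip (X t w) (dd n) - ip (X s w) (dd n)).
  by apply: intgB; apply: sqint_intg; apply: sq; rewrite ?s0 ?(le_trans st)// tT (le_trans s0).
rewrite (eq_integral (fun w => (ip (X t w) (dd n) - ip (X s w) (dd n))%:E)); last first.
  move=> w; rewrite inE /A /= => -[_ wn].
  by rewrite /D ZE wn (ip_sym ip (dd n)) ipBl.
rewrite -(EFin_Rintegral (mA n) (intg_sub (mA n) iN)).
by rewrite (martingale_incr mart s0 st tT (FA n)).
Qed.

End Increment.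

Section StepIntegral.
Variable z : step_process T H.
Hypothesis cz : forall k, (k < step_size z)%N -> countably_valued (step_time z k) (step_val z k).

Let M := step_integral ip z.
Let term (k : nat) (w : Om) (t : R) :=
  ip (step_val z k w) (X (Num.min t (step_time z k.+1)) w - X (Num.min t (step_time z k)) w).

Let tk_itv (k : 'I_(step_size z)) : [/\ 0 <= step_time z k, step_time z k < step_time z k.+1 & step_time z k.+1 <= T].
Proof.
split; last by have /andP[] := step_time_itv (ltn_ord k).
- by have /andP[] := step_time_itv (ltnW (ltn_ord k)).
- exact: step_time_mono.
Qed.

Let term_cont (k : 'I_(step_size z)) w : continuous (term k w).
Proof.
have cmin (u : R) : continuous (fun t : R => Num.min t u).
  by move=> x; apply: continuous_min; [exact: cvg_id|exact: cvg_cst].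
have cX (u : R) : continuous (fun t : R => X (Num.min t u) w).
  move=> x; apply: (@continuous_comp _ _ _ (fun t : R => Num.min t u) (fun t => X t w) x).
    exact: cmin.
  exact: X_cont.
move=> x; rewrite /term; under eq_fun do rewrite ip_sym.
apply: (@continuous_comp _ _ _ (fun t : R => X (Num.min t (step_time z k.+1)) w -
   X (Num.min t (step_time z k)) w) (fun y => ip y (step_val z k w)) x).
  by apply: continuousB; exact: cX.
exact: ip_continuousl.
Qed.

Let incr_eq (k : 'I_(step_size z)) w s t : s <= t ->
  term k w t - term k w s =
  ip (step_val z k w) (X (Num.max (step_time z k) (Num.min t (step_time z k.+1))) w -
                       X (Num.max (step_time z k) (Num.min s (step_time z k.+1))) w).
Proof.
have [_ tt _] := tk_itv k; move: (ltW tt) => tt'.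
move=> stt; rewrite /term -ipBr.
have e r : X (Num.min r (step_time z k.+1)) w - X (Num.min r (step_time z k)) w =
   X (Num.max (step_time z k) (Num.min r (step_time z k.+1))) w - X (step_time z k) w.
  case: (leP r (step_time z k)) => h.
    by rewrite (min_idPl (le_trans h tt')) (max_idPl h) !subrr.
  by rewrite (max_idPr _)// le_min (ltW h) tt'.
by rewrite !e opprB addrA subrK.
Qed.

Let sq_incr (k : 'I_(step_size z)) s t : step_time z k <= s -> s <= t -> t <= step_time z k.+1 ->
  sqint P (fun w => ip (step_val z k w) (X t w - X s w)).
Proof.
have [k0 _ kT] := tk_itv k => ks st tk.
have [C CP] := step_val_bounded z.
apply: (@increment_sqint s t (step_val z k) _ st _ _ C).
- exact: le_trans ks.
- exact: le_trans kT.
- by apply: countably_valued_mono ks _; exact: cz.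
- by move=> w; exact: CP.
Qed.

Let term_diff (k : 'I_(step_size z)) s t B : 0 <= s -> s <= t -> t <= T -> F s B ->
  sqint P (fun w => term k w t - term k w s) /\
  \int[P]_(w in B) (term k w t - term k w s) = 0.
Proof.
move=> s0 st tT FB; have [k0 kk kT] := tk_itv k; have kk' := ltW kk.
under eq_fun do rewrite incr_eq//.
pose u := Num.max (step_time z k) (Num.min s (step_time z k.+1)).
pose v := Num.max (step_time z k) (Num.min t (step_time z k.+1)).
rewrite -/u -/v.
have uv : u <= v.
  by rewrite /u /v ge_max !le_max lexx/= le_min !ge_min st lexx !orbT.
have ku : step_time z k <= u by rewrite /u le_max lexx.
have vk : v <= step_time z k.+1 by rewrite /v ge_max kk' ge_min lexx orbT.
have sq := sq_incr ku uv vk; split => //.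
have [sk|ks] := leP s (step_time z k.+1); last first.
  have -> : u = v.
    rewrite /u /v (min_idPr (ltW ks)) (min_idPr _)//; exact: le_trans (ltW ks) st.
  under eq_Rintegral do rewrite subrr ip0r.
  by rewrite Rintegral_cst ?mul0r//; exact: F0_measurable FB.
have su : s <= u by rewrite /u (min_idPl sk) le_max lexx orbT.
apply: (@increment_mean0 u v (step_val z k)) => //.
- exact: le_trans ku.
- exact: le_trans vk kT.
- by apply: countably_valued_mono ku _; exact: cz.
- exact: (F0_mono su).
Qed.

Let term_at0 (k : 'I_(step_size z)) w : term k w 0 = 0.
Proof.
have [k0 kk kT] := tk_itv k.
by rewrite /term (min_idPl k0) (min_idPl (le_trans k0 (ltW kk))) subrr ip0r.
Qed.

Let term_sqint (k : 'I_(step_size z)) t : 0 <= t <= T -> sqint P (fun w => term k w t).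
Proof.
move=> /andP[t0 tT].
have [+ _] := @term_diff k 0 t setT (lexx 0) t0 tT (@measurableT _ (OmF T H 0)).
by under eq_fun do rewrite term_at0 subr0.
Qed.

Lemma step_integral_continuous w : continuous (step_integral ip z w).
Proof.
move=> t; rewrite (_ : step_integral ip z w = (fun t => \sum_(k < step_size z) term k w t))//.
by apply: (cvg_big (op := +%R)) => [|k _]; [exact: add_continuous|exact: term_cont].
Qed.

Lemma step_integral_sqint t : 0 <= t <= T -> sqint P (fun w => step_integral ip z w t).
Proof. by move=> tT; apply: sqint_sum => k; exact: term_sqint. Qed.

Lemma step_integral_adapted : @raw_adapted R T H R (step_integral ip z).
Proof.
move=> t /andP[t0 tT]; apply/F_measurableP.
apply/bmeas_realP; apply: measurable_sum => k.
have [k0 kk kT] := tk_itv k.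
have [tk|kt] := leP t (step_time z k).
  rewrite (_ : (fun _ => _) = cst 0)//; apply/funext => w.
  by rewrite (min_idPl (le_trans tk (ltW kk))) subrr ip0r.
apply: bmeas_ip => //.
  apply/F_measurableP; apply: (F_measurable_mono (ltW kt)).
  by apply: countably_valued_adapted; exact: cz.
have mX u : 0 <= u -> u <= t -> bmeas (X u : OmF T H t -> H).
  by move=> u0 ut; apply/F_measurableP; apply: F_measurable_X; rewrite u0.
apply: bmeas_sub => //; apply: mX => //; last exact: ltW.
  by rewrite le_min t0 (le_trans k0 (ltW kk)).
by rewrite ge_min lexx.
Qed.

Lemma step_integral_martingale : martingale P (step_integral ip z).
Proof.
have iM t : 0 <= t <= T -> intg (fun w => step_integral ip z w t).
  by move=> tT; apply: sqint_intg; exact: step_integral_sqint.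
split=> //; first exact: step_integral_adapted.
move=> s t B s0 st tT FB; have mB := F0_measurable FB.
have hs : 0 <= s <= T by rewrite s0 (le_trans st).
have ht : 0 <= t <= T by rewrite tT (le_trans s0).
have z0 : \int[P]_(w in B) (step_integral ip z w t - step_integral ip z w s) = 0.
  under eq_Rintegral do rewrite -sumrB.
  rewrite Rintegral_sum//.
    by apply: big1 => k _; case: (term_diff k s0 st tT FB).
  by move=> k; apply: intg_sub => //; apply: sqint_intg; case: (term_diff k s0 st tT FB).
have it := intg_sub mB (iM t ht); have is_ := intg_sub mB (iM s hs).
rewrite -(EFin_Rintegral mB it) -(EFin_Rintegral mB is_); congr EFin.
by apply/esym/eqP; rewrite -subr_eq0 -RintegralB// z0.
Qed.

(** The increments over successive cells are orthogonal, and their second moments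
    add up to the energy. *)
Lemma step_integral_isometry :
  (\int[P]_w ((step_integral ip z w T) ^+ 2)%:E = \int[P]_w path_energy ip b (step_field z) w)%E.
Proof.
have mart := step_integral_martingale; have sq := step_integral_sqint.
pose n := step_size z; pose p := step_time z.
have pitv k : (k <= n)%N -> 0 <= p k <= T by exact: step_time_itv.
have plt i k : (i < k)%N -> (k <= n)%N -> p i < p k by exact: step_time_lt.
have ple i k : (i <= k)%N -> (k <= n)%N -> p i <= p k.
  by rewrite leq_eqVlt => /predU1P[->//|ik] kn; exact/ltW/plt.
have diff (k : 'I_n) w : M w (p k.+1) - M w (p k) = ip (step_val z k w) (X (p k.+1) w - X (p k) w).
  rewrite /M /step_integral -sumrB (bigD1 k)//= big1 ?addr0.
    rewrite minxx (min_idPr (ple _ _ (leqnSn k) (ltn_ord k))) minxx.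
    by rewrite (min_idPl (ple _ _ (leqnSn k) (ltn_ord k))) subrr ip0r subr0.
  move=> i ik; rewrite -ipBr -[X in ip _ X](_ : 0 = _) ?ip0r//.
  have e2 (l : 'I_n) : p l <= p l.+1 by apply: ple.
  have e3 := e2 k; rewrite -[step_time z]/p.
  have [ki|ki|/val_inj ki] := ltngtP i k; last by rewrite ki eqxx in ik.
    have e1 : p i.+1 <= p k by apply: ple => //; exact/ltnW/ltn_ord.
    rewrite (min_idPr (le_trans e1 e3)) (min_idPr (le_trans (e2 i) (le_trans e1 e3))).
    by rewrite (min_idPr e1) (min_idPr (le_trans (e2 i) e1)) !subrr.
  have e1 : p k.+1 <= p i by apply: ple => //; exact/ltnW/ltn_ord.
  rewrite (min_idPl (le_trans e1 (e2 i))) (min_idPl e1).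
  by rewrite (min_idPl (le_trans e3 (le_trans e1 (e2 i)))) (min_idPl (le_trans e3 e1)) !subrr.
have MT w : M w T = M w (p n).
  apply: eq_bigr => k _.
  have h1 : p k.+1 <= T by have /andP[] := pitv _ (ltn_ord k).
  have h2 : p k <= T by have /andP[] := pitv _ (ltnW (ltn_ord k)).
  rewrite !(min_idPr _)//.
  - exact: (ple _ _ (ltnW (ltn_ord k))).
  - exact: (ple _ _ (ltn_ord k)).
have M0 w : M w (p 0%N) = 0.
  apply: big1 => k _; have kn := ltn_ord k.
  rewrite (min_idPl (ple _ _ (leq0n k) (ltnW kn))) (min_idPl (ple _ _ (leq0n k.+1) kn)).
  by rewrite subrr ip0r.
have main m : (m <= n)%N -> (\int[P]_w ((M w (p m)) ^+ 2)%:E =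
    \sum_(k < m) \int[P]_w quad ip b (p k) (p k.+1) (step_val z k w) w)%E.
  elim: m => [|m IH] mn.
    by rewrite big_ord0; apply: integral0_eq => w _; rewrite M0 expr0n.
  rewrite big_ord_recr/= -IH ?(ltnW mn)//.
  have [k0 kk kT] := tk_itv (Ordinal mn).
  rewrite -(@increment_isometry (p m) (p m.+1) (step_val z m) k0 (ltW kk) kT (cz mn)).
  under [X in (_ + X)%E]eq_integral do rewrite -(diff (Ordinal mn)).
  have s1 := sq _ (pitv _ mn); have s2 := sq _ (pitv _ (ltnW mn)).
  have i1 := sqint_sqr s1; have i2 := sqint_sqr s2; have i3 := sqint_sqr (sqintB s1 s2).
  rewrite -(EFin_Rintegral measurableT i1) -(EFin_Rintegral measurableT i2).
  rewrite -(EFin_Rintegral measurableT i3) -EFinD; congr EFin.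
  rewrite (martingale_incr2 mart sq k0 (ltW kk) kT (@measurableT _ (OmF T H _))).
  by rewrite RintegralB// addrC subrK.
under eq_integral do rewrite -/M MT.
rewrite (main n (leqnn n)).
under [RHS]eq_integral do rewrite (regular_energy_step reg).
rewrite ge0_integral_sum//.
- move=> k; apply: (quad_measurable Hsep reg).
  by apply: F_measurable_bmeas; exact: step_val_raw (ltn_ord k).
- by move=> k w _; exact: (quad_ge0 reg).
Qed.

End StepIntegral.

End CountablyValued.

(** * Contractions of the completion *)

Lemma dense_near (R : realType) (V : normedModType R) (A : set V) (Z : V) (e : R) :
  dense A -> 0 < e -> exists2 z, A z & `|Z - z| < e.
Proof.
move=> dA e0; have [|z [zb Az]] := dA (ball Z e) _ (ball_open Z e).
  by exists Z; exact: ballxx.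
by exists z => //; move: zb; rewrite -ball_normE.
Qed.

Section Extension.
Context (R : realType) (V : lmodType R) (HH : completeNormedModType R).
Variables (E : set V) (j r : V -> HH).
Hypothesis E_lin : forall (c : R) e e', E e -> E e' -> E (c *: e + e').
Hypothesis j_lin : forall (c : R) e e', E e -> E e' -> j (c *: e + e') = c *: j e + j e'.
Hypothesis r_lin : forall (c : R) e e', E e -> E e' -> r (c *: e + e') = c *: r e + r e'.
Hypothesis r_le : forall e, E e -> `|r e| <= `|j e|.
Hypothesis j_dense : dense (j @` E).

Let dense_approx Z (e : R) : 0 < e -> exists2 x, E x & `|Z - j x| < e.
Proof. by move=> e0; have [_ [x Ex <-] h] := dense_near Z j_dense e0; exists x. Qed.

Let r_dist e e' : E e -> E e' -> `|r e - r e'| <= `|j e - j e'|.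
Proof.
move=> Ee Ee'; have Es : E (-1 *: e' + e) by exact: E_lin.
have := r_le Es; rewrite r_lin// j_lin// !scaleN1r.
by rewrite addrC (addrC _ (j e)).
Qed.

(** L is a limit along chosen approximations; the estimate of [L Z - r e] by
    [Z - j e], valid for every e in E, makes the choice irrelevant and gives
    linearity and contractivity at once. *)
Lemma extend_contraction : exists2 L : HH -> HH, Defs.contraction L &
  forall e, E e -> L (j e) = r e.
Proof.
have pos n : 0 < n.+1%:R^-1 :> R by rewrite invr_gt0.
pose x Z n := sval (cid2 (dense_approx Z (pos n))).
have Ex Z n : E (x Z n) by rewrite /x; case: cid2.
have xZ Z n : `|Z - j (x Z n)| < n.+1%:R^-1 by rewrite /x; case: cid2.
have cau Z : cvg (r (x Z n) @[n --> \oo]).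
  apply/cauchy_cvgP/cauchy_ballP => e e0.
  have e20 : 0 < e / 2 by rewrite divr_gt0.
  have [N _ NP] := near_infty_natSinv_lt (PosNum e20).
  pose A := [set r (x Z n) | n in [set n | (N <= n)%N]].
  exists (A, A); first by split; exists N => // n /= Nn; exists n.
  move=> [_ _] /= [[n Nn <-] [m Nm <-]]; rewrite -ball_normE /=.
  apply: (le_lt_trans (r_dist (Ex Z n) (Ex Z m))).
  apply: (le_lt_trans (ler_distD Z _ _)).
  rewrite distrC (splitr e) ltrD//.
    exact: lt_trans (xZ Z n) (NP n Nn).
  exact: lt_trans (xZ Z m) (NP m Nm).
pose L Z := lim (r (x Z n) @[n --> \oo]).
have xcvg Z : j (x Z n) @[n --> \oo] --> Z.
  apply/cvgrPdist_lt => e e0; near=> n; apply: (lt_trans (xZ Z n)).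
  near: n; exact: (near_infty_natSinv_lt (PosNum e0)).
have key Z e : E e -> `|L Z - r e| <= `|Z - j e|.
  move=> Ee.
  have c1 : `|r (x Z n) - r e| @[n --> \oo] --> `|L Z - r e|.
    by apply: cvg_norm; apply: cvgB; [exact: cau|exact: cvg_cst].
  have c2 : `|j (x Z n) - j e| @[n --> \oo] --> `|Z - j e|.
    by apply: cvg_norm; apply: cvgB; [exact: xcvg|exact: cvg_cst].
  rewrite -(cvg_lim _ c1)// -(cvg_lim _ c2)//; apply: ler_lim; first by apply/cvg_ex; eexists; exact: c1.
    by apply/cvg_ex; eexists; exact: c2.
  by apply: nearW => n; exact: r_dist.
have Lj e : E e -> L (j e) = r e.
  move=> Ee; apply/eqP; rewrite -subr_eq0 -normr_le0.
  by apply: (le_trans (key _ _ Ee)); rewrite subrr normr0.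
have Lle Z : `|L Z| <= `|Z|.
  apply/ler_addgt0Pr => e e0; have e20 : 0 < e / 2 by rewrite divr_gt0.
  have [y Ey yZ] := dense_approx Z e20.
  have h1 : `|L Z| <= `|L Z - r y| + `|r y| by rewrite -{1}(subrK (r y) (L Z)) ler_normD.
  have h2 : `|j y| <= `|Z - j y| + `|Z|.
    by rewrite -{1}(subKr Z (j y)) [leRHS]addrC ler_normB.
  have := key Z y Ey; have := r_le Ey; lra.
exists L => //; split => // c Z Z'.
apply/eqP; rewrite -subr_eq0 -normr_le0; apply/ler_addgt0Pl => e e0; rewrite addr0.
have c0 : 0 < 2 * (`|c| + 1) by rewrite mulr_gt0// ltr_wpDl.
have d0 : 0 < e / (2 * (`|c| + 1)) by rewrite divr_gt0.
have [y Ey yZ] := dense_approx Z d0; have [y' Ey' yZ'] := dense_approx Z' d0.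
have Es : E (c *: y + y') by exact: E_lin.
have := key (c *: Z + Z') _ Es; rewrite r_lin// j_lin//.
have := key Z y Ey; have := key Z' y' Ey'.
set d := e / _ in yZ yZ'; move=> k1 k2 k3.
have eE : e = 2 * (`|c| + 1) * d by rewrite /d mulrC divfK// gt_eqF.
have b1 : `|c *: Z + Z' - (c *: j y + j y')| <= `|c| * d + d.
  rewrite opprD addrACA -scalerBr (le_trans (ler_normD _ _))// normrZ lerD//; last exact: ltW.
  by rewrite ler_wpM2l// ltW.
have b2 : `|c *: L Z + L Z' - (c *: r y + r y')| <= `|c| * d + d.
  rewrite opprD addrACA -scalerBr (le_trans (ler_normD _ _))// normrZ lerD//; last first.
    exact: le_trans k1 (ltW yZ').
  by rewrite ler_wpM2l// (le_trans k2)// ltW.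
rewrite -(subrKA (c *: r y + r y')) (le_trans (ler_normD _ _))//.
rewrite -(normrN (_ + _ - (c *: L Z + L Z'))) opprB.
rewrite eE; lra.
Unshelve. all: end_near. Qed.

End Extension.

Section Contractions.
Context (R : realType) (HH : completeNormedModType R).
Implicit Types L : HH -> HH.

Lemma contractionB L Z Z' : Defs.contraction L -> L (Z - Z') = L Z - L Z'.
Proof. by move=> [lin _]; rewrite addrC -scaleN1r lin scaleN1r addrC. Qed.

Lemma contraction_norm_sub L Z Z' : Defs.contraction L -> `|L Z - L Z'| <= `|Z - Z'|.
Proof. by move=> cL; rewrite -contractionB//; case: cL. Qed.

Lemma contraction_agree L L' (A : set HH) : Defs.contraction L -> Defs.contraction L' ->
  dense A -> (forall z, A z -> L z = L' z) -> L = L'.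
Proof.
move=> cL cL' dA LL'; apply/funext => Z; apply/eqP; rewrite -subr_eq0 -normr_le0.
apply/ler_addgt0Pl => e e0; rewrite addr0.
have e20 : 0 < e / 2 by rewrite divr_gt0.
have [z Az zZ] := dense_near Z dA e20.
rewrite (le_trans (ler_distD (L z) _ _))// (splitr e) lerD//.
  by rewrite (le_trans (contraction_norm_sub _ _ cL))// ltW.
by rewrite LL'// (le_trans (contraction_norm_sub _ _ cL'))// distrC ltW.
Qed.

(** Uniform Lipschitz bounds carry the Cauchy property from the dense set to the
    whole space. *)
Lemma contractions_limit (D : nat -> HH -> HH) (A : set HH) :
  (forall n, Defs.contraction (D n)) -> dense A ->
  (forall z, A z -> cvg (D n z @[n --> \oo])) ->
  exists2 L, Defs.contraction L & forall Z, D n Z @[n --> \oo] --> L Z.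
Proof.
move=> cD dA cA.
have cv Z : cvg (D n Z @[n --> \oo]).
  apply/cauchy_cvgP/cauchy_exP => e e0; have e20 : 0 < e / 2 by rewrite divr_gt0.
  have [z Az zZ] := dense_near Z dA e20.
  exists (lim (D n z @[n --> \oo])).
  have /cvgrPdist_lt/(_ _ e20) := cA z Az; apply: filterS => n hn.
  rewrite -ball_normE /=; apply: (le_lt_trans (ler_distD (D n z) _ _)).
  rewrite (splitr e) ltrD//; apply: (le_lt_trans (contraction_norm_sub _ _ (cD n))).
  by rewrite distrC.
exists (fun Z => lim (D n Z @[n --> \oo])) => //; split.
  move=> c Z Z'; apply/cvg_lim => //.
  rewrite (_ : (fun n => _) = (fun n => c *: D n Z + D n Z')).
    by apply: cvgD; [apply: cvgZr; exact: cv|exact: cv].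
  by apply/funext => n; case: (cD n) => ->.
move=> Z.
have c1 : `|D n Z| @[n --> \oo] --> `|lim (D n Z @[n --> \oo])| by apply: cvg_norm; exact: cv.
rewrite -(cvg_lim _ c1)//; apply: limr_le; first by apply/cvg_ex; eexists; exact: c1.
by apply: nearW => n; case: (cD n).
Qed.

Lemma sqrt_small (K e : R) : 0 <= K -> 0 < e -> exists2 d, 0 < d & Num.sqrt (K * d) <= e.
Proof.
move=> K0 e0; have K1 : 0 < K + 1 by rewrite ltr_wpDl.
exists (e ^+ 2 / (K + 1)); first by rewrite divr_gt0// exprn_gt0.
rewrite -[leRHS](ger0_norm (ltW e0)) -sqrtr_sqr; apply: ler_wsqrtr.
by rewrite mulrA ler_pdivrMr// mulrC ler_wpM2l ?sqr_ge0// lerDl.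
Qed.

End Contractions.

(** * Upper norms of processes *)

Section MeanSquare.
Context (R : realType) d (S : measurableType d) (P : probability S R).

Lemma Lnorm2_sqr (f : S -> R) :
  (Lnorm P 2%:E (fun w => (f w)%:E) = (\int[P]_w ((f w) ^+ 2)%:E) `^ 2^-1)%E.
Proof.
rewrite unlock; congr (_ `^ _)%E; apply: eq_integral => w _.
by rewrite /= powR_mulrn// real_normK// num_real.
Qed.

Lemma Lnorm2_leP (f : S -> R) (c : R) : 0 <= c ->
  (Lnorm P 2%:E (fun w => (f w)%:E) <= c%:E)%E = (\int[P]_w ((f w) ^+ 2)%:E <= (c ^+ 2)%:E)%E.
Proof.
move=> c0; rewrite Lnorm2_sqr.
have : (0 <= \int[P]_w ((f w) ^+ 2)%:E)%E.
  by apply: integral_ge0 => w _; rewrite lee_fin sqr_ge0.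
case: (\int[P]_w _)%E => [r|_|//].
  rewrite lee_fin => r0; rewrite poweR_EFin powR12_sqrt// !lee_fin.
  by rewrite -[in RHS](sqr_sqrtr r0) ler_sqr// nnegrE ?sqrtr_ge0.
by rewrite poweRyr// invr_eq0 pnatr_eq0.
Qed.

Lemma Lnorm2_fatou (f : nat -> S -> R) (g : S -> R) (c : R) : 0 <= c ->
  (forall n, measurable_fun setT (f n)) -> measurable_fun setT g ->
  {ae P, forall w, f n w @[n --> \oo] --> g w} ->
  (forall n, (Lnorm P 2%:E (fun w => (f n w)%:E) <= c%:E)%E) ->
  (Lnorm P 2%:E (fun w => (g w)%:E) <= c%:E)%E.
Proof.
move=> c0 mf mg fg fc; rewrite Lnorm2_leP//.
apply: (@fatou_cvg _ _ _ P (fun n w => f n w ^+ 2) (fun w => g w ^+ 2)).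
- by move=> n; exact: measurable_funX.
- exact: measurable_funX.
- by move=> n w; exact: sqr_ge0.
- by move=> w; exact: sqr_ge0.
- by apply: filterS fg => w h; rewrite expr2; apply: cvgM.
- by move=> n; have := fc n; rewrite Lnorm2_leP.
Qed.

Lemma Lnorm2_ae0 (f : S -> R) : measurable_fun setT f ->
  (forall e : R, 0 < e -> (Lnorm P 2%:E (fun w => (f w)%:E) <= e%:E)%E) ->
  {ae P, forall w, f w = 0}.
Proof.
move=> mf fe.
have e0 : Lnorm P 2%:E (fun w => (f w)%:E) = 0%E.
  apply/eqP; rewrite eq_le Lnorm_ge0 andbT; apply/lee_addgt0Pr => e e0.
  by rewrite add0e fe.
have mfE : measurable_fun setT (fun w => (f w)%:E) by exact/measurable_EFinP.
have := Lnorm_eq0_eq0 mfE (_ : 0 < 2%:E)%E e0; rewrite lte_fin => /(_ (ltr0n R 2)).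
by apply: filterS => w /(_ I) /= [].
Qed.

End MeanSquare.

Section UpperNorms.
Context (R : realType) (T : R) (H : completeNormedModType R).
Hypothesis T0 : 0 < T.
Local Notation Om := (Omega T H).
Local Notation prob := (probability Om R).
Variable PP : set prob.
Hypothesis PP0 : PP !=set0.

(** Measurability is asked on [0,T] only, where it is available for pathwise step
    integrals. *)
Definition continuous_process (Y : Om -> R -> R) : Prop :=
  (forall w, continuous (Y w)) /\
  (forall t, 0 <= t <= T -> measurable_fun setT (fun w : Om => Y w t)).

Lemma cont_process_continuous Y : cont_process Y -> continuous_process Y.
Proof. by move=> [tY mY]; split => [w|t _]; [case: (tY w)|exact: mY]. Qed.

Lemma continuous_processB Y Y' : continuous_process Y -> continuous_process Y' ->
  continuous_process (Y - Y').
Proof.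
move=> [c m] [c' m']; split => [w t|t tT]; first by apply: continuousB; [exact: c|exact: c'].
by apply: measurable_funB; [exact: m|exact: m'].
Qed.

Lemma continuous_process_stopped tau Y : raw_stopping tau -> continuous_process Y ->
  continuous_process (stopped tau Y).
Proof.
move=> st [c m]; split => [w|t /andP[t0 tT]]; last exact: stopped_measurable.
move=> t; apply: (@continuous_comp _ _ _ (fun t => Num.min t (tau w)) (Y w) t); last exact: c.
by apply: continuous_min; [exact: cvg_id|exact: cvg_cst].
Qed.

Lemma usup_meas Y : continuous_process Y -> measurable_fun setT (fun w => usup T (Y w)).
Proof. by move=> [c m]; apply: usup_measurable. Qed.

Lemma S2_norm_usup Y : continuous_process Y ->
  S2_norm PP Y = upper_L2 PP (fun w => usup T (Y w)).
Proof.
move=> [c m]; rewrite /S2_norm /upper_L2; congr (ereal_sup [set Lnorm _ _ _ | _ in _]).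
by apply/funext => P; apply/funext => w; rewrite ereal_usup.
Qed.

Lemma le_Lnorm2 (P : prob) (f g : Om -> R) : measurable_fun setT f -> measurable_fun setT g ->
  {ae P, forall w, `|f w| <= `|g w|} ->
  (Lnorm P 2%:E (fun w => (f w)%:E) <= Lnorm P 2%:E (fun w => (g w)%:E))%E.
Proof.
move=> mf mg fg; rewrite !Lnorm2_sqr; apply: gt0_ler_poweR; rewrite ?invr_ge0// ?in_itv/= ?leey ?andbT.
- by apply: integral_ge0 => w _; rewrite lee_fin sqr_ge0.
- by apply: integral_ge0 => w _; rewrite lee_fin sqr_ge0.
apply: ae_ge0_le_integral => //.
- by move=> w _; rewrite lee_fin sqr_ge0.
- by apply/measurable_EFinP; exact: measurable_funX.
- by move=> w _; rewrite lee_fin sqr_ge0.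
- by apply/measurable_EFinP; exact: measurable_funX.
- apply: filterS fg => w fgw _; rewrite lee_fin.
  by rewrite -(real_normK (num_real (f w))) -(real_normK (num_real (g w))) ler_sqr ?nnegrE.
Qed.

Lemma Lnorm2_triangle (P : prob) (f g h : Om -> R) : measurable_fun setT f ->
  measurable_fun setT g -> measurable_fun setT h ->
  {ae P, forall w, `|f w| <= `|g w| + `|h w|} ->
  (Lnorm P 2%:E (fun w => (f w)%:E) <=
   Lnorm P 2%:E (fun w => (g w)%:E) + Lnorm P 2%:E (fun w => (h w)%:E))%E.
Proof.
move=> mf mg mh fgh.
have mg' : measurable_fun setT (fun w => `|g w|) by exact: measurableT_comp.
have mh' : measurable_fun setT (fun w => `|h w|) by exact: measurableT_comp.
have Nabs (u : Om -> R) : Lnorm P 2%:E (fun w => `|u w|%:E) = Lnorm P 2%:E (fun w => (u w)%:E).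
  by rewrite -[RHS]Lnorm_abse.
rewrite -(Nabs g) -(Nabs h).
apply: (le_trans _ (minkowski_EFin P mg' mh' (ler1n R 2))).
apply: le_Lnorm2 => //; first exact: measurable_funD.
by apply: filterS fgh => w /le_trans; apply; rewrite ler_norm.
Qed.

Lemma upper_L2_ub (P : prob) (f : Om -> R) : PP P ->
  (Lnorm P 2%:E (fun w => (f w)%:E) <= upper_L2 PP f)%E.
Proof. by move=> PPP; apply: ereal_sup_ubound; exists P. Qed.

Lemma S2_norm_ge0 Y : (0 <= S2_norm PP Y)%E.
Proof.
case: PP0 => P PPP; rewrite /S2_norm; set N := (fun P : prob => Lnorm P _ _).
apply: (@le_trans _ _ (N P)) => //; first exact: Lnorm_ge0.
by apply: ereal_sup_ubound; exists P.
Qed.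

Lemma upper_L2_le (f g : Om -> R) : measurable_fun setT f -> measurable_fun setT g ->
  quasi_surely PP (fun w => `|f w| <= `|g w|) -> (upper_L2 PP f <= upper_L2 PP g)%E.
Proof.
move=> mf mg fg; apply: ge_ereal_sup => _ [P PPP <-].
apply: (le_trans (le_Lnorm2 mf mg (fg P PPP))).
exact: upper_L2_ub.
Qed.

Lemma upper_L2_triangle (f g h : Om -> R) : measurable_fun setT f -> measurable_fun setT g ->
  measurable_fun setT h ->
  quasi_surely PP (fun w => `|f w| <= `|g w| + `|h w|) ->
  (upper_L2 PP f <= upper_L2 PP g + upper_L2 PP h)%E.
Proof.
move=> mf mg mh fgh; apply: ge_ereal_sup => _ [P PPP <-].
apply: (le_trans (Lnorm2_triangle mf mg mh (fgh P PPP))).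
by apply: leeD; exact: upper_L2_ub.
Qed.

Lemma usup_triangle (f g h : R -> R) : continuous f -> continuous g -> continuous h ->
  (forall t, 0 <= t <= T -> `|f t| <= `|g t| + `|h t|) ->
  `|usup T f| <= `|usup T g| + `|usup T h|.
Proof.
move=> cf cg ch fgh; rewrite !ger0_norm ?usup_ge0//.
apply: usup_le => // t tT; apply: (le_trans (fgh t tT)).
by apply: lerD; apply: usup_ub.
Qed.

Lemma S2_norm_triangle Y Y1 Y2 : continuous_process Y -> continuous_process Y1 ->
  continuous_process Y2 ->
  quasi_surely PP (fun w => forall t, 0 <= t <= T -> `|Y w t| <= `|Y1 w t| + `|Y2 w t|) ->
  (S2_norm PP Y <= S2_norm PP Y1 + S2_norm PP Y2)%E.
Proof.
move=> cY cY1 cY2 h; rewrite !S2_norm_usup//.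
apply: upper_L2_triangle; [exact: usup_meas|exact: usup_meas|exact: usup_meas|].
move=> P PPP; apply: filterS (h P PPP) => w hw.
by apply: usup_triangle => //; [case: cY|case: cY1|case: cY2].
Qed.

Lemma S2_norm_le Y Y1 : continuous_process Y -> continuous_process Y1 ->
  quasi_surely PP (fun w => forall t, 0 <= t <= T -> `|Y w t| <= usup T (Y1 w)) ->
  (S2_norm PP Y <= S2_norm PP Y1)%E.
Proof.
move=> cY cY1 h; rewrite !S2_norm_usup//.
apply: upper_L2_le; [exact: usup_meas|exact: usup_meas|].
move=> P PPP; apply: filterS (h P PPP) => w hw.
by rewrite !ger0_norm ?usup_ge0//; [exact: usup_le|case: cY1|case: cY].
Qed.

Lemma S2_norm_qs Y Y' : continuous_process Y -> continuous_process Y' ->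
  qs_eq PP Y Y' -> S2_norm PP Y = S2_norm PP Y'.
Proof.
move=> cY cY' e; apply/eqP; rewrite eq_le; apply/andP; split; apply: S2_norm_le => // P PPP;
  apply: filterS (e P PPP) => w ew t tT.
  by rewrite ew// usup_ub//; case: cY'.
by rewrite -ew// usup_ub//; case: cY.
Qed.

Lemma upper_L2_le_S2 Y t : continuous_process Y -> 0 <= t <= T ->
  (upper_L2 PP (fun w => Y w t) <= S2_norm PP Y)%E.
Proof.
move=> cY tT; rewrite S2_norm_usup//; have [c m] := cY.
apply: upper_L2_le; [exact: m|exact: usup_meas|].
move=> P PPP; apply: nearW => w.
by rewrite [leRHS]ger0_norm ?usup_ge0// usup_ub.
Qed.

Lemma S2_norm_stopped tau Y : raw_stopping tau -> continuous_process Y ->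
  (S2_norm PP (stopped tau Y) <= S2_norm PP Y)%E.
Proof.
move=> st cY; apply: S2_norm_le => //; first exact: continuous_process_stopped.
move=> P PPP; apply: nearW => w t /andP[t0 tT]; rewrite /stopped usup_ub//; first by case: cY.
by case: st => /(_ w)/andP[w0 wT] _; rewrite le_min t0 w0 ge_min tT.
Qed.

Lemma S2_norm0_qs Y Y' : continuous_process Y -> continuous_process Y' ->
  (S2_norm PP (Y - Y')%R <= 0)%E -> qs_eq PP Y Y'.
Proof.
move=> cY cY' h P PPP; have cB := continuous_processB cY cY'.
have u0 : {ae P, forall w, usup T ((Y - Y') w) = 0}.
  apply: Lnorm2_ae0 => [|e e0]; first exact: usup_meas.
  apply: le_trans (upper_L2_ub _ PPP) _; rewrite -S2_norm_usup//.
  by apply: (le_trans h); rewrite lee_fin ltW.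
apply: filterS u0 => w uw t tT; apply/eqP; rewrite -subr_eq0 -normr_le0 -uw.
by have [c _] := cB; have := usup_ub T0 (c w) tT.
Qed.

End UpperNorms.

(** * Energy and step integrals under a family of laws *)

Section UpperEnergy.
Context (R : realType) (T : R) (H : completeNormedModType R) (ip : inner_product H).
Hypothesis T0 : 0 < T.
Hypothesis Hsep : separable_space H.
Local Notation Om := (Omega T H).
Local Notation prob := (probability Om R).
Local Notation F := (@F0 R T H).
Variable PP : set prob.
Variable a : prob -> Om -> R -> H -> H.

(** What the bracket hypotheses give under each law, with one constant G for the
    whole family: an everywhere regular density with the same energies, which is
    the bracket density of the coordinate martingales. *)
Definition regularizable (G : R) : Prop := forall P, PP P ->
  exists b, [/\ regular_density ip G b,
    (forall Z, elementary Z -> (\int[P]_w path_energy ip (a P) Z w = \int[P]_w path_energy ip b Z w)%E)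
    & forall h, [/\ martingale P (fun w t => ip (X t w) h),
        (forall t, 0 <= t <= T -> sqint P (fun w => ip (X t w) h))
      & forall s t B, 0 <= s -> s <= t -> t <= T -> F s B ->
        (\int[P]_(w in B) ((ip (X t w - X s w) h) ^+ 2)%:E = \int[P]_(w in B) quad ip b s t h w)%E]].

Lemma law_regularizable (Gamma : H -> H) : nonneg_op ip Gamma ->
  PP `<=` law_class ip Gamma -> (forall P, PP P -> bracket_density ip Gamma P (a P)) ->
  exists2 G, 0 <= G & regularizable G.
Proof.
move=> nG PPl ad; have [G G0 hG] := nonneg_op_bound nG; exists G => // P PPP.
have [law _] := PPl _ PPP; have dens := ad _ PPP.
have [b reg ab] := regular_version G0 hG dens.
exists b; split => // [Z eZ|h]; first exact: (bracket_path_energy Hsep dens reg ab).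
exact: (coordinate_martingale T0 Hsep law dens reg ab h).
Qed.

Variable G : R.
Hypothesis G0 : 0 <= G.
Hypothesis regG : regularizable G.

Lemma energyE Z : energy ip PP a Z =
  ereal_sup [set ((\int[P]_w path_energy ip (a P) Z w) `^ 2^-1)%E | P in PP].
Proof. by []. Qed.

Lemma le_sqrtE (x y : \bar R) : (0 <= x)%E -> (x <= y)%E -> (x `^ 2^-1 <= y `^ 2^-1)%E.
Proof.
move=> x0 xy; apply: gt0_ler_poweR; rewrite ?invr_ge0// ?in_itv/= ?leey ?andbT//.
exact: le_trans xy.
Qed.

Lemma energy_restrict r Z : elementary Z -> elementary (Defs.restrict r Z) ->
  (energy ip PP a (Defs.restrict r Z) <= energy ip PP a Z)%E.
Proof.
move=> eZ erZ; rewrite !energyE; apply: ge_ereal_sup => _ [P PPP <-].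
apply: (@le_trans _ _ ((\int[P]_w path_energy ip (a P) Z w) `^ 2^-1)%E); last first.
  by apply: ereal_sup_ubound; exists P.
have [b [reg Eb _]] := regG PPP; rewrite !Eb//; apply: le_sqrtE.
  by apply: integral_ge0 => w _; exact: (regular_energy_ge0 reg).
apply: ge0_le_integral => //.
- by move=> w _; exact: (regular_energy_ge0 reg).
- by apply: (regular_energy_measurable Hsep reg).
- by apply: (regular_energy_measurable Hsep reg).
- by move=> w _; exact: (regular_energy_restrict Hsep reg).
Qed.

Lemma energy_short Z C d : elementary Z -> (forall w t, `|Z w t| <= C) ->
  (forall w, exists u v, [/\ u <= v, v - u <= d & forall t, ~~ (u < t <= v) -> Z w t = 0]) ->
  (energy ip PP a Z <= (Num.sqrt (G * C ^+ 2 * d))%:E)%E.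
Proof.
move=> eZ ZC Zs; rewrite energyE; apply: ge_ereal_sup => _ [P PPP <-].
have [b [reg Eb _]] := regG PPP; rewrite Eb//.
have d0 : 0 <= d by have [u [v [uv /(le_trans _) h _]]] := Zs point; apply: h; rewrite subr_ge0.
have K0 : 0 <= G * C ^+ 2 * d by rewrite mulr_ge0// mulr_ge0// sqr_ge0.
rewrite -powR12_sqrt// -poweR_EFin; apply: le_sqrtE.
  by apply: integral_ge0 => w _; exact: (regular_energy_ge0 reg).
apply: (@le_trans _ _ (\int[P]_w (G * C ^+ 2 * d)%:E)%E); last first.
  by rewrite integral_cst// [X in (_ * X)%E](_ : _ = 1%E) ?mule1//; exact: probability_setT.
apply: ge0_le_integral => //.
- by move=> w _; exact: (regular_energy_ge0 reg).
- by apply: (regular_energy_measurable Hsep reg).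
- move=> w _; have [u [v [uv vud Z0]]] := Zs w.
  apply: (le_trans (regular_energy_le Hsep reg eZ uv (ZC w) Z0)); rewrite lee_fin.
  by rewrite ler_wpM2l// mulr_ge0// sqr_ge0.
Qed.

Definition step_countable (z : step_process T H) := forall k, (k < step_size z)%N ->
  countably_valued (step_time z k) (step_val z k).

Lemma step_continuous_process z : PP !=set0 -> step_countable z ->
  continuous_process (step_integral ip z).
Proof.
move=> [P PPP] cz; have [b [reg _ cm]] := regG PPP; split => [w|t tT].
  exact: step_integral_continuous.
by apply: (@F_measurable_fun _ _ _ t); apply: (step_integral_adapted ip Hsep cz).
Qed.

Lemma step_upper_L2 z : step_countable z ->
  upper_L2 PP (fun w => step_integral ip z w T) = energy ip PP a (step_field z).
Proof.
move=> cz; rewrite energyE /upper_L2; congr ereal_sup; apply: eq_imagel => P PPP.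
have [b [reg Eb cm]] := regG PPP; rewrite Lnorm2_sqr Eb; last by exists z.
by rewrite (step_integral_isometry Hsep reg cm cz).
Qed.

Lemma step_S2_norm z : PP !=set0 -> step_countable z ->
  (S2_norm PP (step_integral ip z) <= 2%:E * energy ip PP a (step_field z))%E.
Proof.
move=> PP0 cz; have cp := step_continuous_process PP0 cz; rewrite S2_norm_usup// -step_upper_L2//.
apply: ge_ereal_sup => _ [P PPP <-].
have [b [reg Eb cm]] := regG PPP.
have mart := step_integral_martingale Hsep reg cm cz.
have sq := step_integral_sqint Hsep reg cm cz.
apply: (@le_trans _ _ (2%:E * Lnorm P 2%:E (fun w => (step_integral ip z w T)%:E))%E); last first.
  by apply: lee_pmul => //; [exact: Lnorm_ge0|exact: upper_L2_ub].
rewrite !Lnorm2_sqr.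
have -> : 2%:E = (4%:E `^ 2^-1)%E :> \bar R.
  by rewrite poweR_EFin powR12_sqrt// (_ : 4 = 2 ^+ 2) ?sqrtr_sqr ?ger0_norm// expr2 -natrM.
rewrite -poweRM//; last by apply: integral_ge0 => w _; rewrite lee_fin sqr_ge0.
apply: le_sqrtE; first by apply: integral_ge0 => w _; rewrite lee_fin sqr_ge0.
by apply: doob_L2 => //; case: cp.
Qed.

(** The finitely many values are approximated uniformly within d; the difference is
    crudely at most n d, and a small field on [0,T] has small energy. *)
Lemma step_countable_approx Z (e : R) : elementary Z -> 0 < e ->
  exists2 z, step_countable z & (energy ip PP a (Z - step_field z)%R <= e%:E)%E.
Proof.
move=> eZ e0; have [z0 Zz] := eZ; set n := step_size z0.
pose s := Num.sqrt (G * T).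
have s0 : 0 <= s by exact: sqrtr_ge0.
pose d := e / (n.+1%:R * (s + 1)).
have d0 : 0 < d by rewrite divr_gt0// mulr_gt0// ltr_wpDl.
have ap k : exists v, (k < n)%N -> countably_valued (step_time z0 k) v /\
    forall w, `|step_val z0 k w - v w| < d.
  have [kn|] := boolP (k < n)%N; last by exists 0.
  have /F_measurableP mv := step_val_raw kn.
  have [dd [idx [mi hd]]] := bmeas_approx Hsep d0 mv.
  by exists (fun w => dd (idx w)) => _; split => //; exists dd, idx; split.
have [v hv] := choice ap.
have vb : exists C : R, forall k w, (k < n)%N -> `|v k w| <= C.
  have [C hC] := step_val_bounded z0; exists (C + d) => k w kn.
  have [_ /(_ w)/ltW h] := hv k kn; rewrite -(subKr (step_val z0 k w) (v k w)).
  by rewrite (le_trans (ler_normB _ _))// lerD// hC.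
have va k : (k < n)%N -> F_measurable (F (step_time z0 k)) (v k).
  by move=> kn; apply: countably_valued_adapted; case: (hv k kn).
pose z := StepProcess (@step_time_itv _ _ _ z0) (@step_time_mono _ _ _ z0) vb va.
exists z; first by move=> k kn; case: (hv k kn).
have eD : elementary (Z - step_field z) by apply: elementary_sub => //; exists z.
have [_ supp] := step_field_bounded z0; have [_ supp'] := step_field_bounded z.
apply: (@le_trans _ _ (Num.sqrt (G * (n%:R * d) ^+ 2 * T))%:E).
  apply: energy_short => // [w t|w].
    rewrite Zz; change (`|step_field z0 w t - step_field z w t| <= n%:R * d).
    rewrite /step_field -sumrB (le_trans (ler_norm_sum _ _ _))//.
    rewrite mulr_natl -[in leRHS](card_ord n) -sumr_const; apply: ler_sum => k _ /=.
    have [_ /(_ w)/ltW h] := hv k (ltn_ord k).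
    by case: ifP => _ //; rewrite subrr normr0 ltW.
  exists 0, T; split; [exact: ltW|by rewrite subr0|] => t tn.
  by rewrite Zz; change (step_field z0 w t - step_field z w t = 0); rewrite supp// supp'// subr0.
rewrite lee_fin (_ : G * _ * T = (n%:R * d) ^+ 2 * (G * T)); last by ring.
rewrite sqrtrM ?sqr_ge0// sqrtr_sqr (ger0_norm (mulr_ge0 (ler0n _ _) (ltW d0))) -/s.
have eE : e = n.+1%:R * (s + 1) * d by rewrite /d mulrC divfK// gt_eqF// mulr_gt0// ltr_wpDl.
rewrite eE -natr1 -subr_ge0.
have -> : (n%:R + 1) * (s + 1) * d - n%:R * d * s = n%:R * d + (s + 1) * d by ring.
by rewrite addr_ge0// mulr_ge0// ?ltW// ltr_wpDl.
Qed.

End UpperEnergy.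

(** * Truncation of the completed space *)

Section Truncation.
Context (R : realType) (T : R) (H : completeNormedModType R) (ip : inner_product H).
Hypothesis T0 : 0 < T.
Hypothesis Hsep : separable_space H.
Local Notation Om := (Omega T H).
Local Notation prob := (probability Om R).
Variable PP : set prob.
Hypothesis PP0 : PP !=set0.
Variable a : prob -> Om -> R -> H -> H.
Variable G : R.
Hypothesis G0 : 0 <= G.
Hypothesis regG : regularizable ip PP a G.
Variables (HH : completeNormedModType R) (j : (Om -> R -> H) -> HH).
Hypothesis completion : energy_completion ip PP a j.

Local Notation el := (@elementary R T H).

Lemma completion_lin c Z Z' : el Z -> el Z' -> j (c *: Z + Z') = c *: j Z + j Z'.
Proof. by case: completion => h _ _; exact: h. Qed.

Lemma completionB Z Z' : el Z -> el Z' -> j (Z - Z') = j Z - j Z'.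
Proof.
by move=> eZ eZ'; rewrite addrC -scaleN1r completion_lin// scaleN1r addrC.
Qed.

Lemma completion_norm Z : el Z -> (`|j Z|)%:E = energy ip PP a Z.
Proof. by case: completion => _ h _; exact: h. Qed.

Lemma completion_dense : dense (j @` el).
Proof. by case: completion. Qed.

Lemma restrict_lin (r : Om -> R) (c : R) (Z Z' : Om -> R -> H) :
  Defs.restrict r (c *: Z + Z') = c *: Defs.restrict r Z + Defs.restrict r Z'.
Proof.
apply/funext => w; apply/funext => t; rewrite field_linE /Defs.restrict.
by case: ifP => // _; rewrite scaler0 addr0.
Qed.

Lemma dyadic_truncation tau n : raw_stopping tau ->
  exists D, pointwise_truncation j (dyadic_ceil tau n) D.
Proof.
move=> st; have er := elementary_restrict T0 Hsep n st.
have [|||||D cD DE] := @extend_contraction _ _ HH el j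
    (fun e => j (Defs.restrict (dyadic_ceil tau n) e)).
- by move=> c e e'; exact: elementary_lin.
- by move=> c e e'; exact: completion_lin.
- by move=> c e e' he he'; rewrite restrict_lin completion_lin//; exact: er.
- move=> e he; rewrite -lee_fin !completion_norm//; last exact: er.
  by apply: (energy_restrict Hsep regG) => //; exact: er.
- exact: completion_dense.
by exists D; split => // e he; split; [exact: er|exact: DE].
Qed.

(** The difference of the two restrictions vanishes outside the random interval
    between the smaller and the larger horizon. *)
Lemma restrict_dist Z C d r r' : el Z -> el (Defs.restrict r Z) -> el (Defs.restrict r' Z) ->
  (forall w t, `|Z w t| <= C) -> (forall w, 0 <= r w) -> (forall w, 0 <= r' w) ->
  (forall w, `|r w - r' w| <= d) ->
  `|j (Defs.restrict r Z) - j (Defs.restrict r' Z)| <= Num.sqrt (G * C ^+ 2 * d).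
Proof.
move=> eZ erZ erZ' ZC r0 r0' rd.
have es : el (Defs.restrict r Z - Defs.restrict r' Z) by exact: elementary_sub.
have C0 : 0 <= C by apply: le_trans (ZC point 0).
rewrite -completionB// -lee_fin completion_norm//; apply: (energy_short Hsep G0 regG es).
  move=> w t; change (`|Defs.restrict r Z w t - Defs.restrict r' Z w t| <= C).
  by rewrite /Defs.restrict; case: ifP => _; case: ifP => _;
    rewrite ?subrr ?subr0 ?sub0r ?normrN ?normr0.
move=> w; exists (Num.min (r w) (r' w)), (Num.max (r w) (r' w)); split.
- by rewrite ge_min le_max lexx.
- have := rd w; rewrite ler_norml => /andP[h1 h2].
  by case: (leP (r w) (r' w)) => h; lra.
move=> t; change (~~ (Num.min (r w) (r' w) < t <= Num.max (r w) (r' w)) ->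
  Defs.restrict r Z w t - Defs.restrict r' Z w t = 0).
rewrite gt_min le_max /Defs.restrict !ltNge.
by case: (0 <= t) => //=; case: (t <= r w) => //=; case: (t <= r' w) => //=; rewrite ?subrr.
Qed.

Lemma elementary_bounded Z : el Z -> exists C : R, forall w t, `|Z w t| <= C.
Proof. by move=> [z ->]; case: (step_field_bounded z). Qed.

Lemma dyadic_ceil_ge0 (tau : Om -> R) n w : raw_stopping tau -> 0 <= dyadic_ceil tau n w.
Proof. by move=> st; case: (dyadic_ceil_stopping T0 n st) => /(_ w)/andP[]. Qed.

Lemma pointwise_truncation_elementary rho D e : pointwise_truncation j rho D -> el e ->
  el (Defs.restrict rho e) /\ D (j e) = j (Defs.restrict rho e).
Proof. by case=> _; exact. Qed.

Lemma truncation_exists tau : raw_stopping tau -> exists L, truncation j tau L.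
Proof.
move=> st; have /choice[D hD] := fun n => dyadic_truncation n st.
have [||z [e he <-]|L cL DL] := @contractions_limit _ HH D (j @` el).
- by move=> n; case: (hD n).
- exact: completion_dense.
- have [C hC] := elementary_bounded he.
  apply/cauchy_cvgP/cauchy_exP => eps eps0.
  have K0 : 0 <= G * C ^+ 2 by rewrite mulr_ge0// sqr_ge0.
  have e20 : 0 < eps / 2 by rewrite divr_gt0.
  have [d d0 sd] := sqrt_small K0 e20.
  have d20 : 0 < d / 2 by rewrite divr_gt0.
  have [N _ hN] := dyadic_mesh_small T d20.
  exists (D N (j e)); exists N => // n Nn; rewrite -ball_normE /=.
  have [e1 ->] := pointwise_truncation_elementary (hD N) he.
  have [e2 ->] := pointwise_truncation_elementary (hD n) he.
  apply: (@le_lt_trans _ _ (eps / 2)); last by rewrite ltr_pdivrMr// ltr_pMr// ltr1n.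
  apply: le_trans sd; apply: restrict_dist => // [w|w|w]; try exact: dyadic_ceil_ge0.
  rewrite (le_trans (ler_distD (tau w) _ _))// (splitr d) lerD//.
    by rewrite (le_trans (dyadic_ceil_dist T0 _ _ _))//; apply: hN => /=.
  by rewrite distrC (le_trans (dyadic_ceil_dist T0 _ _ _))//; exact: hN.
by exists L; split => //; exists D.
Qed.

(** A truncation is prescribed on elementary fields at each dyadic level, hence
    its values on a dense set are prescribed limits. *)
Lemma truncation_unique tau L L' : truncation j tau L -> truncation j tau L' -> L = L'.
Proof.
move=> [cL [D hD DL]] [cL' [D' hD' DL']].
apply: (contraction_agree cL cL' completion_dense) => _ [e he <-].
have DD : (fun n => D n (j e)) = (fun n => D' n (j e)).
  apply/funext => n; have [_ ->] := pointwise_truncation_elementary (hD n) he.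
  by have [_ ->] := pointwise_truncation_elementary (hD' n) he.
have c1 := DL (j e); have c2 := DL' (j e); rewrite -DD in c2.
exact: (cvg_unique _ c1 c2).
Qed.

(** On an elementary field, [restrict_dist] applies at each dyadic level, where the
    ceilings add at most two mesh sizes to the distance of the horizons; the
    general case follows by contraction from a nearby elementary field. *)
Lemma truncation_horizon Z (e : R) : 0 < e -> exists2 d, 0 < d &
  forall sigma tau L M, raw_stopping sigma -> raw_stopping tau ->
    truncation j sigma L -> truncation j tau M ->
    (forall w, `|sigma w - tau w| <= d) -> `|L Z - M Z| <= e.
Proof.
move=> e0; have e30 : 0 < e / 3 by rewrite divr_gt0.
have [_ [f hf <-] fZ] := dense_near Z completion_dense e30.
have [C hC] := elementary_bounded hf.
have K0 : 0 <= G * C ^+ 2 by rewrite mulr_ge0// sqr_ge0.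
have [d d0 sd] := sqrt_small K0 e30; have d30 : 0 < d / 3 by rewrite divr_gt0.
exists (d / 3) => // sigma tau L M ss st [cL [D hD DL]] [cM [E hE EM]] h.
have k : `|L (j f) - M (j f)| <= e / 3.
  have c1 : `|D n (j f) - E n (j f)| @[n --> \oo] --> `|L (j f) - M (j f)|.
    by apply: cvg_norm; apply: cvgB; [exact: DL|exact: EM].
  rewrite -(cvg_lim _ c1)//; apply: limr_le; first by apply/cvg_ex; eexists; exact: c1.
  apply: filterS (dyadic_mesh_small T d30) => n hn.
  have [e1 ->] := pointwise_truncation_elementary (hD n) hf.
  have [e2 ->] := pointwise_truncation_elementary (hE n) hf.
  apply: le_trans sd; apply: restrict_dist => // [w|w|w]; try exact: dyadic_ceil_ge0.
  have := dyadic_ceil_dist T0 sigma n w; have := dyadic_ceil_dist T0 tau n w; have := h w.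
  set x := dyadic_ceil sigma n w; set y := dyadic_ceil tau n w.
  move: hn; set m := T / _ => hn; rewrite !ler_norml => /andP[? ?] /andP[? ?] /andP[? ?].
  by apply/andP; split; lra.
have l1 := contraction_norm_sub Z (j f) cL; have l2 := contraction_norm_sub (j f) Z cM.
have l3 := ler_distD (L (j f)) (L Z) (M Z).
have l4 := ler_distD (M (j f)) (L (j f)) (M Z).
rewrite (distrC (j f)) in l2; lra.
Qed.

End Truncation.

(** * The extended integral *)

Section Integral.
Context (R : realType) (T : R) (H : completeNormedModType R) (ip : inner_product H).
Hypothesis T0 : 0 < T.
Hypothesis Hsep : separable_space H.
Local Notation Om := (Omega T H).
Local Notation prob := (probability Om R).
Variable PP : set prob.
Hypothesis PP0 : PP !=set0.
Variable a : prob -> Om -> R -> H -> H.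
Variable G : R.
Hypothesis G0 : 0 <= G.
Hypothesis regG : regularizable ip PP a G.
Variables (HH : completeNormedModType R) (j : (Om -> R -> H) -> HH).
Hypothesis completion : energy_completion ip PP a j.
Variable I : HH -> Om -> R -> R.
Hypothesis extension : step_integral_extension ip PP j I.

Local Notation el := (@elementary R T H).

Lemma integral_cont_process Z : cont_process (I Z).
Proof. by case: extension => /(_ Z)[]. Qed.

Lemma integral_continuous Z : continuous_process (I Z).
Proof. exact/cont_process_continuous/integral_cont_process. Qed.

Lemma step_extensionB Z Z' : qs_eq PP (I (Z - Z')) (I Z - I Z').
Proof.
case: extension => _ lin _ _ P PPP; apply: filterS (lin (-1) Z' Z P PPP) => w h t tT.
rewrite addrC -scaleN1r h//.
by change (-1 * I Z' w t + I Z w t = I Z w t - I Z' w t); ring.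
Qed.

Lemma integral_bound : exists2 C, 0 <= C &
  forall Z, (S2_norm PP (I Z) <= (C * `|Z|)%:E)%E.
Proof.
case: extension => _ _ [C hC] _; exists `|C| => // Z; apply: (le_trans (hC Z)).
by rewrite lee_fin ler_wpM2r// ler_norm.
Qed.

Lemma upper_L2_qs (f g : Om -> R) : measurable_fun setT f -> measurable_fun setT g ->
  quasi_surely PP (fun w => f w = g w) -> upper_L2 PP f = upper_L2 PP g.
Proof.
move=> mf mg fg; apply/eqP; rewrite eq_le; apply/andP; split; apply: upper_L2_le => // P PPP;
  by apply: filterS (fg P PPP) => w ->.
Qed.

Let TT : 0 <= T <= T. Proof. by rewrite lexx (ltW T0). Qed.

Lemma integral_measurable Z t : measurable_fun setT (fun w => I Z w t).
Proof. by case: (integral_cont_process Z) => _; exact. Qed.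

Lemma countable_dense Z (e : R) : 0 < e ->
  exists2 z, step_countable z & `|Z - j (step_field z)| <= e.
Proof.
move=> e0; have e20 : 0 < e / 2 by rewrite divr_gt0.
have [_ [f ef <-] fZ] := dense_near Z (completion_dense completion) e20.
have [z cz hz] := step_countable_approx T0 Hsep G0 regG ef e20.
exists z => //; rewrite (le_trans (ler_distD (j f) _ _))// (splitr e) lerD//; first exact: ltW.
have ez : el (step_field z) by exists z.
rewrite -(completionB completion)// -lee_fin (completion_norm completion)//.
exact: elementary_sub.
Qed.

Lemma integral_step z : qs_eq PP (I (j (step_field z))) (step_integral ip z).
Proof. by case: extension. Qed.

Lemma upper_L2_near C Z Z' : (forall Z, (S2_norm PP (I Z) <= (C * `|Z|)%:E)%E) ->
  (upper_L2 PP (fun w => I Z w T) <= upper_L2 PP (fun w => I Z' w T) + (C * `|Z - Z'|)%:E)%E.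
Proof.
move=> hC; apply: (@le_trans _ _ (upper_L2 PP (fun w => I Z' w T) +
   upper_L2 PP (fun w => I (Z - Z')%R w T))%E).
  apply: upper_L2_triangle; try exact: integral_measurable.
  move=> P PPP; apply: filterS (step_extensionB Z Z' PPP) => w /(_ T TT) ->.
  change (`|I Z w T| <= `|I Z' w T| + `|I Z w T - I Z' w T|).
  by rewrite -{1}(subrKC (I Z' w T) (I Z w T)) ler_normD.
rewrite leeD2l//; apply: le_trans (hC _).
have := upper_L2_le_S2 T0 PP (integral_continuous (Z - Z')) TT.
exact.
Qed.

Lemma S2_norm_near C Z Z' : (forall Z, (S2_norm PP (I Z) <= (C * `|Z|)%:E)%E) ->
  (S2_norm PP (I Z) <= S2_norm PP (I Z') + (C * `|Z - Z'|)%:E)%E.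
Proof.
move=> hC; apply: (@le_trans _ _ (S2_norm PP (I Z') + S2_norm PP (I (Z - Z')%R))%E).
  apply: S2_norm_triangle => //; try exact: integral_continuous.
  move=> P PPP; apply: filterS (step_extensionB Z Z' PPP) => w h t tT; rewrite h//.
  change (`|I Z w t| <= `|I Z' w t| + `|I Z w t - I Z' w t|).
  by rewrite -{1}(subrKC (I Z' w t) (I Z w t)) ler_normD.
by rewrite leeD2l.
Qed.

(** Both sides depend continuously on Z, the right one because the integral is
    bounded, and they agree on the countably valued step fields. *)
Lemma integral_isometry Z : (`|Z|)%:E = upper_L2 PP (fun w => I Z w T).
Proof.
have [C C0 hC] := integral_bound.
have step z : step_countable z ->
    upper_L2 PP (fun w => I (j (step_field z)) w T) = (`|j (step_field z)|)%:E.
  move=> cz; have [_ mz] := step_continuous_process Hsep regG PP0 cz.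
  rewrite (completion_norm completion); last by exists z.
  rewrite -(step_upper_L2 Hsep regG cz); apply: upper_L2_qs => //.
  - exact: integral_measurable.
  - exact: mz.
  - by move=> P PPP; apply: filterS (integral_step z PPP) => w; exact.
have C1 : 0 < C + 1 by rewrite ltr_wpDl.
apply/eqP; rewrite eq_le; apply/andP; split; apply/lee_addgt0Pr => e e0;
  have d0 : 0 < e / (C + 1) by [rewrite divr_gt0];
  have [z cz hz] := countable_dense Z d0; set W := j _ in hz;
  have hz' : `|W - Z| <= e / (C + 1) by [rewrite distrC];
  have eE : e = e / (C + 1) * C + e / (C + 1) by [rewrite -[X in _ + X]mulr1 -mulrDr divfK// gt_eqF];
  move: hz hz' eE; set d := e / (C + 1) => hz hz' eE.
- have h1 : `|Z| <= `|W| + d.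
    by rewrite -(subrK W Z) addrC (le_trans (ler_normD _ _))// lerD.
  have h2 := upper_L2_near W Z hC; rewrite step// in h2.
  apply: (@le_trans _ _ (`|W|%:E + d%:E)%E); first by rewrite -EFinD lee_fin.
  rewrite eE EFinD addeA leeD2r//; apply: (le_trans h2); rewrite leeD2l//.
  by rewrite lee_fin mulrC ler_wpM2r.
- have h1 : `|W| <= `|Z| + d.
    by rewrite -(subrK Z W) addrC (le_trans (ler_normD _ _))// lerD.
  apply: (le_trans (upper_L2_near Z W hC)); rewrite step// -!EFinD lee_fin.
  have : C * `|Z - W| <= C * d by rewrite ler_wpM2l.
  lra.
Qed.

Lemma integral_maximal Z : (S2_norm PP (I Z) <= 2%:E * (`|Z|)%:E)%E.
Proof.
have [C C0 hC] := integral_bound.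
have C2 : 0 < C + 2 by rewrite ltr_wpDl.
apply/lee_addgt0Pr => e e0; have d0 : 0 < e / (C + 2) by rewrite divr_gt0.
have [z cz hz] := countable_dense Z d0; set W := j _ in hz.
have eE : e = e / (C + 2) * (C + 2) by rewrite divfK// gt_eqF.
move: hz eE; set d := e / (C + 2) => hz eE.
have h1 : `|W| <= `|Z| + d.
  by rewrite -(subrK Z W) addrC (le_trans (ler_normD _ _))// lerD// distrC.
apply: (le_trans (S2_norm_near Z W hC)).
have hW : (S2_norm PP (I W) <= 2%:E * (`|W|)%:E)%E.
  rewrite (S2_norm_qs T0 (integral_continuous _) _ (integral_step z)); last first.
    exact: (step_continuous_process Hsep regG PP0 cz).
  rewrite (completion_norm completion); last by exists z.
  exact: (step_S2_norm T0 Hsep regG PP0 cz).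
apply: (@le_trans _ _ (2%:E * (`|W|)%:E + (C * `|Z - W|)%:E)%E); first by rewrite leeD2r.
rewrite -!EFinM -!EFinD lee_fin.
have : C * `|Z - W| <= C * d by rewrite ler_wpM2l.
nra.
Qed.

(** The zero of the completion has integral of norm zero at time T, by the isometry
    itself; this is the value compared with that of the difference. *)
Lemma integral_injective Z Z' : qs_eq PP (I Z) (I Z') -> Z = Z'.
Proof.
move=> ZZ'; apply/eqP; rewrite -subr_eq0 -normr_le0 -lee_fin integral_isometry.
have -> : 0%:E = upper_L2 PP (fun w => I 0 w T) by rewrite -integral_isometry normr0.
apply: upper_L2_le; try exact: integral_measurable.
move=> P PPP; have := step_extensionB Z Z' PPP; have := step_extensionB 0 0 PPP; have := ZZ' P PPP.
rewrite subrr; apply: filterS3 => w h1 h2 h3.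
rewrite h3// h2//; change (`|I Z w T - I Z' w T| <= `|I 0 w T - I 0 w T|).
by rewrite h1// !subrr.
Qed.

Lemma stopped_qs (tau : Om -> R) (Y Y' : Om -> R -> R) : raw_stopping tau -> qs_eq PP Y Y' ->
  qs_eq PP (stopped tau Y) (stopped tau Y').
Proof.
move=> [h _] YY' P PPP; apply: filterS (YY' P PPP) => w e t /andP[t0 tT].
by apply: e; have /andP[w0 wT] := h w; rewrite le_min t0 w0 ge_min tT.
Qed.

(** Both sides are continuous in Z, stopping being contractive for the supremum
    norm, and they agree on elementary fields by [step_integral_restrict]. *)
Lemma integral_dyadic tau n D Z : raw_stopping tau ->
  pointwise_truncation j (dyadic_ceil tau n) D ->
  qs_eq PP (I (D Z)) (stopped (dyadic_ceil tau n) (I Z)).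
Proof.
move=> st hD; have sr := dyadic_ceil_stopping T0 n st; set rho := dyadic_ceil tau n in hD sr *.
have cs W : continuous_process (stopped rho (I W)).
  exact: continuous_process_stopped (integral_continuous W).
apply: (S2_norm0_qs T0 (integral_continuous _)) => //.
apply/lee_addgt0Pr => e e0; have d0 : 0 < e / 4 by rewrite divr_gt0.
have [_ [f ef <-] fZ] := dense_near Z (completion_dense completion) d0.
have [z [z' [fz fz' sz]]] := step_integral_restrict ip T0 Hsep n st ef.
have [erf Df] := pointwise_truncation_elementary hD ef.
have If : qs_eq PP (I (D (j f))) (stopped rho (I (j f))).
  move=> P PPP; rewrite Df -fz' -fz.
  have := integral_step z' PPP; have := stopped_qs sr (integral_step z) PPP.
  by apply: filterS2 => w h1 h2 t tT; rewrite h2// sz -h1.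
apply: (@le_trans _ _ (S2_norm PP (I (D Z - D (j f))%R) + S2_norm PP (stopped rho (I (j f - Z)%R)))%E).
  apply: S2_norm_triangle => //; try exact: integral_continuous.
    by apply: continuous_processB => //; exact: integral_continuous.
  move=> P PPP; have := step_extensionB (D Z) (D (j f)) PPP; have := If P PPP.
  have := stopped_qs sr (step_extensionB (j f) Z) PPP.
  apply: filterS3 => w h1 h2 h3 t tT; rewrite h1// h3//.
  change (`|I (D Z) w t - stopped rho (I Z) w t| <= `|I (D Z) w t - I (D (j f)) w t| +
     `|stopped rho (I (j f)) w t - stopped rho (I Z) w t|).
  by rewrite -h2//; exact: ler_distD.
have cD : Defs.contraction D by case: hD.
have l1 : (S2_norm PP (I (D Z - D (j f))%R) <= (2 * (e / 4))%:E)%E.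
  apply: (le_trans (integral_maximal _)); rewrite -EFinM lee_fin ler_wpM2l//.
  by rewrite (le_trans (contraction_norm_sub _ _ cD))// ltW.
have l2 : (S2_norm PP (stopped rho (I (j f - Z)%R)) <= (2 * (e / 4))%:E)%E.
  apply: (le_trans (S2_norm_stopped T0 _ sr (integral_continuous _))).
  apply: (le_trans (integral_maximal _)); rewrite -EFinM lee_fin ler_wpM2l//.
  by rewrite distrC ltW.
rewrite add0e (_ : e = 2 * (e / 4) + 2 * (e / 4)); last by field.
by rewrite EFinD leeD.
Qed.

Lemma stopped_traj (tau : Om -> R) (Y : Om -> R -> R) :
  raw_stopping tau -> (forall w, traj T (Y w)) -> forall w, traj T (stopped tau Y w).
Proof.
move=> st tY w; have [cY eY] := tY w; have [h _] := st; have /andP[w0 wT] := h w.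
split; last first.
  move=> t; rewrite /stopped /clamp.
  have [t0|t0] := ltP 0 t.
    have [tT|tT] := leP T t.
      by rewrite (min_idPr (le_trans wT tT)) (min_idPr wT).
    by [].
  rewrite (min_idPr (ltW T0)) (min_idPl (le_trans t0 w0)) (min_idPl w0) eY /clamp.
  by rewrite (max_idPl t0) (min_idPr (ltW T0)).
move=> t; apply: (@continuous_comp _ _ _ (fun t => Num.min t (tau w)) (Y w) t); last exact: cY.
by apply: continuous_min; [exact: cvg_id|exact: cvg_cst].
Qed.

(** Lets a quasi-sure equality be checked at countably many times. *)
Lemma traj_rat (f g : R -> R) : traj T f -> traj T g ->
  (forall q : rat, f (clamp T (ratr q)) = g (clamp T (ratr q))) -> f = g.
Proof.
move=> [cf ef] [cg eg] fg; apply/funext => t; apply/eqP; apply: contrapT => /negP ne.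
have co : open [set t | f t - g t != 0].
  have c : continuous (f \- g) by move=> x; apply: continuousB; [exact: cf|exact: cg].
  have -> : [set t | f t - g t != 0] = (f \- g) @^-1` [set x | x != 0] by [].
  by apply: open_comp; [move=> x _; exact: c|exact: open_neq].
have [|x [/= xn [q _ qx]]] := @dense_rat R _ _ co; first by exists t => /=; rewrite subr_eq0.
by move: xn; rewrite -qx ef eg fg subrr eqxx.
Qed.

Lemma stopped_cont_process (tau : Om -> R) (Y : Om -> R -> R) :
  raw_stopping tau -> cont_process Y -> cont_process (stopped tau Y).
Proof.
move=> st [tY mY]; have tS := stopped_traj st tY; split => // t.
rewrite (_ : (fun w => _) = (fun w => stopped tau Y w (clamp T t))).
  have /andP[c0 _] := clamp_itv T0 t.
  by apply: stopped_measurable => // w; case: (tY w).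
by apply/funext => w; case: (tS w) => _ ->.
Qed.

(** At a fixed time, the integrals of the dyadic truncations converge in mean
    square to the integral of the truncation, while the integrals stopped at the
    dyadic ceilings converge along each path to the integral stopped at tau;
    Fatou's lemma identifies the two limits. *)
Lemma integral_truncation tau L Z : raw_stopping tau -> truncation j tau L ->
  qs_eq PP (I (L Z)) (stopped tau (I Z)).
Proof.
move=> st [cL [D hD DL]] P PPP.
have cS := stopped_cont_process st (integral_cont_process Z).
have cD n := stopped_cont_process (dyadic_ceil_stopping T0 n st) (integral_cont_process Z).
have at_time t : 0 <= t <= T -> {ae P, forall w, I (L Z) w t - stopped tau (I Z) w t = 0}.
  move=> tT; apply: Lnorm2_ae0 => [|e e0].
    by apply: measurable_funB; [exact: integral_measurable|case: cS].
  have e20 : 0 < e / 2 by rewrite divr_gt0.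
  have /cvgrPdist_le/(_ _ e20)[N _ hN] := DL Z.
  (* The bound holds from rank N on, so the sequence is started there. *)
  apply: (@Lnorm2_fatou _ _ _ P
    (fun n w => I (L Z) w t - stopped (dyadic_ceil tau (n + N)) (I Z) w t) _ _ (ltW e0)).
  - by move=> n; apply: measurable_funB; [exact: integral_measurable|case: (cD (n + N)%N)].
  - by apply: measurable_funB; [exact: integral_measurable|case: cS].
  - apply: nearW => w; apply: cvgB; first exact: cvg_cst.
    have cI : continuous (I Z w) by case: (integral_continuous Z).
    rewrite /stopped; apply: (@cvg_comp _ _ _ (fun n => Num.min t (dyadic_ceil tau (n + N) w)) (I Z w)); last exact: cI.
    have ct : continuous (fun s : R => Num.min t s).
      by move=> s; apply: continuous_min; [exact: cvg_cst|exact: cvg_id].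
    apply: (@cvg_comp _ _ _ (fun n => dyadic_ceil tau (n + N) w) (fun s => Num.min t s)); last exact: ct.
    have := @dyadic_ceil_cvg _ _ _ T0 tau w; rewrite -(cvg_shiftn N).
    exact.
  - move=> n; have -> : e = 2 * (e / 2) by field.
    apply: (@le_trans _ _ (S2_norm PP (I (L Z - D (n + N)%N Z)%R))).
      have tI := upper_L2_le_S2 T0 PP (integral_continuous (L Z - D (n + N)%N Z)) tT.
      apply: le_trans tI; apply: le_trans (upper_L2_ub _ PPP); apply: le_Lnorm2.
      + by apply: measurable_funB; [exact: integral_measurable|case: (cD (n + N)%N)].
      + exact: integral_measurable.
      + have := integral_dyadic Z st (hD (n + N)%N) PPP; have := step_extensionB (L Z) (D (n + N)%N Z) PPP.
        by apply: filterS2 => w h1 h2; rewrite h1// -h2.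
    apply: (le_trans (integral_maximal _)); rewrite -EFinM lee_fin ler_wpM2l//.
    by apply: hN => /=; rewrite leq_addl.
have all_rat : {ae P, forall w, forall q : rat,
    I (L Z) w (clamp T (ratr q)) = stopped tau (I Z) w (clamp T (ratr q))}.
  have : {ae P, forall w, forall n : nat, forall q : rat, unpickle n = Some q ->
      I (L Z) w (clamp T (ratr q)) = stopped tau (I Z) w (clamp T (ratr q))}.
    apply: ae_foralln => n; case: (unpickle n) => [q|]; last by apply: nearW.
    apply: filterS (at_time _ (clamp_itv T0 (ratr q))) => w /eqP; rewrite subr_eq0 => /eqP h q' [<-].
    exact: h.
  by apply: filterS => w h q; apply: (h (pickle q)); rewrite pickleK.
apply: filterS all_rat => w h t _; congr (_ t); apply: traj_rat => //.
  by case: (integral_cont_process (L Z)).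
by case: cS.
Qed.

(** Approximants of the integral of the truncation are also approximants of the
    stopped integral, which equals it quasi-surely. *)
Lemma stopped_S2 tau L Z : raw_stopping tau -> truncation j tau L -> S2 PP (stopped tau (I Z)).
Proof.
move=> st hL; have cS := stopped_cont_process st (integral_cont_process Z); split => // e e0.
have qs := integral_truncation Z st hL.
case: extension => /(_ (L Z))[_ /(_ e e0)[Y' gY' hY']] _ _ _; exists Y' => //.
have cY' : continuous_process Y' by apply: cont_process_continuous; case: gY'.
rewrite -(S2_norm_qs T0 (Y := I (L Z) - Y'))//.
- exact: continuous_processB (integral_continuous _) cY'.
- by apply: continuous_processB => //; exact: cont_process_continuous.
- move=> P PPP; apply: filterS (qs P PPP) => w h t tT.
  by change (I (L Z) w t - Y' w t = stopped tau (I Z) w t - Y' w t); rewrite h.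
Qed.

End Integral.

(** * The truncation theorem *)

Theorem proposition8p16 (R : realType) (T : R) (T_gt0 : 0 < T)
    (H : completeNormedModType R) (ip : inner_product H)
    (H_separable : separable_space H) (H_nonzero : exists x : H, x <> 0)
    (Gamma : H -> H) (Gamma_S1 : pos_trace_class ip Gamma)
    (PP : set (probability (Omega T H) R)) (PP_nonempty : PP !=set0)
    (PP_sub : PP `<=` law_class ip Gamma)
    (a : probability (Omega T H) R -> Omega T H -> R -> H -> H)
    (a_density : forall P, PP P -> bracket_density ip Gamma P (a P))
    (HH : completeNormedModType R) (j : (Omega T H -> R -> H) -> HH)
    (HH_completion : energy_completion ip PP a j)
    (I : HH -> Omega T H -> R -> R)
    (I_extension : step_integral_extension ip PP j I) :
  exists trunc : (Omega T H -> R) -> HH -> HH,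
  [/\ (forall tau, raw_stopping tau ->
         truncation j tau (trunc tau) /\
         forall L, truncation j tau L -> L = trunc tau),
      (forall tau Z, raw_stopping tau ->
         S2 PP (stopped tau (I Z)) /\
         qs_eq PP (I (trunc tau Z)) (stopped tau (I Z))) /\
      (forall sigma tau Z, raw_stopping sigma -> raw_stopping tau ->
         trunc sigma (trunc tau Z) =
         trunc (fun w => Num.min (sigma w) (tau w)) Z),
      (forall (tau_ : nat -> Omega T H -> R) (tau : Omega T H -> R),
         (forall n, raw_stopping (tau_ n)) -> raw_stopping tau ->
         ereal_sup (range (fun w => (`|tau_ n w - tau w|)%:E))
           @[n --> \oo] --> 0%E ->
         forall Z,
           ((`|trunc (tau_ n) Z - trunc tau Z|)%:E +
            S2_norm PP (stopped (tau_ n) (I Z) - stopped tau (I Z))%R)%E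
           @[n --> \oo] --> 0%E),
      (forall tau Z, raw_stopping tau ->
         (`|trunc tau Z|)%:E = upper_L2 PP (fun w => I Z w (tau w))) /\
      (forall t Z, 0 <= t <= T ->
         (`|trunc (cst t) Z|)%:E = upper_L2 PP (fun w => I Z w t))
    & (forall Z,
         [/\ (`|Z|)%:E = upper_L2 PP (fun w => I Z w T),
             (upper_L2 PP (fun w => I Z w T) <= S2_norm PP (I Z))%E
           & (S2_norm PP (I Z) <= 2%:E * (`|Z|)%:E)%E]) /\
      (forall (B : set H) (frak : Omega T H -> R -> H -> H)
          (YY : set (Omega T H -> R -> R))
          (cov : (Omega T H -> R -> R) -> H -> Omega T H -> R -> R),
         orthonormal_basis ip B ->
         common_bracket_density ip PP a frak ->
         admissible_core ip PP j B frak YY cov ->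
         forall Y Z Y' Z',
           jet_graph ip PP j B frak YY cov (Y, Z) ->
           jet_graph ip PP j B frak YY cov (Y', Z') ->
           dW PP (Y, Z) (Y', Z') =
           (S2_norm PP (Y - Y')%R + upper_L2 PP (fun w => I (Z - Z')%R w T))%E)].
Proof.
have [nG _] := Gamma_S1.
have [G G0 regG] := law_regularizable T_gt0 H_separable nG PP_sub a_density.
have TT : 0 <= T <= T by rewrite lexx ltW.
have /choice[trunc tr] : forall tau, exists L, raw_stopping tau -> truncation j tau L.
  move=> tau; have [st|ns] := pselect (raw_stopping tau); last by exists id.
  have [L hL] := truncation_exists T_gt0 H_separable G0 regG HH_completion st.
  by exists L.
have iso := integral_isometry T_gt0 H_separable PP_nonempty G0 regG HH_completion I_extension.
have maxi := integral_maximal T_gt0 H_separable PP_nonempty G0 regG HH_completion I_extension.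
have mI := integral_measurable I_extension.
have cI := integral_continuous I_extension.
have stop tau Z (st : raw_stopping tau) :=
  integral_truncation T_gt0 H_separable PP_nonempty G0 regG HH_completion I_extension Z st (tr tau st).
have norm_trunc tau Z : raw_stopping tau ->
    (`|trunc tau Z|)%:E = upper_L2 PP (fun w => I Z w (tau w)).
  move=> st; rewrite iso; have [h _] := st.
  have at_T w : stopped tau (I Z) w T = I Z w (tau w).
    by rewrite /stopped; have /andP[_ /min_idPr ->] := h w.
  apply: upper_L2_qs; first exact: mI.
    rewrite (_ : (fun w => _) = (fun w => stopped tau (I Z) w T)).
      by case: (continuous_process_stopped T_gt0 st (cI Z)) => _; apply.
    by apply/funext => w; rewrite at_T.
  by move=> P PPP; apply: filterS (stop tau Z st P PPP) => w /(_ T TT); rewrite at_T.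
exists trunc; split.
- move=> tau st; split; first exact: tr.
  by move=> L hL; apply: (truncation_unique HH_completion hL); exact: tr.
- split=> [tau Z st|sigma tau Z ss st].
    split; last exact: stop.
    exact: (stopped_S2 T_gt0 H_separable PP_nonempty G0 regG HH_completion I_extension Z st (tr tau st)).
  apply: (integral_injective T_gt0 H_separable PP_nonempty G0 regG HH_completion I_extension).
  have sm := raw_stopping_min ss st.
  move=> P PPP; have h1 := stop sigma (trunc tau Z) ss P PPP.
  have h2 := stopped_qs ss (stop tau Z st) PPP; have h3 := stop _ Z sm P PPP.
  apply: filterS3 h1 h2 h3 => w h1 h2 h3 t tT.
  by rewrite h1// h2// h3// /stopped minA.
- move=> tau_ tau st_ st sup0 Z.
  have diff n : (S2_norm PP (stopped (tau_ n) (I Z) - stopped tau (I Z))%R <=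
      2%:E * (`|trunc (tau_ n) Z - trunc tau Z|)%:E)%E.
    apply: le_trans (maxi _); apply: S2_norm_le => //.
      by apply: continuous_processB; exact: continuous_process_stopped.
    move=> P PPP; have h1 := stop (tau_ n) Z (st_ n) P PPP; have h2 := stop tau Z st P PPP.
    have h3 := step_extensionB I_extension (trunc (tau_ n) Z) (trunc tau Z) PPP.
    apply: filterS3 h1 h2 h3 => w h1 h2 h3 t tT.
    apply: le_trans (usup_ub T_gt0 _ tT); last by case: (cI (trunc (tau_ n) Z - trunc tau Z)).
    rewrite h3//; change (`|stopped (tau_ n) (I Z) w t - stopped tau (I Z) w t| <=
      `|I (trunc (tau_ n) Z) w t - I (trunc tau Z) w t|).
    by rewrite h1// h2.
  have tz : `|trunc (tau_ n) Z - trunc tau Z| @[n --> \oo] --> (0 : R).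
    apply/cvgr0Pnorm_le => e e0.
    have [d d0 hd] := truncation_horizon T_gt0 H_separable G0 regG HH_completion Z e0.
    have dE : (0 < d%:E)%E by rewrite lte_fin.
    have near_d : \forall n \near \oo,
        (ereal_sup (range (fun w => (`|tau_ n w - tau w|)%:E)) < d%:E)%E.
      by apply: (sup0 [set x | (x < d%:E)%E]); apply: open_nbhs_nbhs; split=> //; exact: open_ereal_lt_ereal.
    apply: filterS near_d => n hn; rewrite normr_id.
    apply: (hd (tau_ n) tau) => // [||w]; [exact: tr|exact: tr|].
    rewrite -lee_fin; apply: le_trans (ltW hn); apply: ereal_sup_ubound; by exists w.
  apply: (@squeeze_cvge _ _ _ _ (cst 0%E) _ (fun n => (3 * `|trunc (tau_ n) Z - trunc tau Z|)%:E)).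
  - apply: nearW => n; rewrite adde_ge0 ?S2_norm_ge0//=.
    apply: (@le_trans _ _ ((`|trunc (tau_ n) Z - trunc tau Z|)%:E +
      2%:E * (`|trunc (tau_ n) Z - trunc tau Z|)%:E)%E); first exact: leeD2l.
    by rewrite -EFinM -EFinD lee_fin; lra.
  - exact: cvg_cst.
  - apply: cvg_EFinT; rewrite -[X in _ --> X](mulr0 3); apply: cvgM => //; exact: cvg_cst.
- split=> // t Z tT; rewrite norm_trunc//; exact: raw_stopping_cst.
- split=> [Z|B frak YY cov _ _ _ Y Z Y' Z' _ _].
    split; [exact: iso|exact: upper_L2_le_S2|exact: maxi].
  by rewrite /dW /= iso.
Qed.
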